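(* Let $K$ be the finite field $\mathbf{F}_q$. Let $Z \cong K^\times$ be the center of $\mathrm{GL}_3(K)$. The maximal abelian subgroups of $\mathrm{PGL}_3(K) = \mathrm{GL}_3(K)/Z$ are, up to conjugacy: (i) identifying $K^3$ with the field $L = \mathbf{F}_{q^3}$, the cyclic group $L^\times / K^\times$; (ii) identifying $K^3$ with $L \times K$ where $L = \mathbf{F}_{q^2}$, the group $L^\times K^\times / K^\times$ (that is, the group $L^\times \times K^\times$ acting by coordinatewise multiplication, modulo the diagonally embedded scalars $K^\times$); (iii) the group $(K^\times)^3/Z \cong (K^\times)^2$ of diagonal matrices mod $Z$; (iv) \[ \left\{ \begin{pmatrix} r & a & 0 \\ 0 & r & 0 \\ 0 & 0 & 1 \end{pmatrix} : r \in K^\times,\ a \in K \right\} Z/Z \cong K^\times \times K; \] (v) \[ \left\{ \begin{pmatrix} 1 & a & b \\ 0 & 1 & a \\ 0 & 0 & 1 \end{pmatrix} : a, b \in K \right\} Z/Z \cong \begin{cases} K^2 & \text{if } q \text{ is odd},\\ C_4^d & \text{if } q = 2^d; \end{cases} \] (vi) \[ \left\{ \begin{pmatrix} 1 & 0 & b \\ 0 & 1 & a \\ 0 & 0 & 1 \end{pmatrix} : a, b \in K \right\} Z/Z \cong K^2; \] (vii) \[ \left\{ \begin{pmatrix} 1 & a & b \\ 0 & 1 & 0 \\ 0 & 0 & 1 \end{pmatrix} : a, b \in K \right\} Z/Z \cong K^2; \] (viii) (only if $q \equiv 1 \pmod 3$) the group $\langle g, h \rangle Z/Z \cong C_3 \times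 C_3$, where \[ g = \begin{pmatrix} 1 & 0 & 0 \\ 0 & \omega & 0 \\ 0 & 0 & \omega^2 \end{pmatrix}, \qquad h = \begin{pmatrix} 0 & 0 & 1 \\ 1 & 0 & 0 \\ 0 & 1 & 0 \end{pmatrix}, \] where $\omega \in K$ is a primitive cube root of unity; (ix) (only if $q \equiv 1 \pmod 3$) identifying $K^3$ with $L = \mathbf{F}_{q^3}$, the group \[ \langle (K^\times)^{1/3}, \mathrm{Frob}_q \rangle K^\times / K^\times \cong C_3 \times C_3, \] where $\mathrm{Frob}_q$ is the $x \mapsto x^q$ automorphism of $L/K$.
   Context: A maximal abelian subgroup is an abelian subgroup not properly contained in any other abelian subgroup. $C_m$ denotes the cyclic group of order $m$; in the isomorphism types, $K$ and $K^2$ denote additive groups and $K^\times$ the multiplicative group. When $K^3$ is identified as a $K$-vector space with a $K$-algebra $A$ ($A = \mathbf{F}_{q^3}$ or $A = \mathbf{F}_{q^2} \times K$), the units $A^\times$ are regarded as a subgroup of $\mathrm{GL}_3(K)$ acting by multiplication, and the quotient is by $K^\times$ acting as the scalars $Z$. In (ix), $(K^\times)^{1/3} = \{x \in L^\times : x^3 \in K^\times\}$, acting by multiplication on $L$, and $\mathrm{Frob}_q$ is regarded as a $K$-linear map $L \to L$.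
   Formalization: For q = 2 the groups (iii) and (iv) are left out of the list of maximal abelian subgroups: they then have orders 1 and 2 and are not maximal abelian in PGL_3(F_2); the remaining entries are proved to be the complete list. *)

(* Defs.v *)
From HB Require Import structures.
From mathcomp Require Import all_boot all_order all_algebra.
From mathcomp Require Import all_fingroup all_solvable all_field.

Set Implicit Arguments.
Unset Strict Implicit.
Unset Printing Implicit Defensive.

Import GroupScope GRing.Theory.
Local Open Scope ring_scope.

Notation Z3 K := 'Z('GL_3[K])%g.
Notation PGL3 K := ('GL_3[K] / 'Z('GL_3[K]))%g.

Definition max_abelian (K : finFieldType) (A : {set coset_of (Z3 K)}) : bool :=
  [max A of B | B \subset PGL3 K & abelian B].

Definition conj_in_PGL3 (K : finFieldType) (A B : {set coset_of (Z3 K)}) : Prop :=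
  exists2 x, x \in PGL3 K & A = (B :^ x)%g.

(* M, acting on column vectors, is the matrix of f : V -> V once K^3 is
   identified with V by phi. *)
Definition realizes (K : finFieldType) (V : vectType K)
    (phi : 'cV[K]_3 -> V) (f : V -> V) (M : {'GL_3[K]}) : bool :=
  [forall v : 'cV[K]_3, phi (GLval M *m v) == f (phi v)].

Definition mx3 (K : finFieldType) (rows : seq (seq K)) : 'M[K]_3 :=
  \matrix_(i < 3, j < 3) nth 0 (nth [::] rows i) j.

Section Subsets.

Variables (K : finFieldType) (omega : K) (L2 L3 : fieldExtType K).
Variables (phi2 : 'cV[K]_3 -> (L2 * K^o)%type) (phi3 : 'cV[K]_3 -> L3).

(* In the next three definitions finvect_type L is L itself, with the finType
   structure that makes the boolean quantifier available. *)

Definition cubic_units : {set {'GL_3[K]}} :=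
  [set M : {'GL_3[K]} | [exists x : finvect_type L3,
    (x != 0) && realizes phi3 (fun y : L3 => (x : L3) * y) M]].

Definition quadratic_units : {set {'GL_3[K]}} :=
  [set M : {'GL_3[K]} | [exists x : finvect_type L2, [exists c : K,
    [&& x != 0, c != 0 &
      realizes phi2 (fun y => ((x : L2) * y.1, c * y.2)) M]]]].

Definition cube_root_units : {set {'GL_3[K]}} :=
  [set M : {'GL_3[K]} | [exists x : finvect_type L3, [exists c : K,
    [&& x != 0, c != 0, (x : L3) ^+ 3 == c%:A &
      realizes phi3 (fun y : L3 => (x : L3) * y) M]]]].

Definition frobenius : {set {'GL_3[K]}} :=
  [set M : {'GL_3[K]} | realizes phi3 (fun y : L3 => y ^+ #|K|) M].

Definition diagonals : {set {'GL_3[K]}} := [set M : {'GL_3[K]} | is_diag_mx (GLval M)].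

Definition jordan21 : {set {'GL_3[K]}} :=
  [set M : {'GL_3[K]} | [exists r : K, [exists a : K, (r != 0) &&
    (GLval M == mx3 [:: [:: r; a; 0];
                        [:: 0; r; 0];
                        [:: 0; 0; 1]])]]].

Definition jordan3 : {set {'GL_3[K]}} :=
  [set M : {'GL_3[K]} | [exists a : K, [exists b : K,
    GLval M == mx3 [:: [:: 1; a; b];
                       [:: 0; 1; a];
                       [:: 0; 0; 1]]]]].

Definition column_unipotents : {set {'GL_3[K]}} :=
  [set M : {'GL_3[K]} | [exists a : K, [exists b : K,
    GLval M == mx3 [:: [:: 1; 0; b];
                       [:: 0; 1; a];
                       [:: 0; 0; 1]]]]].

Definition row_unipotents : {set {'GL_3[K]}} :=
  [set M : {'GL_3[K]} | [exists a : K, [exists b : K,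
    GLval M == mx3 [:: [:: 1; a; b];
                       [:: 0; 1; 0];
                       [:: 0; 0; 1]]]]].

Definition clock_shift : {set {'GL_3[K]}} :=
  [set M : {'GL_3[K]} | (GLval M == mx3 [:: [:: 1; 0; 0];
                               [:: 0; omega; 0];
                               [:: 0; 0; omega ^+ 2]])
        || (GLval M == mx3 [:: [:: 0; 0; 1];
                               [:: 1; 0; 0];
                               [:: 0; 1; 0]])].

End Subsets.

Inductive pgl3_class : Type :=
  | CubicTorus | QuadraticTorus | SplitTorus
  | Jordan21 | Jordan3 | ColumnUnipotent | RowUnipotent
  | ClockShift | CubeRootFrobenius.

(* For #|K| = 2 the groups SplitTorus and Jordan21 have orders 1 and 2, and are
   not maximal abelian in PGL_3(F_2). *)
Definition occurs (K : finFieldType) (c : pgl3_class) : bool :=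
  match c with
  | SplitTorus | Jordan21 => #|K| != 2%N
  | ClockShift | CubeRootFrobenius => #|K| == 1 %[mod 3]
  | _ => true
  end.

(* The quotient by Z3 K is the image in PGL_3(K), so it accounts for the
   factors Z and K^* in H Z / Z and H K^* / K^*. *)
Definition representative (K : finFieldType) (omega : K)
    (L2 L3 : fieldExtType K) (phi2 : 'cV[K]_3 -> (L2 * K^o)%type)
    (phi3 : 'cV[K]_3 -> L3) (c : pgl3_class) : {set coset_of (Z3 K)} :=
  (match c with
   | CubicTorus => cubic_units phi3
   | QuadraticTorus => quadratic_units phi2
   | SplitTorus => diagonals K
   | Jordan21 => jordan21 K
   | Jordan3 => jordan3 K
   | ColumnUnipotent => column_unipotents K
   | RowUnipotent => row_unipotents K
   | ClockShift => <<clock_shift omega>>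
   | CubeRootFrobenius => <<cube_root_units phi3 :|: frobenius phi3>>
   end / Z3 K)%g.

(* Main.v *)
(** Pull an abelian subgroup A of PGL_3(K) back to GL_3(K).

    If the preimage is not commutative, it contains g, h with g h = w h g for a
    primitive cube root of unity w.  Then g^3 and h^3 are scalars, and as K^* has
    only three classes modulo cubes one can arrange g^3 = 1 and g v = v with
    v <> 0.  In the basis v, h v, h^2 v the pair is determined by the scalar
    b = h^3, every matrix commuting with g and h up to scalars is a multiple of
    some g^i h^j, and one gets (viii) or (ix) according to whether b is a cube.

    If the preimage is commutative and contains a matrix M with a cyclic vector,
    it lies in K[M], whose conjugacy class depends on the way the characteristic
    polynomial of M factors: this gives (i)-(v).  Otherwise every matrix of the
    preimage has the form c + u w with u a column and w a row.  If some w u is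
    nonzero, the group is diagonalizable or of type (iv); if all of them vanish,
    commutation forces either all the u or all the w to be proportional, which
    gives (vii) or (vi).

    As each group of the list is abelian and equal to its own centralizer, it is
    maximal, and it suffices to embed A in a conjugate of one of them. *)

Require Import Defs.
From HB Require Import structures.
From mathcomp Require Import all_boot all_order all_algebra.
From mathcomp Require Import all_fingroup all_solvable all_field.
From mathcomp Require Import ring.

Set Implicit Arguments.
Unset Strict Implicit.
Unset Printing Implicit Defensive.

Import GroupScope GRing.Theory.
Local Open Scope ring_scope.

(** Subgroups of PGL_3(K) are handled through the set of all matrices above them, so that commuting
    downstairs reads X Y = c Y X for a scalar c. Determinants give c^3 = 1. This is where q = 1 mod
    3 comes from: a value of c other than 1 is an element of order 3 among the units of K. The same
    scalar is the obstacle to maximality. The centralizer must be computed in PGL_3(K), and when the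
    preimage of the representative is commutative, c has to be shown to be 1 before linear algebra
    applies. Three devices do this: a test element 1 + (rank one), a test element whose only
    eigenvalue in K is 1, and a pair of test elements N, 1 + N.

    When h^3 = b is not a cube, the two classes of non-cubes might be expected to give two groups.
    They do not: every non-cube of K becomes a cube in the cubic extension, so the group (ix)
    contains a suitable pair for each such b.

    That the list has no repetition is read off from properties of the preimage that survive
    conjugation, such as being commutative or having all eigenvalues in K. *)

Notation o0 := (@Ordinal 3 0 isT).
Notation o1 := (@Ordinal 3 1 isT).
Notation o2 := (@Ordinal 3 2 isT).

Lemma ord3P (P : 'I_3 -> Prop) : P o0 -> P o1 -> P o2 -> forall i, P i.
Proof.
move=> P0 P1 P2 [[|[|[|//]]] lti].
- by have -> : Ordinal lti = o0 by apply: val_inj.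
- by have -> : Ordinal lti = o1 by apply: val_inj.
- by have -> : Ordinal lti = o2 by apply: val_inj.
Qed.

Lemma sum_ord3 (V : nmodType) (f : 'I_3 -> V) :
  \sum_i f i = f o0 + f o1 + f o2.
Proof.
rewrite !big_ord_recl big_ord0 addr0 addrA.
by congr (f _ + f _ + f _); apply: val_inj.
Qed.

Lemma det_mx2 (R : comNzRingType) (A : 'M[R]_2) :
  \det A = A 0 0 * A 1 1 - A 0 1 * A 1 0.
Proof.
rewrite (expand_det_row _ 0) big_ord_recl big_ord1 /cofactor !det_mx11 !mxE /=.
have -> : lift 0 0 = 1 :> 'I_2 by apply: val_inj.
have -> : lift 1 0 = 0 :> 'I_2 by apply: val_inj.
by rewrite expr0 expr1; ring.
Qed.

(** * Linear algebra in dimension 3: dual bases and cyclic vectors *)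

Section ThreeDim.
Variable F : finFieldType.
Implicit Types (A B M N P X : 'M[F]_3) (a b u v : 'cV[F]_3) (w : 'rV[F]_3).

Lemma mx3E (r : seq (seq F)) i j : mx3 r i j = nth 0 (nth [::] r i) j.
Proof. by rewrite mxE. Qed.

Lemma eq_mx3 A B :
  A o0 o0 = B o0 o0 -> A o0 o1 = B o0 o1 -> A o0 o2 = B o0 o2 ->
  A o1 o0 = B o1 o0 -> A o1 o1 = B o1 o1 -> A o1 o2 = B o1 o2 ->
  A o2 o0 = B o2 o0 -> A o2 o1 = B o2 o1 -> A o2 o2 = B o2 o2 -> A = B.
Proof. by move=> *; apply/matrixP; apply: ord3P; apply: ord3P. Qed.

Lemma eq_cV3 u v : u o0 0 = v o0 0 -> u o1 0 = v o1 0 -> u o2 0 = v o2 0 -> u = v.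
Proof. by move=> *; apply/colP; apply: ord3P. Qed.

Lemma det_mx3 A : \det A =
  A o0 o0 * (A o1 o1 * A o2 o2 - A o1 o2 * A o2 o1)
  - A o0 o1 * (A o1 o0 * A o2 o2 - A o1 o2 * A o2 o0)
  + A o0 o2 * (A o1 o0 * A o2 o1 - A o1 o1 * A o2 o0).
Proof.
rewrite (expand_det_row _ o0) sum_ord3 /cofactor !det_mx2 !mxE.
have l00 : lift o0 (0 : 'I_2) = o1 by apply: val_inj.
have l01 : lift o0 (1 : 'I_2) = o2 by apply: val_inj.
have l10 : lift o1 (0 : 'I_2) = o0 by apply: val_inj.
have l11 : lift o1 (1 : 'I_2) = o2 by apply: val_inj.
have l20 : lift o2 (0 : 'I_2) = o0 by apply: val_inj.
have l21 : lift o2 (1 : 'I_2) = o1 by apply: val_inj.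
rewrite l00 l01 l10 l11 l20 l21 /=.
ring.
Qed.

Definition col3 a b v : 'M[F]_3 :=
  \matrix_(i, j) (nth 0 [:: a; b; v] j) i 0.

Lemma col3E a b v i j : col3 a b v i j = (nth 0 [:: a; b; v] j) i 0.
Proof. by rewrite mxE. Qed.

Lemma mul_col3 M a b v : M *m col3 a b v = col3 (M *m a) (M *m b) (M *m v).
Proof.
apply/matrixP=> i; apply: ord3P; rewrite !mxE /=;
by apply: eq_bigr => k _; rewrite mxE.
Qed.

Lemma col3_mul a b v (x : 'cV[F]_3) :
  col3 a b v *m x = x o0 0 *: a + x o1 0 *: b + x o2 0 *: v.
Proof. by apply/colP=> i; rewrite !mxE sum_ord3 !mxE /=; ring. Qed.

Lemma unitmx_inj A : (forall u, A *m u = 0 -> u = 0) -> A \in unitmx.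
Proof.
move=> injA; rewrite -unitmx_tr -row_free_unit -kermx_eq0; apply/rowV0P => w.
move/sub_kermxP => wA; rewrite -[w]trmxK [w^T]injA ?trmx0 //.
by rewrite -[A]trmxK -trmx_mul wA trmx0.
Qed.

Lemma col3_unitP a b v :
  (forall x y z, x *: a + y *: b + z *: v = 0 -> [/\ x = 0, y = 0 & z = 0]) ->
  col3 a b v \in unitmx.
Proof.
move=> indep; apply: unitmx_inj => u; rewrite col3_mul => /indep[u0 u1 u2].
by apply: eq_cV3; rewrite mxE.
Qed.

Lemma unit_mulmx_eq0 A u : A \in unitmx -> A *m u = 0 -> u = 0.
Proof. by move=> uA Au0; rewrite -[u](mulKmx uA) Au0 mulmx0. Qed.

Lemma unit_mulmx_inj n A (X Y : 'M[F]_(n, 3)) :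
  A \in unitmx -> X *m A = Y *m A -> X = Y.
Proof. by move=> uA eqXY; rewrite -[X](mulmxK uA) eqXY mulmxK. Qed.

Lemma unit_col3_span a b v u : col3 a b v \in unitmx ->
  exists x y z, u = x *: a + y *: b + z *: v.
Proof.
move=> uP; have := mulKVmx uP u; rewrite col3_mul => <-.
by do 3!eexists.
Qed.

Lemma unit_col3_free a b v x y z : col3 a b v \in unitmx ->
  x *: a + y *: b + z *: v = 0 -> [/\ x = 0, y = 0 & z = 0].
Proof.
move=> uP; pose c : 'cV[F]_3 := \col_i nth 0 [:: x; y; z] i.
have := @col3_mul a b v c; rewrite !mxE /= => <- /(unit_mulmx_eq0 uP) c0.
by split; [move/colP/(_ o0): c0|move/colP/(_ o1): c0|move/colP/(_ o2): c0];
   rewrite !mxE.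
Qed.

Lemma eq_on_col3 n (A B : 'M[F]_(n, 3)) a b v : col3 a b v \in unitmx ->
  A *m a = B *m a -> A *m b = B *m b -> A *m v = B *m v -> A = B.
Proof.
move=> uP Aa Ab Av; apply: (unit_mulmx_inj uP).
have E (C : 'M[F]_(n, 3)) i j :
  (C *m col3 a b v) i j = nth 0 [:: (C *m a) i 0; (C *m b) i 0; (C *m v) i 0] j.
  by elim/ord3P: j; rewrite !mxE /=; apply: eq_bigr => k _; rewrite mxE.
by apply/matrixP=> i j; rewrite !E Aa Ab Av.
Qed.

Definition dot w v : F := (w *m v) 0 0.

Lemma mulmx_dot u w v : u *m w *m v = dot w v *: u.
Proof. by rewrite -mulmxA [w *m v]mx11_scalar mul_mx_scalar. Qed.

Lemma dot_mulmx u w w' : w *m (u *m w') = dot w u *: w'.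
Proof. by rewrite mulmxA [w *m u]mx11_scalar mul_scalar_mx. Qed.

Lemma dotDr w u v : dot w (u + v) = dot w u + dot w v.
Proof. by rewrite /dot mulmxDr mxE. Qed.

Lemma dotZr w x v : dot w (x *: v) = x * dot w v.
Proof. by rewrite /dot -scalemxAr mxE. Qed.

Lemma dot0r w : dot w 0 = 0.
Proof. by rewrite /dot mulmx0 mxE. Qed.

Lemma dot_dual w : w != 0 -> exists u, dot w u = 1.
Proof.
case/rV0Pn=> i wi; exists ((w 0 i)^-1 *: delta_mx i 0).
by rewrite dotZr /dot -colE mxE mulVf.
Qed.

Lemma ker_dot2 w w' : exists2 u, u != 0 & dot w u = 0 /\ dot w' u = 0.
Proof.
pose A : 'M[F]_(3, 1 + 1) := row_mx w^T w'^T.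
(* Three rows in a space of dimension 2 are dependent, so the left kernel is nonzero. *)
have: kermx A != 0.
  by rewrite kermx_eq0 /row_free neq_ltn (leq_ltn_trans (rank_leq_col _)).
case/rowV0Pn=> x /sub_kermxP xA nzx; exists x^T; first by rewrite trmx_eq0.
have: x *m w^T = 0 /\ x *m w'^T = 0.
  by move: xA; rewrite /A mul_mx_row => /eqP; rewrite row_mx_eq0 => /andP[/eqP-> /eqP->].
have tr y : x *m y^T = 0 -> dot y x^T = 0.
  by move/(congr1 trmx); rewrite trmx_mul trmxK trmx0 /dot => ->; rewrite mxE.
by case=> /tr-> /tr->.
Qed.

Lemma ker_codot2 u v : exists2 w, w != 0 & dot w u = 0 /\ dot w v = 0.
Proof.
have [w nzw [wu wv]] := ker_dot2 u^T v^T; exists w^T; first by rewrite trmx_eq0.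
have E x : dot w^T x = dot x^T w 
  by transitivity ((x^T *m w)^T 0 0); [rewrite trmx_mul trmxK | rewrite mxE].
by rewrite !E.
Qed.

Lemma mulmx_cVrV_eq0 u w : u *m w = 0 -> u = 0 \/ w = 0.
Proof.
have [->|nzw] := eqVneq w 0; first by right.
have [v wv] := dot_dual nzw => uw0; left.
by rewrite -[u]scale1r -wv -mulmx_dot uw0 mul0mx.
Qed.

(** Applying [w] to a linear relation isolates the coefficient of [u]; what is left is a relation
    between [a] and [b]. *)
Lemma dual_basis a b u w : (forall c, b != c *: a) -> a != 0 ->
  dot w a = 0 -> dot w b = 0 -> dot w u = 1 -> col3 a b u \in unitmx.
Proof.
move=> nab nza wa wb wu; apply: col3_unitP => x y z E.
have z0: z = 0.
  have := congr1 (dot w) E.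
  by rewrite !dotDr !dotZr wa wb wu dot0r !mulr0 mulr1 !add0r.
move: E; rewrite z0 scale0r addr0 => E.
have y0 : y = 0.
  apply/eqP/negPn/negP=> nzy; case/negP: (nab (- (y^-1 * x))).
  rewrite scaleNr -scalerA -subr_eq0 opprK -[X in X + _]scale1r -(mulVf nzy).
  by rewrite -scalerA -scalerDr addrC E scaler0.
move: E; rewrite y0 scale0r addr0 => /eqP.
by rewrite scaler_eq0 (negPf nza) orbF => /eqP ->.
Qed.

(** Invertible exactly when [v] is a cyclic vector of [M]. *)
Definition krylov M v := col3 v (M *m v) (M *m (M *m v)).

Definition poly2 x y z M : 'M[F]_3 := x%:M + y *: M + z *: (M *m M).

Lemma poly2_mul x y z M v :
  poly2 x y z M *m v = x *: v + y *: (M *m v) + z *: (M *m (M *m v)).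
Proof. by rewrite !mulmxDl mul_scalar_mx -!scalemxAl mulmxA. Qed.

Lemma comm_poly2 x y z M : M *m poly2 x y z M = poly2 x y z M *m M.
Proof.
rewrite mulmxDr mulmxDr mulmxDl mulmxDl -!scalemxAr -!scalemxAl.
by rewrite mul_mx_scalar mul_scalar_mx mulmxA.
Qed.

(* A cyclic vector v turns a matrix X commuting with M into the polynomial in M
   read off X v. *)
Lemma krylov_commutant M v X : krylov M v \in unitmx -> X *m M = M *m X ->
  exists x y z, X = poly2 x y z M.
Proof.
move=> uP XM; have [x [y [z Xv]]] := unit_col3_span (X *m v) uP.
exists x, y, z; set Y := poly2 x y z M.
have YM : Y *m M = M *m Y by rewrite comm_poly2.
have e0 : X *m v = Y *m v by rewrite Xv poly2_mul.
have e1 : X *m (M *m v) = Y *m (M *m v).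
  by rewrite !mulmxA XM YM -!mulmxA e0.
apply: (eq_on_col3 uP) => //.
by rewrite mulmxA XM -mulmxA e1 mulmxA -YM -mulmxA.
Qed.

(** In their Krylov bases [M] and [N] both become the companion matrix of X^3 - z X^2 - y X - x. *)
Lemma krylov_similar M N v v' x y z :
  krylov M v \in unitmx -> krylov N v' \in unitmx ->
  M *m (M *m (M *m v)) = x *: v + y *: (M *m v) + z *: (M *m (M *m v)) ->
  N *m (N *m (N *m v')) = x *: v' + y *: (N *m v') + z *: (N *m (N *m v')) ->
  exists2 P, P \in unitmx & M *m P = P *m N.
Proof.
move=> uM uN eM eN; pose C := mx3 [:: [:: 0; 0; x]; [:: 1; 0; y]; [:: 0; 1; z]].
have comp M' u : M' *m (M' *m (M' *m u)) =
    x *: u + y *: (M' *m u) + z *: (M' *m (M' *m u)) ->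
  M' *m krylov M' u = krylov M' u *m C.
  move=> e; rewrite mul_col3 e /krylov; move: (M' *m (M' *m u)) (M' *m u) => b a.
  by apply/matrixP=> i; apply: ord3P;
     rewrite [RHS]mxE sum_ord3 !mx3E !col3E /= ?mxE; ring.
exists (krylov M v *m invmx (krylov N v')); first by rewrite unitmx_mul uM unitmx_inv.
apply: (unit_mulmx_inj uN).
by rewrite -!mulmxA (comp _ _ eN) mulKmx // mulVmx // mulmx1 comp.
Qed.

Lemma krylov_rel M v : krylov M v \in unitmx ->
  exists x y z,
    M *m (M *m (M *m v)) = x *: v + y *: (M *m v) + z *: (M *m (M *m v)).
Proof. exact: unit_col3_span. Qed.

(** If every vector is an eigenvector, comparing the eigenvalues of the three basis vectors with
    that of their sum shows that they agree. *)
Lemma scalar_or_moving M :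
  (exists v, forall c, M *m v != c *: v) \/ exists c, M = c%:M.
Proof.
case: (boolP [exists v : 'cV[F]_3, [forall c : F, M *m v != c *: v]]).
  by case/existsP=> v /forallP vP; left; exists v.
rewrite negb_exists => /forallP eigM; right.
have eig v : exists c, M *m v = c *: v.
  by have := eigM v; rewrite negb_forall => /existsP[c /negPn/eqP]; exists c.
pose e i : 'cV[F]_3 := delta_mx i 0.
have [c0 E0] := eig (e o0); have [c1 E1] := eig (e o1).
have [c2 E2] := eig (e o2); have [c E] := eig (e o0 + e o1 + e o2).
have eM i j : M i j = (M *m e j) i 0 by rewrite -colE mxE.
move: E; rewrite !mulmxDr E0 E1 E2 => E; exists c.
have := congr1 (fun u : 'cV_3 => u o0 0) E; have := congr1 (fun u : 'cV_3 => u o1 0) E.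
have := congr1 (fun u : 'cV_3 => u o2 0) E.
rewrite !mxE /= ?eqxx ?mulr1 ?mulr0 ?addr0 ?add0r ?mulr1 => h2 h1 h0.
by apply: eq_mx3; rewrite eM ?E0 ?E1 ?E2 !mxE /= ?mulr0 ?mulr1 ?mulr1n ?mulr0n //; congruence.
Qed.

(* With N = M - c, where c is the eigenvalue of M on the quotient by the plane
   (v, M v), and u outside this plane such that N u = ga v, either ga = 0 and
   N has rank one on (v, N v, u), or u or v + u is cyclic. *)
Lemma cyclic_or_rank1 M :
  (exists v, krylov M v \in unitmx) \/ exists c u w, M = c%:M + u *m w.
Proof.
have [[v nMv]|[c ->]] := scalar_or_moving M; last first.
  by right; exists c, 0, 0; rewrite mul0mx addr0.
have nzv : v != 0.
  by apply/eqP=> v0; case/negP: (nMv 0); rewrite v0 mulmx0 scaler0.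
have [uK|nuK] := boolP (krylov M v \in unitmx); first by left; exists v.
have [w nzw [wv wMv]] := ker_codot2 v (M *m v).
have [u0 wu0] := dot_dual nzw.
have uB := dual_basis nMv nzv wv wMv wu0.
(* Otherwise [M (M v)] lies outside the plane and [v] itself is cyclic. *)
have wMMv : dot w (M *m (M *m v)) = 0.
  apply/eqP/negPn/negP=> nz; case/negP: nuK; set t := M *m (M *m v).
  have -> : krylov M v = col3 v (M *m v) (dot w t *: ((dot w t)^-1 *: t)).
    by rewrite scalerA divff // scale1r.
  apply: col3_unitP => x y z E.
  have uB' : col3 v (M *m v) ((dot w t)^-1 *: t) \in unitmx.
    by apply: (dual_basis nMv nzv wv wMv); rewrite dotZr mulVf.
  move: E; rewrite [z *: _]scalerA => /(unit_col3_free uB') [-> -> /eqP].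
  by rewrite mulf_eq0 (negPf nz) orbF => /eqP.
pose c := dot w (M *m u0); pose N := M - c%:M.
have NE x : N *m x = M *m x - c *: x by rewrite mulmxBl mul_scalar_mx.
have wN : w *m N = 0.
  apply: (eq_on_col3 uB); rewrite !mul0mx -mulmxA NE.
  - by rewrite [LHS]mx11_scalar -/(dot _ _) dotDr -scaleNr dotZr wMv wv mulr0 addr0 raddf0.
  - by rewrite [LHS]mx11_scalar -/(dot _ _) dotDr -scaleNr dotZr wMMv wMv mulr0 addr0 raddf0.
  by rewrite [LHS]mx11_scalar -/(dot _ _) dotDr -scaleNr dotZr wu0 mulr1 subrr raddf0.
have wNx x : dot w (N *m x) = 0 by rewrite /dot mulmxA wN mul0mx mxE.
have nNv k : N *m v != k *: v by rewrite NE subr_eq -scalerDl.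
have uB' := dual_basis nNv nzv wv (wNx v).
have [al [be [z0 NNv]]] := unit_col3_span (N *m (N *m v)) (uB' _ wu0).
have [ga [de [z1 Nu0]]] := unit_col3_span (N *m u0) (uB' _ wu0).
have z00 : z0 = 0.
  by have := wNx (N *m v); rewrite NNv !dotDr !dotZr wNx wv wu0 !mulr0 !add0r mulr1.
have z10 : z1 = 0.
  by have := wNx u0; rewrite Nu0 !dotDr !dotZr wNx wv wu0 !mulr0 !add0r mulr1.
rewrite {}z00 scale0r addr0 in NNv; rewrite {}z10 scale0r addr0 in Nu0.
(* The shift by [de *: v] removes the [N v] component of [N u0], so that [N u = ga v]. *)
pose u := u0 - de *: v.
have wu : dot w u = 1 by rewrite dotDr -scaleNr dotZr wv mulr0 addr0.
have Nu : N *m u = ga *: v by rewrite mulmxBr Nu0 -scalemxAr addrK.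
have defM : M = c%:M + N by rewrite addrC subrK.
clearbody u N.
have {}uB := uB' _ wu; set P := col3 v (N *m v) u in uB.
(* The columns of [T1] are the coordinates of [s], [N s], [N (N s)] in the basis [P]; [T2] passes
   from powers of [N] to powers of [M = c + N]. The hypothesis is that [T1] has nonzero
   determinant. *)
have cyc r s : ga * (ga + r * be) - r * r * al != 0 ->
    s = r *: v + u -> krylov M s \in unitmx.
  move=> nz ->; pose T1 := mx3 [:: [:: r; ga; r * al];
     [:: 0; r; ga + r * be]; [:: 1; 0; 0]].
  pose T2 := mx3 [:: [:: 1; c; c * c]; [:: 0; 1; c + c]; [:: 0; 0; 1]].
  have -> : krylov M (r *: v + u) = P *m T1 *m T2.
    have ME x : M *m x = N *m x + c *: x by rewrite NE subrK.
    rewrite /krylov !ME !mulmxDr -!scalemxAr !Nu !mulmxDr -!scalemxAr !Nu NNv.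
    rewrite /P; move: (N *m v) => a.
    by apply/matrixP=> i; apply: ord3P;
       rewrite [RHS]mxE sum_ord3 ![(_ *m T1) _ _]mxE !sum_ord3 !mx3E !col3E /= !mxE; ring.
  rewrite !unitmx_mul uB /= !unitmxE !det_mx3 !mx3E /= !unitfE.
  by apply/andP; split; [move: nz; congr (~~ (_ == _)); ring
     | rewrite !(mul0r, mulr0, mulr1, subr0, addr0) oner_eq0].
have [ga0|nzga] := eqVneq ga 0; last first.
  by left; exists u; apply: (cyc 0); rewrite ?scale0r ?add0r // !mul0r addr0 subr0 mulf_neq0.
have [al0|nzal] := eqVneq al 0; last first.
  by left; exists (1 *: v + u); apply: (cyc 1); rewrite // ga0 !mul0r !mul1r sub0r oppr_eq0.
(* Now [N] sends [v], [N v], [u] to 1, [be], 0 times [N v]. These multiples form the row, which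
   [invmx P] rewrites in the standard basis. *)
right; exists c, (N *m v), (\row_j (nth 0 [:: 1; be; 0] j) *m invmx P).
rewrite [LHS]defM; congr (_ + _); apply: (unit_mulmx_inj uB).
rewrite mulmxA mulmxKV // mul_col3 NNv Nu al0 ga0.
move: (N *m v) => a; apply/matrixP=> i; apply: ord3P;
by rewrite col3E !mxE big_ord1 !mxE /=; ring.
Qed.

End ThreeDim.

(** * Pairs that commute up to a cube root of unity *)

Section Twisted.
Variables (F : finFieldType) (om : F).
Hypothesis prim_om : 3.-primitive_root om.
Implicit Types (g h X P : 'M[F]_3) (u v : 'cV[F]_3).

(** The witness is the middle coefficient of the characteristic polynomial, the sum of the principal
    2 by 2 minors. *)
Lemma Cayley_Hamilton3 g : exists e,
  g *m g *m g - \tr g *: (g *m g) + e *: g = (\det g)%:M.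
Proof.
exists (g o0 o0 * g o1 o1 - g o0 o1 * g o1 o0 + g o0 o0 * g o2 o2
  - g o0 o2 * g o2 o0 + g o1 o1 * g o2 o2 - g o1 o2 * g o2 o1).
rewrite det_mx3 /mxtrace sum_ord3.
by apply: eq_mx3; rewrite !(mxE, sum_ord3) ?mulr1n ?mulr0n; ring.
Qed.

Lemma cube_root_neq1 : om != 1.
Proof. by rewrite -[om]expr1 -(prim_order_dvd prim_om). Qed.

Lemma cube_root_sq_neq1 : om * om != 1.
Proof. by rewrite -expr2 -(prim_order_dvd prim_om). Qed.

Lemma cube_root_cube : om * om * om = 1.
Proof. by rewrite -[RHS](prim_expr_order prim_om) !exprS expr0 mulr1 mulrA. Qed.

Lemma cube_root_neq0 : om != 0.
Proof. by apply/eqP=> o0; have := cube_root_cube; rewrite o0 !mulr0 => /eqP; rewrite eq_sym oner_eq0. Qed.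

(** Conjugation by [h] rescales [g] by a factor other than 1 but preserves its trace. *)
Lemma twisted_trace g h : h \in unitmx -> g *m h = om *: (h *m g) -> \tr g = 0.
Proof.
move=> uh gh; have eg : g = om *: (h *m g *m invmx h).
  by rewrite scalemxAl -gh mulmxK.
have := congr1 mxtrace eg; rewrite mxtraceZ mxtrace_mulC mulmxA mulVmx // mul1mx.
move=> /eqP; rewrite -subr_eq0 -[X in X - _]mul1r -mulrBl mulf_eq0 subr_eq0 eq_sym.
by rewrite (negPf cube_root_neq1) => /eqP.
Qed.

(** The trace term of Cayley-Hamilton vanishes. Both [g^3] and the scalar [\det g] commute with [h],
    whereas [e g] commutes with [h] only if [e = 0]. Hence [g^3 = \det g]. *)
Lemma twisted_cube g h : g \in unitmx -> h \in unitmx ->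
  g *m h = om *: (h *m g) -> exists2 a, a != 0 & g *m g *m g = a%:M.
Proof.
move=> ug uh gh.
have [e] := Cayley_Hamilton3 g; rewrite (twisted_trace uh gh) scale0r subr0 => CH.
exists (\det g); first by rewrite -unitfE -unitmxE.
suff e0 : e = 0 by rewrite -CH e0 scale0r addr0.
have ggh : g *m g *m h = (om * om) *: (h *m (g *m g)).
  by rewrite -mulmxA gh -scalemxAr [g *m (h *m g)]mulmxA gh -scalemxAl scalerA !mulmxA.
have gggh : g *m g *m g *m h = h *m (g *m g *m g).
  rewrite -mulmxA gh -scalemxAr [g *m g *m (h *m g)]mulmxA ggh -scalemxAl scalerA !mulmxA.
  by rewrite mulrA cube_root_cube scale1r.
have := congr1 (fun X => X *m h - h *m X) CH.
rewrite mulmxDl mulmxDr gggh -scalemxAl -scalemxAr gh scalerA opprD addrACA subrr add0r.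
rewrite mul_mx_scalar mul_scalar_mx subrr -scalerBl => /eqP.
rewrite scaler_eq0 -[X in _ - X]mulr1 -mulrBr mulf_eq0 subr_eq0 (negPf cube_root_neq1) orbF.
case/orP=> /eqP // hg0; have: h *m g \in unitmx by rewrite unitmx_mul uh.
by rewrite hg0 unitmxE det0 unitr0.
Qed.

(** Lagrange interpolation: (X - b)(X - c) evaluated at [g] kills [v] and [v'] and multiplies [u] by
    (a - b)(a - c), so a relation has coefficient 0 at [u], and likewise at the other two. [comb]
    evaluates an arbitrary quadratic polynomial. *)
Lemma eigen_col3 g a b c u v v' : a != b -> b != c -> a != c ->
  u != 0 -> v != 0 -> v' != 0 -> g *m u = a *: u -> g *m v = b *: v ->
  g *m v' = c *: v' -> col3 u v v' \in unitmx.
Proof.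
move=> nab nbc nac nzu nzv nzv' gu gv gv'; apply: col3_unitP => x y z E.
have [E1 E2] : x * a *: u + y * b *: v + z * c *: v' = 0 /\
    x * a * a *: u + y * b * b *: v + z * c * c *: v' = 0.
  have E1 : x * a *: u + y * b *: v + z * c *: v' = 0.
    by have := congr1 (mulmx g) E; rewrite mulmx0 !mulmxDr -!scalemxAr gu gv gv' !scalerA.
  split=> //; have := congr1 (mulmx g) E1.
  by rewrite mulmx0 !mulmxDr -!scalemxAr gu gv gv' !scalerA.
have comb p q r : p *: (x * a * a *: u + y * b * b *: v + z * c * c *: v') 
   + q *: (x * a *: u + y * b *: v + z * c *: v') + r *: (x *: u + y *: v + z *: v') = 0.
  by rewrite E E1 E2 !scaler0 !addr0.
split.
- have : (x * ((a - b) * (a - c))) *: u = 0.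
    by rewrite -(comb 1 (- (b + c)) (b * c)); apply/colP=> i; rewrite !mxE; ring.
  move/eqP; rewrite scaler_eq0 !mulf_eq0 !subr_eq0 (negPf nzu) (negPf nab) (negPf nac) !orbF.
  by move/eqP.
- have : (y * ((b - a) * (b - c))) *: v = 0.
    by rewrite -(comb 1 (- (a + c)) (a * c)); apply/colP=> i; rewrite !mxE; ring.
  move/eqP; rewrite scaler_eq0 !mulf_eq0 !subr_eq0 (negPf nzv) (eq_sym b) (negPf nab) (negPf nbc) !orbF.
  by move/eqP.
have : (z * ((c - a) * (c - b))) *: v' = 0.
  by rewrite -(comb 1 (- (a + b)) (a * b)); apply/colP=> i; rewrite !mxE; ring.
move/eqP; rewrite scaler_eq0 !mulf_eq0 !subr_eq0 (negPf nzv') !(eq_sym c) (negPf nac) (negPf nbc) !orbF.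
by move/eqP.
Qed.

(* A pair generating the Heisenberg group modulo scalars; together with h, the
   eigenvector v gives the basis v, h v, h^2 v in which g is diagonal and h is
   the companion matrix of X^3 - b. *)
Definition heis_pair b g h v :=
  [/\ g *m v = v, v != 0, b != 0, g *m h = om *: (h *m g) & h *m h *m h = b%:M].

Lemma heis_unit b g h v : heis_pair b g h v -> h \in unitmx.
Proof.
case=> _ _ nzb _ hhh; have: h *m h *m h \in unitmx.
  by rewrite hhh unitmxE det_scalar unitfE expf_neq0.
by rewrite !unitmx_mul => /andP[].
Qed.

Lemma heis_eigen b g h v : heis_pair b g h v ->
  g *m (h *m v) = om *: (h *m v) /\
  g *m (h *m (h *m v)) = (om * om) *: (h *m (h *m v)).
Proof.
case=> gv _ _ gh _; have E : g *m (h *m v) = om *: (h *m v).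
  by rewrite mulmxA gh -scalemxAl -mulmxA gv.
by rewrite E mulmxA gh -scalemxAl -mulmxA E -scalemxAr scalerA.
Qed.

Lemma heis_cyclic b g h v : heis_pair b g h v -> krylov h v \in unitmx.
Proof.
move=> hp; have [gv nzv nzb gh hhh] := hp; have uh := heis_unit hp.
have [ghv ghhv] := heis_eigen hp.
have nzh u : u != 0 -> h *m u != 0.
  by apply: contraNneq => /(unit_mulmx_eq0 uh) ->.
apply: (@eigen_col3 g 1 om (om * om)); rewrite ?nzh ?scale1r //.
- by rewrite eq_sym cube_root_neq1.
- by rewrite -[X in X != _]mulr1 (inj_eq (mulfI cube_root_neq0)) eq_sym cube_root_neq1.
by rewrite eq_sym cube_root_sq_neq1.
Qed.

Lemma heis_diag b g h v : heis_pair b g h v -> g *m g *m g = 1%:M.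
Proof.
move=> hp; have [gv nzv nzb gh hhh] := hp.
have [ghv ghhv] := heis_eigen hp.
apply: (eq_on_col3 (heis_cyclic hp)); rewrite !mul1mx -!mulmxA.
- by rewrite !gv.
- by rewrite !(ghv, =^~ scalemxAr) !scalerA cube_root_cube scale1r.
rewrite !(ghhv, =^~ scalemxAr) !scalerA.
rewrite -[RHS]scale1r; congr (_ *: _).
transitivity ((om * om * om) * (om * om * om)); first by ring.
by rewrite cube_root_cube mulr1.
Qed.

Lemma heis_similar b g h v g' h' v' :
  heis_pair b g h v -> heis_pair b g' h' v' ->
  exists P, [/\ P \in unitmx, g *m P = P *m g' & h *m P = P *m h'].
Proof.
move=> hp hp'; have [gv _ _ _ hhh] := hp; have [gv' _ _ _ hhh'] := hp'.
have [ghv ghhv] := heis_eigen hp; have [ghv' ghhv'] := heis_eigen hp'.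
have [uK uK'] := (heis_cyclic hp, heis_cyclic hp').
have gK g0 h0 v0 : g0 *m v0 = v0 -> g0 *m (h0 *m v0) = om *: (h0 *m v0) ->
    g0 *m (h0 *m (h0 *m v0)) = (om * om) *: (h0 *m (h0 *m v0)) ->
    g0 *m krylov h0 v0 = krylov h0 v0 *m diag_mx (\row_i nth 0 [:: 1; om; om * om] i).
  move=> e0 e1 e2; rewrite mul_col3 e0 e1 e2 mul_mx_diag /krylov.
  apply/matrixP=> i; apply: ord3P; rewrite !mxE /= ?mxE; ring.
have hK h0 v0 : h0 *m h0 *m h0 = b%:M ->
    h0 *m krylov h0 v0 = krylov h0 v0 *m mx3 [:: [:: 0; 0; b]; [:: 1; 0; 0]; [:: 0; 1; 0]].
  move=> e; have e3 : h0 *m (h0 *m (h0 *m v0)) = b *: v0 by rewrite !mulmxA e mul_scalar_mx.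
  rewrite mul_col3 e3 /krylov; move: (h0 *m (h0 *m v0)) (h0 *m v0) => y x.
  by apply/matrixP=> i; apply: ord3P;
     rewrite [RHS]mxE sum_ord3 !mx3E !col3E /= ?mxE; ring.
exists (krylov h v *m invmx (krylov h' v')); split.
- by rewrite unitmx_mul uK unitmx_inv.
- apply: (unit_mulmx_inj uK'); rewrite -!mulmxA mulVmx // mulmx1.
  by rewrite (gK g' h' v') // mulKmx // (gK g h v).
apply: (unit_mulmx_inj uK'); rewrite -!mulmxA mulVmx // mulmx1.
by rewrite (hK h' v') // mulKmx // (hK h v).
Qed.

(** [X v] is fixed by [g], whose fixed space is the line of [v]; commuting with [h] then spreads the
    eigenvalue to [h v] and [h (h v)]. *)
Lemma heis_centralizer b g h v X : heis_pair b g h v ->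
  X *m g = g *m X -> X *m h = h *m X -> exists c, X = c%:M.
Proof.
move=> hp Xg Xh; have [gv nzv nzb gh hhh] := hp; have uK := heis_cyclic hp.
have [ghv ghhv] := heis_eigen hp.
have [x [y [z Xv]]] := unit_col3_span (X *m v) uK.
have: g *m (X *m v) = X *m v by rewrite mulmxA -Xg -mulmxA gv.
rewrite Xv !mulmxDr -!scalemxAr gv ghv ghhv => E.
have [|_ y0 z0] := @unit_col3_free _ _ _ _ 0 (y * (om - 1)) (z * (om * om - 1)) uK.
  move/eqP: E; rewrite -subr_eq0 => /eqP E'; rewrite -[RHS]E'.
  by move: (h *m (h *m v)) (h *m v) => p q; apply/colP=> i; rewrite !mxE; ring.
move/eqP: y0; rewrite mulf_eq0 subr_eq0 (negPf cube_root_neq1) orbF => /eqP y0.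
move/eqP: z0; rewrite mulf_eq0 subr_eq0 (negPf cube_root_sq_neq1) orbF => /eqP z0.
move: Xv; rewrite y0 z0 !scale0r !addr0 => Xv; exists x.
have Xhv : X *m (h *m v) = x *: (h *m v) by rewrite mulmxA Xh -mulmxA Xv scalemxAr.
apply: (eq_on_col3 uK); rewrite mul_scalar_mx //.
by rewrite mulmxA Xh -mulmxA Xhv -scalemxAr.
Qed.

Definition mxpow (g : 'M[F]_3) i := iter i (mulmx g) 1%:M.

Lemma mxpowS g i : mxpow g i.+1 = g *m mxpow g i. Proof. by []. Qed.

Lemma mxpow_twist l g h i : g *m h = l *: (h *m g) ->
  g *m mxpow h i = l ^+ i *: (mxpow h i *m g).
Proof.
move=> gh; elim: i => [|i IHi]; first by rewrite mulmx1 mul1mx scale1r.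
by rewrite !mxpowS [in LHS]mulmxA gh -scalemxAl -mulmxA IHi -scalemxAr scalerA -exprS mulmxA.
Qed.

Lemma mxpow_twistl l g h i : g *m h = l *: (h *m g) ->
  mxpow g i *m h = l ^+ i *: (h *m mxpow g i).
Proof.
move=> gh; elim: i => [|i IHi]; first by rewrite mulmx1 mul1mx scale1r.
by rewrite !mxpowS -mulmxA IHi -scalemxAr [in LHS]mulmxA gh -scalemxAl scalerA -exprSr !mulmxA.
Qed.

Lemma mxpow_comm g i : mxpow g i *m g = g *m mxpow g i.
Proof. by have /(_ i) := @mxpow_twist 1 g g _ (esym (scale1r _)); rewrite expr1n scale1r. Qed.

(** Taking determinants gives [l ^+ 3 = 1]. *)
Lemma twist_root l X g : X \in unitmx -> g \in unitmx -> X *m g = l *: (g *m X) ->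
  exists2 i, (i < 3)%N & l = om ^+ i.
Proof.
move=> uX ug /(congr1 determinant); rewrite detZ !det_mulmx mulrC => E.
have: l ^+ 3 = 1.
  apply: (mulIf (x := \det g * \det X)); last by rewrite mul1r -E.
  by rewrite mulf_neq0 // -unitfE -unitmxE.
by case/(prim_rootP prim_om)=> i ->; exists i.
Qed.

(** The twists of [X] with [g] and [h] are some [om^i] and [om^j]. A factor [h^i] cancels the first
    and a factor [g^(3-j)] the second, neither disturbing the other; the product commutes with both
    [g] and [h], so it is scalar. *)
Lemma heis_twisted b g h v X l m : heis_pair b g h v -> X \in unitmx ->
  X *m g = l *: (g *m X) -> X *m h = m *: (h *m X) ->
  exists c i j, X *m mxpow h i *m mxpow g j = c%:M.
Proof.
move=> hp uX Xg Xh; have [_ _ _ gh _] := hp; have uh := heis_unit hp.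
have ug : g \in unitmx.
  have := unitmx1 F 3; rewrite -(heis_diag hp) !unitmx_mul => /andP[] //.
have [i lti el] := twist_root uX ug Xg; have [j ltj em] := twist_root uX uh Xh.
have XhE : X *m mxpow h i *m g = g *m (X *m mxpow h i).
  apply: (scalerI (expf_neq0 i cube_root_neq0)).
  by rewrite -mulmxA scalemxAr -(mxpow_twist i gh) [in LHS]mulmxA Xg el -scalemxAl !mulmxA.
pose Y := X *m mxpow h i *m mxpow g (3 - j).
have Yg : Y *m g = g *m Y by rewrite /Y -mulmxA mxpow_comm [in LHS]mulmxA XhE !mulmxA.
have Yh : Y *m h = h *m Y.
  rewrite /Y -mulmxA (mxpow_twistl (3 - j) gh) -scalemxAr [in LHS]mulmxA.
  rewrite -[X *m _ *m h]mulmxA mxpow_comm [in LHS]mulmxA Xh em -!scalemxAl scalerA -exprD subnK 1?ltnW //.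
  by rewrite (prim_expr_order prim_om) scale1r !mulmxA.
by have [c Yc] := heis_centralizer hp Yg Yh; exists c, i, (3 - j)%N.
Qed.

Lemma cube_root_sum : 1 + om + om * om = 0.
Proof.
apply: (mulfI (x := om - 1)); first by rewrite subr_eq0 cube_root_neq1.
by rewrite mulr0 -(subrr 1) -[X in _ = X - _]cube_root_cube; ring.
Qed.

(** The value at 1 of 1 + X + X^2 = (X - om)(X - om^2): a primitive cube root of unity excludes
    characteristic 3. *)
Lemma three_neq0 : 1 + 1 + 1 != 0 :> F.
Proof.
have -> : 1 + 1 + 1 = (1 - om) * (1 - om * om).
  rewrite -[RHS](addr0) -cube_root_sum.
  transitivity (1 + 1 + om * om * om); first by rewrite cube_root_cube.
  by ring.
by rewrite mulf_neq0 // subr_eq0 eq_sym ?cube_root_neq1 ?cube_root_sq_neq1.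
Qed.

(** As [g^3 = 1], a nonzero vector has a nonzero component in one of the eigenspaces of [g] for 1,
    [om], [om^2]. Multiplication by [h] permutes these cyclically, so the eigenvalue can be moved to
    1. *)
Lemma heis_pair_of_cube1 b g h : g *m g *m g = 1%:M -> b != 0 ->
  h *m h *m h = b%:M -> g *m h = om *: (h *m g) -> exists v, heis_pair b g h v.
Proof.
move=> ggg nzb hhh gh.
have uh : h \in unitmx.
  have: h *m h *m h \in unitmx by rewrite hhh unitmxE det_scalar unitfE expf_neq0.
  by rewrite !unitmx_mul => /andP[].
have nzh u : u != 0 -> h *m u != 0.
  by apply: contraNneq => /(unit_mulmx_eq0 uh) ->.
have shift c u : g *m u = c *: u -> g *m (h *m u) = (om * c) *: (h *m u).
  by move=> gu; rewrite mulmxA gh -scalemxAl -mulmxA gu -scalemxAr scalerA.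
pose u : 'cV[F]_3 := delta_mx o0 0.
have nzu : u != 0.
  by apply/eqP=> /colP/(_ o0)/eqP; rewrite !mxE /= oner_eq0.
(* [p k] is three times the projection of [u] to the eigenspace of [om ^+ k]; the exponent [2 * k]
   stands for [- k]. *)
clearbody u; pose p k := u + (om ^+ (2 * k)) *: (g *m u) + (om ^+ k) *: (g *m (g *m u)).
have gp k : g *m p k = (om ^+ k) *: p k.
  have o3 : om ^+ k * om ^+ (2 * k) = 1.
    by rewrite -exprD -mulSn exprM (prim_expr_order prim_om) expr1n.
  rewrite /p !mulmxDr -!scalemxAr !mulmxA ggg mul1mx !scalerDr !scalerA o3 scale1r.
  by rewrite -exprD addnn -mul2n -!mulmxA addrC addrA.
(* The three vectors add up to [3 u], because 1 + om + om^2 = 0, and 3 is invertible. *)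
have: [|| p 0 != 0, p 1 != 0 | p 2 != 0].
  apply: contraNT nzu; rewrite !negb_or !negbK => /and3P[/eqP p0 /eqP p1 /eqP p2].
  have: (1 + 1 + 1) *: u = 0.
    have <- : p 0%N + p 1%N + p 2%N = (1 + 1 + 1) *: u; last by rewrite p0 p1 p2 !addr0.
    rewrite /p; move: (g *m (g *m u)) => x; move: (g *m u) => y.
    have o4 : om ^+ (2 * 2) = om.
      by rewrite -[LHS]/(om * (om * (om * om))) !mulrA cube_root_cube mul1r.
    rewrite o4 ?muln0 ?expr0 ?muln1 ?expr1 expr2.
    transitivity ((1 + 1 + 1) *: u + (1 + om + om * om) *: (x + y)).
      by apply/colP=> i; rewrite !mxE; ring.
    by rewrite cube_root_sum scale0r addr0.
  by move/eqP; rewrite scaler_eq0 (negPf three_neq0).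
case/or3P=> nzp.
- by exists (p 0%N); split=> //; rewrite gp expr0 scale1r.
- exists (h *m (h *m p 1%N)); split=> //; rewrite ?nzh //.
  by rewrite (shift _ _ (shift _ _ (gp 1%N))) expr1 mulrA cube_root_cube scale1r.
exists (h *m p 2%N); split=> //; rewrite ?nzh //.
by rewrite (shift _ _ (gp 2%N)) expr2 mulrA cube_root_cube scale1r.
Qed.

(** The unit group is cyclic, so modulo cubes a non-cube [a] generates it. With [a = z^k] and
    [b = z^l], the exponent [j] solves [j k + l = 0] mod 3: it is [2 l] if [k] is 1 mod 3 and [l] if
    [k] is 2 mod 3. *)
Lemma cube_class (a b : F) : a != 0 -> b != 0 ->
  (exists d, a = d ^+ 3) \/ exists j d, a ^+ j * b = d ^+ 3.
Proof.
have: cyclic [set: {unit F}] by exact: field_unit_group_cyclic.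
case/cyclicP=> z Ez nza nzb.
have gen c : c != 0 -> exists k, c = val z ^+ k.
  rewrite -unitfE => uc; have: FinRing.unit F uc \in <[z]>%g by rewrite -Ez inE.
  by case/cycleP=> k /(congr1 val) ck; exists k; rewrite -[c]/(val (FinRing.unit F uc)) ck; exact: FinRing.val_unitX.
have [k ->] := gen a nza; have [l ->] := gen b nzb.
have cube m : (3 %| m)%N -> exists d, val z ^+ m = d ^+ 3.
  by case/dvdnP=> q ->; exists (val z ^+ q); rewrite exprM.
have : (k %% 3 < 3)%N by rewrite ltn_mod.
case Ek: (k %% 3)%N => [|[|[|//]]] _.
- by left; apply: cube; rewrite /dvdn Ek.
- right; exists (2 * l)%N; rewrite -exprM -exprD; apply: cube.
  by rewrite /dvdn -modnDml -modnMml Ek mul1n modnDml -mulSnr modnMr.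
right; exists l; rewrite -exprM -exprD; apply: cube.
by rewrite /dvdn -modnDml -modnMml Ek modnDml -mulSnr modnMr.
Qed.

(** Sorting the six factors takes three exchanges of [h] with [g], whose total factor is a power of
    [l ^+ 3]. *)
Lemma twisted_mul_cube l g h : l ^+ 3 = 1 -> g *m h = l *: (h *m g) ->
  (g *m h) *m (g *m h) *m (g *m h) = (g *m g *m g) *m (h *m h *m h).
Proof.
move=> l3 gh; have hg (Z : 'M[F]_3) : h *m (g *m Z) = (l * l) *: (g *m (h *m Z)).
  rewrite !mulmxA gh -scalemxAl scalerA -[LHS]scale1r -l3.
  by congr (_ *: _); ring.
rewrite -!mulmxA !(hg, =^~ scalemxAr) !scalerA -[RHS]scale1r; congr (_ *: _).
by transitivity ((l ^+ 3) * (l ^+ 3)); [ring | rewrite l3 mulr1].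
Qed.

(** [S] will be the preimage of an abelian subgroup. If the scalar [a = g^3] is a cube, rescaling
    [g] suffices. Otherwise some [(g^j h)^3] is the cube of a scalar; then [g^j h], rescaled, takes
    the role of [g], and [g^2] that of [h], with parameter [a^2]. *)
Lemma twisted_heis_pair (S : 'M[F]_3 -> Prop) g h :
  (forall X Y, S X -> S Y -> S (X *m Y)) ->
  (forall c X, c != 0 -> S X -> S (c *: X)) ->
  S g -> S h -> g \in unitmx -> h \in unitmx -> g *m h = om *: (h *m g) ->
  exists b g1 h1 v, [/\ S g1, S h1 & heis_pair b g1 h1 v].
Proof.
move=> SM SZ Sg Sh ug uh gh.
have [a nza ggg] := twisted_cube ug uh gh.
have [b nzb hhh] : exists2 b, b != 0 & h *m h *m h = b%:M.
  (* The twist of [h] with [g^2] is [om^-2 = om], so [twisted_cube] applies to [h] as well. *)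
  have hg : h *m (g *m g) = om *: (g *m g *m h).
    have := mxpow_twistl 2 gh; rewrite /mxpow /= mulmx1 => ->.
    by rewrite scalerA -exprS (prim_expr_order prim_om) scale1r.
  by apply: twisted_cube hg => //; rewrite unitmx_mul ug.
have cubeZ c X x : X *m X *m X = x%:M -> (c *: X) *m (c *: X) *m (c *: X) = (c ^+ 3 * x)%:M.
  move=> Xx; rewrite !(=^~ scalemxAl, =^~ scalemxAr) Xx !scalerA scale_scalar_mx.
  by congr _%:M; ring.
have unitr_cube (d x : F) : d ^+ 3 = x -> x != 0 -> d != 0 /\ d^-1 ^+ 3 * x = 1.
  move=> <-; rewrite expf_eq0 /= => nzd; split=> //.
  by rewrite -exprMn mulVf // expr1n.
case: (cube_class nza nzb) => [[d ad]|[j [d abd]]].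
  have [nzd d1] := unitr_cube _ _ (esym ad) nza.
  have [//||v hp] := @heis_pair_of_cube1 b (d^-1 *: g) h _ nzb hhh.
  - by rewrite (cubeZ _ _ _ ggg) d1.
  - by rewrite -scalemxAl gh -scalemxAr scalerA mulrC -scalerA.
  by exists b, (d^-1 *: g), h, v; split=> //; apply: SZ; rewrite ?invr_neq0.
have [nzd d1] : d != 0 /\ d^-1 ^+ 3 * (a ^+ j * b) = 1.
  by apply: unitr_cube; rewrite // mulf_neq0 // expf_neq0.
have hg : h *m g = (om * om) *: (g *m h).
  by rewrite gh scalerA cube_root_cube scale1r.
have kg : mxpow g j *m h *m g = (om * om) *: (g *m (mxpow g j *m h)).
  by rewrite -mulmxA hg -scalemxAr !mulmxA mxpow_comm.
have kgg : mxpow g j *m h *m (g *m g) = om *: (g *m g *m (mxpow g j *m h)).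
  rewrite mulmxA kg -scalemxAl -mulmxA kg -scalemxAr scalerA mulmxA.
  by rewrite mulrA cube_root_cube mul1r !mulmxA.
have kkk : (mxpow g j *m h) *m (mxpow g j *m h) *m (mxpow g j *m h) = (a ^+ j * b)%:M.
  have GGG : mxpow g j *m mxpow g j *m mxpow g j = (a ^+ j)%:M.
    elim: (j) => [|i IHi]; first by rewrite !mulmx1.
    have cz (Z : 'M[F]_3) : mxpow g i *m (g *m Z) = g *m (mxpow g i *m Z).
      by rewrite mulmxA mxpow_comm -mulmxA.
    rewrite mxpowS -!mulmxA !cz; rewrite -mulmxA in IHi; rewrite IHi.
    by rewrite !mulmxA ggg exprS -scalar_mxM.
  rewrite (twisted_mul_cube _ (mxpow_twistl j gh)) ?GGG ?hhh -?scalar_mxM //.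
  by rewrite -exprM mulnC exprM (prim_expr_order prim_om) expr1n.
pose k := d^-1 *: (mxpow g j *m h).
have [//||||v hp] := @heis_pair_of_cube1 (a * a) k (g *m g).
- by rewrite (cubeZ _ _ _ kkk) d1.
- by rewrite mulf_neq0.
- by rewrite scalar_mxM -ggg !mulmxA.
- by rewrite -scalemxAl kgg -scalemxAr !scalerA mulrC.
exists (a * a), k, (g *m g), v; split; [|exact: SM|by []].
apply: SZ; rewrite ?invr_neq0 // /k.
elim: (j) => [|i IHi]; first by rewrite mul1mx.
by rewrite mxpowS -mulmxA; apply: SM.
Qed.

End Twisted.

(** * Matrix lifts of subsets of PGL_3 *)

Section Projective.
Variable K : finFieldType.
Implicit Types (M N P X Y : 'M[K]_3) (m n : {'GL_3[K]}).

Local Notation pcoset := (coset (Z3 K)).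

Lemma GL_of_unit X : X \in unitmx -> exists m : {'GL_3[K]}, GLval m = X.
Proof. by move=> uX; exists (FinRing.Unit uX). Qed.

Lemma GL_inj m n : GLval m = GLval n -> m = n.
Proof. exact: val_inj. Qed.

Lemma GL_unitmx m : GLval m \in unitmx. Proof. exact: GL_unit. Qed.

Lemma GLM m n : GLval (m * n)%g = GLval m *m GLval n.
Proof. exact: GL_MxE. Qed.

Lemma GL1 : GLval (1%g : {'GL_3[K]}) = 1%:M.
Proof. exact: GL_1E. Qed.

(** The units [1 + E i j] with i <> j suffice: commuting with them means commuting with [E i j],
    which kills the off-diagonal entries and equates the diagonal ones. *)
Lemma scalar_of_central X :
  (forall Y, Y \in unitmx -> X *m Y = Y *m X) -> exists c, X = c%:M.
Proof.
move=> cX; pose E i j : 'M[K]_3 := delta_mx i j.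
have {}cX i j : i != j -> X *m E i j = E i j *m X.
  move=> nij; have: 1%:M + E i j \in unitmx.
    have: (1%:M + E i j) *m (1%:M - E i j) = 1%:M.
      rewrite mulmxDl !mulmxBr !mul1mx mulmx1 mul_delta_mx_0 1?eq_sym //.
      by rewrite subr0 subrK.
    by case/mulmx1_unit.
  by move/cX; rewrite mulmxDr mulmxDl mulmx1 mul1mx => /addrI.
have ev i j k l : i != j -> (X *m E i j) k l = (E i j *m X) k l by move=> /cX ->.
have E1 i j k l : (X *m E i j) k l = X k i *+ (l == j).
  rewrite mxE (bigD1 i) //= big1 ?addr0 => [|s /negPf nsi]; rewrite mxE ?eqxx ?nsi ?mulr0 //=.
  by case: (l == j); rewrite ?mulr1 ?mulr0.
have E2 i j k l : (E i j *m X) k l = X j l *+ (k == i).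
  rewrite mxE (bigD1 j) //= big1 ?addr0 => [|s /negPf nsi]; rewrite mxE ?eqxx ?nsi ?andbF ?mul0r //=.
  by case: (k == i); rewrite ?mul1r ?mul0r.
have {E1 E2}ev i j k l : i != j -> X k i *+ (l == j) = X j l *+ (k == i).
  by move=> nij; rewrite -E1 ev // E2.
exists (X o0 o0).
have := ev o0 o1 o0 o1 isT; rewrite /= ?mulr1n => e1.
have := ev o1 o2 o1 o2 isT; rewrite /= ?mulr1n => e2.
apply: eq_mx3; rewrite !mxE ?mulr1n ?mulr0n ?e1 -?e2 //=.
- by have := ev o1 o0 o0 o0 isT; rewrite /= ?mulr1n ?mulr0n.
- by have := ev o2 o0 o0 o0 isT; rewrite /= ?mulr1n ?mulr0n.
- by have := ev o0 o1 o1 o1 isT; rewrite /= ?mulr1n ?mulr0n.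
- by have := ev o2 o1 o1 o1 isT; rewrite /= ?mulr1n ?mulr0n.
- by have := ev o0 o2 o2 o2 isT; rewrite /= ?mulr1n ?mulr0n.
- by have := ev o1 o2 o2 o2 isT; rewrite /= ?mulr1n ?mulr0n.
Qed.

Lemma in_Z3 m : reflect (exists c, GLval m = c%:M) (m \in Z3 K).
Proof.
apply: (iffP (@centerP _ _ m)) => [[_ cm]|[c mc]].
  apply: scalar_of_central => Y uY; have [n <-] := GL_of_unit uY.
  by rewrite -!GLM cm ?inE.
split=> [|n _]; first by rewrite inE.
by apply: GL_inj; rewrite !GLM mc mul_mx_scalar mul_scalar_mx.
Qed.

Lemma in_norm_Z3 m : m \in 'N(Z3 K)%g.
Proof. by apply: (subsetP (normal_norm (center_normal _))); rewrite inE. Qed.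

Lemma pcosetM m n : pcoset (m * n)%g = (pcoset m * pcoset n)%g.
Proof. by rewrite morphM ?in_norm_Z3. Qed.

Lemma pcosetV m : pcoset (m^-1)%g = (pcoset m)^-1%g.
Proof. by rewrite morphV ?in_norm_Z3. Qed.

Lemma pcosetX m i : pcoset (m ^+ i)%g = (pcoset m ^+ i)%g.
Proof. by rewrite morphX ?in_norm_Z3. Qed.

Lemma pcoset1P m : reflect (exists c, GLval m = c%:M) (pcoset m == 1%g).
Proof.
apply: (iffP idP) => [/eqP/(coset_idr (in_norm_Z3 m))/in_Z3 // | ].
by move/in_Z3=> Zm; rewrite coset_id.
Qed.

Lemma pcosetP m n :
  reflect (exists2 c, c != 0 & GLval m = c *: GLval n) (pcoset m == pcoset n).
Proof.
have -> : (pcoset m == pcoset n) = (pcoset (m * n^-1)%g == 1%g).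
  by rewrite pcosetM pcosetV eq_mulgV1.
apply: (iffP (pcoset1P _)) => [[c mnc]|[c _ mnc]]; exists c.
- apply/eqP=> c0; have := GL_unitmx (m * n^-1)%g.
  by rewrite mnc c0 raddf0 unitmxE det0 unitr0.
- by rewrite -mul_scalar_mx -mnc -GLM mulgKV.
by rewrite GLM mnc -scalemxAl -GLM mulgV GL1 scalemx1.
Qed.

Lemma pcoset_surj (x : coset_of (Z3 K)) : exists m, x = pcoset m.
Proof. by have [m _ ->] := cosetP x; exists m. Qed.

Lemma in_PGL3 x : x \in PGL3 K.
Proof.
by have [m ->] := pcoset_surj x; apply: mem_morphim; rewrite ?in_norm_Z3 ?inE.
Qed.

Implicit Types A B : {set coset_of (Z3 K)}.

(** The full preimage in GL_3(K), as a predicate on bare matrices so that matrix algebra applies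
    directly. It is stable under nonzero scalars, which absorbs the factor Z. *)
Definition lift A X := exists2 m, pcoset m \in A & GLval m = X.

Lemma mem_lift A m : pcoset m \in A <-> lift A (GLval m).
Proof.
split=> [Am|[n An nm]]; first by exists m.
by rewrite -(GL_inj nm).
Qed.

Lemma lift_unit A X : lift A X -> X \in unitmx.
Proof. by case=> m _ <-; exact: GL_unitmx. Qed.

Lemma liftZ A c X : c != 0 -> lift A X -> lift A (c *: X).
Proof.
move=> nzc [m Am <-]; have: c *: GLval m \in unitmx.
  by rewrite unitmxZ ?unitfE // GL_unitmx.
case/GL_of_unit=> n nE; exists n => //.
suff -> : pcoset n = pcoset m by [].
by apply/eqP/pcosetP; exists c.
Qed.

Lemma liftM (G : {group coset_of (Z3 K)}) X Y : lift G X -> lift G Y -> lift G (X *m Y).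
Proof.
case=> m Gm <- [n Gn <-]; exists (m * n)%g; last by rewrite GLM.
by rewrite pcosetM groupM.
Qed.

Lemma lift_scalar (G : {group coset_of (Z3 K)}) c : c != 0 -> lift G c%:M.
Proof.
move=> nzc; rewrite -scalemx1; apply: liftZ => //; exists 1%g; last exact: GL1.
by rewrite morph1 group1.
Qed.

Lemma sub_lift A B : (forall X, lift A X -> lift B X) -> A \subset B.
Proof.
move=> sAB; apply/subsetP=> x Ax; have [m xm] := pcoset_surj x.
by rewrite xm; apply/mem_lift/sAB/mem_lift; rewrite -xm.
Qed.

Lemma lift_quotient (H : {set {'GL_3[K]}}) X :
  lift (H / Z3 K)%g X <-> exists n c, [/\ n \in H, c != 0 & X = c *: GLval n].
Proof.
split=> [[m /morphimP[n _ Hn /eqP/pcosetP[c nzc mc]] <-]|[n [c [Hn nzc ->]]]].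
  by exists n, c.
by apply: liftZ => //; exists n => //; apply: mem_morphim; rewrite ?in_norm_Z3.
Qed.

Lemma pcosetJ m n : (pcoset m ^ pcoset n)%g = pcoset (m ^ n)%g.
Proof. by rewrite !conjgE !pcosetM pcosetV. Qed.

Lemma lift_conj B p X : lift (B :^ pcoset p)%g X <-> lift B (GLval p *m X *m invmx (GLval p)).
Proof.
have Vp := GL_VxE p; split.
  case=> m; rewrite mem_conjg -pcosetV pcosetJ => Bm <-.
  by exists (m ^ p^-1)%g; rewrite // conjgE !GLM invgK -Vp mulmxA.
case=> m Bm mE; exists (m ^ p)%g; first by rewrite -pcosetJ memJ_conjg.
rewrite conjgE !GLM mE Vp !mulmxA mulVmx ?GL_unitmx // mul1mx.
by rewrite mulmxKV ?GL_unitmx.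
Qed.

Lemma commute_up_to_scalar m n :
  commute (pcoset m) (pcoset n) <-> exists c, GLval m *m GLval n = c *: (GLval n *m GLval m).
Proof.
rewrite /commute -!pcosetM -!GLM; split=> [/eqP/pcosetP[c _ ->]|[c mn]].
  by exists c.
apply/eqP/pcosetP; exists c => //; apply/eqP=> c0.
by have := GL_unitmx (m * n)%g; rewrite mn c0 scale0r unitmxE det0 unitr0.
Qed.

Lemma abelian_lift A :
  (forall X Y, lift A X -> lift A Y -> exists c, X *m Y = c *: (Y *m X)) <-> abelian A.
Proof.
split=> [cA|/centsP cA X Y [m Am <-] [n An <-]].
  apply/centsP=> x Ax y Ay; have [m xm] := pcoset_surj x; have [n yn] := pcoset_surj y.
  by rewrite xm yn; apply/commute_up_to_scalar/cA; apply/mem_lift; rewrite -?xm -?yn.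
by apply/commute_up_to_scalar/cA.
Qed.

Implicit Types G H : {group coset_of (Z3 K)}.

Lemma max_abelianP A : max_abelian A <->
  exists G, [/\ A = G, abelian G & forall H, abelian H -> G \subset H -> H :=: G].
Proof.
split=> [maxA|[G [-> abG maxG]]].
  have /andP[gA _] := maxsetp maxA.
  have /maxgroupP[/andP[_ abA] mA] : max_abelian (Group gA) by [].
  exists (Group gA); split=> // H abH sAH; apply: mA => //; rewrite abH andbT.
  by apply/subsetP=> x _; exact: in_PGL3.
apply/maxgroupP; split=> [|H /andP[_ abH]]; last exact: maxG.
by rewrite abG andbT; apply/subsetP=> x _; exact: in_PGL3.
Qed.

Lemma max_abelian_centralizer G : abelian G ->
  (forall X, X \in unitmx -> (forall Y, lift G Y -> exists c, X *m Y = c *: (Y *m X)) ->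
     lift G X) -> max_abelian G.
Proof.
move=> abG cG; apply/max_abelianP; exists G; split=> // H abH sGH.
apply/eqP; rewrite eqEsubset sGH andbT; apply: sub_lift => X HX; apply: cG.
  exact: lift_unit HX.
move=> Y [m Gm mY]; have /abelian_lift := abH; apply=> //.
by exists m; rewrite ?(subsetP sGH).
Qed.

Lemma max_abelianJ A x : max_abelian A -> max_abelian (A :^ x)%g.
Proof.
case/max_abelianP=> G [-> abG maxG]; apply/max_abelianP; exists (G :^ x)%G.
split; rewrite ?abelianJ // => H abH sGH.
rewrite -[H : {set _}](conjsgKV x) /=.
congr (_ :^ x)%g; apply: (maxG (H :^ x^-1)%G); first by rewrite abelianJ.
by rewrite -sub_conjg.
Qed.

Lemma conj_of_sub A G P : max_abelian A -> abelian G -> P \in unitmx ->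
  (forall X, lift A X -> exists2 Y, lift G Y & X *m P = P *m Y) -> conj_in_PGL3 A G.
Proof.
move=> /max_abelianP[B [-> _ maxB]] abG uP sAG.
(* [G :^ x] is [x^-1 G x], so the element conjugating [G] to [A] comes from the inverse of [P]. *)
have [p pP] : exists p : {'GL_3[K]}, GLval p = invmx P.
  by apply: GL_of_unit; rewrite unitmx_inv.
exists (pcoset p); first exact: in_PGL3.
have <- // := maxB (G :^ pcoset p)%G; first by rewrite abelianJ.
apply: sub_lift => X /sAG[Y GY XP]; apply/lift_conj; rewrite pP invmxK.
by rewrite -mulmxA XP mulKmx.
Qed.

Lemma conj_lift A B : conj_in_PGL3 A B ->
  exists2 P, P \in unitmx & forall X, lift A X <-> lift B (P *m X *m invmx P).
Proof.
case=> x _ ->; have [p ->] := pcoset_surj x; exists (GLval p) => [|X].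
  exact: GL_unitmx.
exact: lift_conj.
Qed.

End Projective.

(** * Quadratic and cubic extensions of a finite field *)

Section Extensions.
Variable K : finFieldType.

(** The field [L'] generated by a root [z] of [p] has the same number [q] of elements as [L], so [z]
    is a root of X^q - X. Hence [p] divides X^q - X, which over [L] is the product of all the X -
    x. *)
Lemma irreducible_root (L : fieldExtType K) (p : {poly K}) :
  irreducible_poly p -> (size p).-1 = \dim {:L} ->
  exists x : L, root (map_poly (in_alg L) p) x.
Proof.
move=> irr_p dimL; have [L' dimL' [z pz _]] := irredp_FAdjoin irr_p.
pose q := (#|K| ^ \dim {:L})%N; pose Q : {poly K} := 'X^q - 'X.
have cardL (E : fieldExtType K) : #|finvect_type E| = (#|K| ^ \dim {:E})%N.
  rewrite -(card_vspacef (Vector.class (finvect_type E))).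
  exact: (@card_vspace K (finvect_type E) (Vector.class (finvect_type E))).
have mapQ (E : fieldExtType K) : map_poly (in_alg E) Q = 'X^q - 'X.
  by rewrite rmorphB /= map_polyXn map_polyX.
have rootQ : root (map_poly (in_alg L') Q) z.
  have := expf_card (z : finvect_type L'); rewrite cardL dimL' dimL -/q => zq.
  by rewrite mapQ rootE !hornerE zq subrr.
(* Over [L'] the two polynomials share the root [z], so they are not coprime; irreducibility of [p]
   does the rest. *)
have pQ : p %| Q.
  have [//|npQ] := boolP (p %| Q).
  have: coprimep (map_poly (in_alg L') p) (map_poly (in_alg L') Q).
    rewrite coprimep_map /coprimep.
    apply: contraR npQ => /(irr_p.2 _)/(_ (dvdp_gcdl _ _)) pg.
    by rewrite -(eqp_dvdl _ pg) dvdp_gcdr.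
  by move/coprimep_root/(_ pz); rewrite -[_ == 0]/(root _ z) rootQ.
have: map_poly (in_alg L) p %| \prod_(x <- enum (finvect_type L)) ('X - (x : L)%:P).
  rewrite big_enum.
  have /= <- := finField_genPoly (finvect_type L); rewrite cardL -/q.
  by rewrite -[X in _ %| X](mapQ L) dvdp_map.
case/dvdp_prod_XsubC=> m pm; have := eqp_size pm.
rewrite size_map_poly size_prod_XsubC; case Em: (mask _ _) => [|x s] sz_p.
  by case: irr_p; rewrite sz_p.
by exists x; rewrite (eqp_root pm) Em root_prod_XsubC mem_head.
Qed.

Section Elements.
Variable L : fieldExtType K.

Lemma nonscalar_ex : (1 < \dim {:L})%N -> exists x : L, forall c, x != c%:A.
Proof.
move=> dimL; have: ~~ ({:L} <= 1)%VS.
  by rewrite -(dimv_leqif_sup (sub1v _)) dimv1 neq_ltn dimL.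
by case/subvPn=> x _ /vlineP nx; exists x => c; apply/eqP=> xc; case: nx; exists c.
Qed.

Lemma ext_scalarP (x : L) :
  (exists c, x = c%:A) \/ (forall a b : K, a%:A + b *: x = 0 -> a = 0 /\ b = 0).
Proof.
have [/vlineP[c ->]|nKx] := boolP (x \in 1%VS); first by left; exists c.
right=> a b E; have b0 : b = 0.
  apply/eqP; apply: contraR nKx => nzb; apply/vlineP; exists (- (b^-1 * a)).
  have bx : b *: x = - a%:A by apply/eqP; rewrite -addr_eq0 addrC E.
  by rewrite -[LHS]scale1r -(mulVf nzb) -scalerA bx scalerN scalerA scaleNr.
split=> //; move: E; rewrite b0 scale0r addr0 => /eqP.
by rewrite scaler_eq0 oner_eq0 orbF => /eqP.
Qed.

(** A nontrivial relation makes the degree of [x] at most 2. The degree also divides 3, so it is 1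
    and [x] lies in [K]. *)
Lemma cubic_free (x : L) : \dim {:L} = 3%N -> (forall c, x != c%:A) ->
  forall a b c : K, a%:A + b *: x + c *: (x * x) = 0 -> [/\ a = 0, b = 0 & c = 0].
Proof.
move=> dimL nKx a b c E.
have nx : x \notin 1%VS by apply/negP=> /vlineP[k /eqP]; apply/negP.
have [] := ext_scalarP x; first by case=> k /eqP; rewrite (negPf (nKx k)).
move=> free2; pose p : {poly L} := map_poly (in_alg L) (a%:P + b *: 'X + c *: 'X^2).
have px : root p x.
  rewrite rootE /p !rmorphD /= map_polyC !map_polyZ /= map_polyX map_polyXn !hornerE.
  by rewrite /= !mulr_algl -scalerAl E.
have : p \is a polyOver 1%VS.
  by apply/polyOverP=> i; rewrite coef_map /=; apply/vlineP; eexists.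
move/(minPoly_dvdp)/(_ px) => dvd_p.
have [c0|nzc] := eqVneq c 0.
  by move: E; rewrite c0 scale0r addr0 => /free2[-> ->].
have sz_p : size p = 3%N.
  rewrite size_map_poly addrC size_polyDl size_scale ?size_polyXn //.
  rewrite (leq_ltn_trans (size_polyD _ _)) // gtn_max.
  by rewrite (leq_ltn_trans (size_polyC_leq1 _)) // (leq_ltn_trans (size_scale_leq _ _)) ?size_polyX.
have nzp : p != 0 by rewrite -size_poly_eq0 sz_p.
have := dvdp_leq nzp dvd_p; rewrite sz_p size_minPoly ltnS => deg2.
have : (adjoin_degree 1%AS x %| 3)%N.
  by have := dim_Fadjoin 1%AS x; rewrite dimv1 muln1 -dimL => <-; rewrite field_dimS ?subvf.
have := adjoin_deg_eq1 1%AS x; rewrite (negPf nx).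
by case: (adjoin_degree _ _) deg2 => [|[|[|]]].
Qed.

(** X^q - X with q = #|K| is the product of the X - c for c in [K], and remains so over [L]. *)
Lemma frobenius_fixed (x : L) : x ^+ #|K| = x -> exists c, x = c%:A.
Proof.
move=> xK; have: root (map_poly (in_alg L) ('X^#|K| - 'X)) x.
  by rewrite rmorphB /= map_polyXn map_polyX rootE !hornerE xK subrr.
rewrite finField_genPoly rmorph_prod /=.
have -> : \prod_(z : K) map_poly (in_alg L) ('X - z%:P) =
    \prod_(y <- [seq z%:A | z : K]) ('X - y%:P).
  by rewrite big_image; apply: eq_bigr => b _; rewrite rmorphB /= map_polyX map_polyC.
by rewrite root_prod_XsubC => /mapP[c _ ->]; exists c.
Qed.

Lemma frobenius_linear (a : K) (x y : L) :
  (a *: x + y) ^+ #|K| = a *: x ^+ #|K| + y ^+ #|K|.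
Proof.
have [p pr_p pcharK] := finPcharP K.
have pcharL : p \in [pchar L] by rewrite pchar_lalg.
rewrite exprDn_pchar ?exprZn ?expf_card // (card_pprimeChar pcharK).
by rewrite pnatX pnatE // pcharL.
Qed.

End Elements.
End Extensions.

(** * Triangular representatives *)

Ltac mx3_ring := apply: eq_mx3; rewrite !(mxE, sum_ord3) /=; ring.

Section Triangular.
Variable K : finFieldType.
Implicit Types (M N P X Y : 'M[K]_3) (m n : {'GL_3[K]}) (A : {set coset_of (Z3 K)}).

Lemma group_set_lift A : lift A 1%:M ->
  (forall X Y, lift A X -> lift A Y -> lift A (X *m Y)) -> group_set A.
Proof.
move=> A1 AM; apply/group_setP; split=> [|x y].
  by rewrite -(morph1 (coset_morphism (Z3 K))); apply/mem_lift; rewrite GL1.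
have [m ->] := pcoset_surj x; have [n ->] := pcoset_surj y.
move=> /mem_lift Am /mem_lift An; rewrite -pcosetM; apply/mem_lift.
by rewrite GLM; apply: AM.
Qed.

Lemma abelian_of_commuting A :
  (forall X Y, lift A X -> lift A Y -> X *m Y = Y *m X) -> abelian A.
Proof.
by move=> cA; apply/abelian_lift => X Y AX AY; exists 1; rewrite scale1r; apply: cA.
Qed.

Lemma unitmx_triangular (r s t a b c : K) :
  (mx3 [:: [:: r; a; b]; [:: 0; s; c]; [:: 0; 0; t]] \in unitmx) = (r * s * t != 0).
Proof.
by rewrite unitmxE det_mx3 !mx3E /= unitfE; congr (~~ (_ == 0)); ring.
Qed.

Lemma lift_diagonals X : lift (diagonals K / Z3 K)%g X <->
  exists a b c, a * b * c != 0 /\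
    X = mx3 [:: [:: a; 0; 0]; [:: 0; b; 0]; [:: 0; 0; c]].
Proof.
split=> [DX|[a [b [c [nz XE]]]]]; last first.
  have uX : X \in unitmx by rewrite XE unitmx_triangular.
  have [n nE] := GL_of_unit uX; apply/lift_quotient; exists n, 1.
  rewrite oner_neq0 nE scale1r inE nE; split=> //; apply/is_diag_mxP.
  by rewrite XE; apply: ord3P; apply: ord3P; rewrite // mx3E.
have uX := lift_unit DX.
case/lift_quotient: DX => n [k [+ nzk XE]]; rewrite inE => /is_diag_mxP dn.
suff E : X = mx3 [:: [:: X o0 o0; 0; 0]; [:: 0; X o1 o1; 0]; [:: 0; 0; X o2 o2]].
  exists (X o0 o0), (X o1 o1), (X o2 o2); split=> //.
  by rewrite -(unitmx_triangular _ _ _ 0 0 0) -E.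
by rewrite XE; apply: eq_mx3; rewrite mx3E //= mxE dn ?mulr0.
Qed.

(** Scalar multiples free the diagonal entry that [jordan21] normalizes to 1; dividing by [t] goes
    back. *)
Lemma lift_jordan21 X : lift (jordan21 K / Z3 K)%g X <->
  exists r a t, r * t != 0 /\
    X = mx3 [:: [:: r; a; 0]; [:: 0; r; 0]; [:: 0; 0; t]].
Proof.
split=> [|[r [a [t [nz ->]]]]].
  case/lift_quotient=> n [k [+ nzk ->]]; rewrite inE.
  case/existsP=> r /existsP[a /andP[nzr /eqP->]]; exists (k * r), (k * a), k.
  by rewrite !mulf_neq0 //; split=> //; mx3_ring.
have [nzr nzt] : r != 0 /\ t != 0 by apply/andP; rewrite -negb_or -mulf_eq0.
have : mx3 [:: [:: r / t; a / t; 0]; [:: 0; r / t; 0]; [:: 0; 0; 1]] \in unitmx.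
  by rewrite unitmx_triangular !mulf_neq0 ?invr_neq0 ?oner_neq0.
case/GL_of_unit=> n nE; apply/lift_quotient; exists n, t; split=> //; last first.
  by rewrite nE; apply: eq_mx3; rewrite !(mxE, sum_ord3) /=; field.
rewrite inE; apply/existsP; exists (r / t); apply/existsP; exists (a / t).
by rewrite nE eqxx mulf_neq0 ?invr_neq0.
Qed.

Lemma lift_jordan3 X : lift (jordan3 K / Z3 K)%g X <->
  exists r a b, r != 0 /\
    X = mx3 [:: [:: r; a; b]; [:: 0; r; a]; [:: 0; 0; r]].
Proof.
split=> [|[r [a [b [nz ->]]]]].
  case/lift_quotient=> n [k [+ nzk ->]]; rewrite inE.
  case/existsP=> a /existsP[b /eqP->]; exists k, (k * a), (k * b).
  by split=> //; mx3_ring.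
have : mx3 [:: [:: 1; a / r; b / r]; [:: 0; 1; a / r]; [:: 0; 0; 1]] \in unitmx.
  by rewrite unitmx_triangular !mulr1 oner_neq0.
case/GL_of_unit=> n nE; apply/lift_quotient; exists n, r; split=> //; last first.
  by rewrite nE; apply: eq_mx3; rewrite !(mxE, sum_ord3) /=; field.
rewrite inE; apply/existsP; exists (a / r); apply/existsP; exists (b / r).
by rewrite nE eqxx.
Qed.

Lemma lift_column_unipotents X : lift (column_unipotents K / Z3 K)%g X <->
  exists r a b, r != 0 /\
    X = mx3 [:: [:: r; 0; b]; [:: 0; r; a]; [:: 0; 0; r]].
Proof.
split=> [|[r [a [b [nz ->]]]]].
  case/lift_quotient=> n [k [+ nzk ->]]; rewrite inE.
  case/existsP=> a /existsP[b /eqP->]; exists k, (k * a), (k * b).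
  by split=> //; mx3_ring.
have : mx3 [:: [:: 1; 0; b / r]; [:: 0; 1; a / r]; [:: 0; 0; 1]] \in unitmx.
  by rewrite unitmx_triangular !mulr1 oner_neq0.
case/GL_of_unit=> n nE; apply/lift_quotient; exists n, r; split=> //; last first.
  by rewrite nE; apply: eq_mx3; rewrite !(mxE, sum_ord3) /=; field.
rewrite inE; apply/existsP; exists (a / r); apply/existsP; exists (b / r).
by rewrite nE eqxx.
Qed.

Lemma lift_row_unipotents X : lift (row_unipotents K / Z3 K)%g X <->
  exists r a b, r != 0 /\
    X = mx3 [:: [:: r; a; b]; [:: 0; r; 0]; [:: 0; 0; r]].
Proof.
split=> [|[r [a [b [nz ->]]]]].
  case/lift_quotient=> n [k [+ nzk ->]]; rewrite inE.
  case/existsP=> a /existsP[b /eqP->]; exists k, (k * a), (k * b).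
  by split=> //; mx3_ring.
have : mx3 [:: [:: 1; a / r; b / r]; [:: 0; 1; 0]; [:: 0; 0; 1]] \in unitmx.
  by rewrite unitmx_triangular !mulr1 oner_neq0.
case/GL_of_unit=> n nE; apply/lift_quotient; exists n, r; split=> //; last first.
  by rewrite nE; apply: eq_mx3; rewrite !(mxE, sum_ord3) /=; field.
rewrite inE; apply/existsP; exists (a / r); apply/existsP; exists (b / r).
by rewrite nE eqxx.
Qed.

Lemma scalar_mx3 (c : K) : c%:M = mx3 [:: [:: c; 0; 0]; [:: 0; c; 0]; [:: 0; 0; c]].
Proof. by apply: eq_mx3; rewrite !mxE /= ?mulr1n ?mulr0n. Qed.

Lemma diagonals_group : group_set (diagonals K / Z3 K)%g.
Proof.
apply: group_set_lift => [|X Y]; first by apply/lift_diagonals; exists 1, 1, 1; rewrite !mulr1 oner_neq0 scalar_mx3.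
move=> /lift_diagonals[a [b [c [nz ->]]]] /lift_diagonals[a' [b' [c' [nz' ->]]]].
apply/lift_diagonals; exists (a * a'), (b * b'), (c * c'); split; last by mx3_ring.
by have := mulf_neq0 nz nz'; congr (~~ (_ == 0)); ring.
Qed.

Lemma jordan21_group : group_set (jordan21 K / Z3 K)%g.
Proof.
apply: group_set_lift => [|X Y]; first by apply/lift_jordan21; exists 1, 0, 1; rewrite !mulr1 oner_neq0 scalar_mx3.
move=> /lift_jordan21[r [a [t [nz ->]]]] /lift_jordan21[r' [a' [t' [nz' ->]]]].
apply/lift_jordan21; exists (r * r'), (r * a' + a * r'), (t * t'); split; last by mx3_ring.
by rewrite mulrACA mulf_neq0.
Qed.

Lemma jordan3_group : group_set (jordan3 K / Z3 K)%g.
Proof.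
apply: group_set_lift => [|X Y]; first by apply/lift_jordan3; exists 1, 0, 0; rewrite oner_neq0 scalar_mx3.
move=> /lift_jordan3[r [a [b [nz ->]]]] /lift_jordan3[r' [a' [b' [nz' ->]]]].
apply/lift_jordan3; exists (r * r'), (r * a' + a * r'), (r * b' + a * a' + b * r').
by split; [rewrite mulf_neq0 | mx3_ring].
Qed.

Lemma column_unipotents_group : group_set (column_unipotents K / Z3 K)%g.
Proof.
apply: group_set_lift => [|X Y]; first by apply/lift_column_unipotents; exists 1, 0, 0; rewrite oner_neq0 scalar_mx3.
move=> /lift_column_unipotents[r [a [b [nz ->]]]] /lift_column_unipotents[r' [a' [b' [nz' ->]]]].
apply/lift_column_unipotents; exists (r * r'), (r * a' + a * r'), (r * b' + b * r').
by split; [rewrite mulf_neq0 | mx3_ring].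
Qed.

Lemma row_unipotents_group : group_set (row_unipotents K / Z3 K)%g.
Proof.
apply: group_set_lift => [|X Y]; first by apply/lift_row_unipotents; exists 1, 0, 0; rewrite oner_neq0 scalar_mx3.
move=> /lift_row_unipotents[r [a [b [nz ->]]]] /lift_row_unipotents[r' [a' [b' [nz' ->]]]].
apply/lift_row_unipotents; exists (r * r'), (r * a' + a * r'), (r * b' + b * r').
by split; [rewrite mulf_neq0 | mx3_ring].
Qed.

Lemma diagonals_comm X Y : lift (diagonals K / Z3 K)%g X ->
  lift (diagonals K / Z3 K)%g Y -> X *m Y = Y *m X.
Proof.
move=> /lift_diagonals[a [b [c [_ ->]]]] /lift_diagonals[a' [b' [c' [_ ->]]]].
mx3_ring.
Qed.

Lemma jordan21_comm X Y : lift (jordan21 K / Z3 K)%g X ->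
  lift (jordan21 K / Z3 K)%g Y -> X *m Y = Y *m X.
Proof.
move=> /lift_jordan21[a [b [c [_ ->]]]] /lift_jordan21[a' [b' [c' [_ ->]]]].
mx3_ring.
Qed.

Lemma jordan3_comm X Y : lift (jordan3 K / Z3 K)%g X ->
  lift (jordan3 K / Z3 K)%g Y -> X *m Y = Y *m X.
Proof.
move=> /lift_jordan3[a [b [c [_ ->]]]] /lift_jordan3[a' [b' [c' [_ ->]]]].
mx3_ring.
Qed.

Lemma column_unipotents_comm X Y : lift (column_unipotents K / Z3 K)%g X ->
  lift (column_unipotents K / Z3 K)%g Y -> X *m Y = Y *m X.
Proof.
move=> /lift_column_unipotents[a [b [c [_ ->]]]] /lift_column_unipotents[a' [b' [c' [_ ->]]]].
mx3_ring.
Qed.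

Lemma row_unipotents_comm X Y : lift (row_unipotents K / Z3 K)%g X ->
  lift (row_unipotents K / Z3 K)%g Y -> X *m Y = Y *m X.
Proof.
move=> /lift_row_unipotents[a [b [c [_ ->]]]] /lift_row_unipotents[a' [b' [c' [_ ->]]]].
mx3_ring.
Qed.

End Triangular.

(** * Maximality of the triangular representatives *)

Section Twists.
Variable K : finFieldType.
Implicit Types (M N P X Y : 'M[K]_3) (u v : 'cV[K]_3) (w : 'rV[K]_3).
Implicit Types (A : {set coset_of (Z3 K)}).

Lemma max_abelian_of_lift A : group_set A -> abelian A ->
  (forall X, X \in unitmx -> (forall Y, lift A Y -> exists c, X *m Y = c *: (Y *m X)) ->
     lift A X) -> max_abelian A.
Proof. by move=> gA; exact: (@max_abelian_centralizer _ (Group gA)). Qed.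

(* M (1 + u w) = c (1 + u w) M makes (1 - c) M a matrix of rank at most 2. *)
Lemma twist_rank1 M u w c : M \in unitmx ->
  M *m (1%:M + u *m w) = c *: ((1%:M + u *m w) *m M) ->
  M *m (u *m w) = u *m w *m M.
Proof.
move=> uM E; have [x nzx [wx wMx]] := ker_dot2 w (w *m M).
have c1 : c = 1.
  have := congr1 (mulmx^~ x) E; rewrite -mulmxA -scalemxAl -[_ *m M *m x]mulmxA.
  have wMx' : dot w (M *m x) = 0 by rewrite /dot mulmxA.
  rewrite !mulmxDl !mul1mx !mulmx_dot wx wMx' !scale0r !addr0 => /eqP.
  rewrite -subr_eq0 -[X in X - _]scale1r -scalerBl scaler_eq0 subr_eq0 eq_sym.
  by case/orP=> /eqP // /(unit_mulmx_eq0 uM) x0; rewrite x0 eqxx in nzx.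
by move: E; rewrite c1 scale1r mulmxDr mulmxDl mulmx1 mul1mx => /addrI.
Qed.

(** Entrywise form of commuting with the matrix unit at (i, j): column [i] of [M] moved to column
    [j] equals row [j] moved to row [i]. Each instance yields a zero entry or the equality of two
    diagonal entries. *)
Lemma twist_delta M i j a c : M \in unitmx -> a != 0 ->
  M *m (1%:M + a *: delta_mx i j) = c *: ((1%:M + a *: delta_mx i j) *m M) ->
  forall k l, M k i *+ (l == j) = M j l *+ (k == i).
Proof.
move=> uM nza; have -> : a *: delta_mx i j = (a *: delta_mx i 0) *m delta_mx (0 : 'I_1) j :> 'M[K]_3.
  by rewrite -scalemxAl mul_delta_mx.
move=> /(twist_rank1 uM); rewrite -scalemxAl mul_delta_mx -scalemxAr -scalemxAl.
move=> /(scalerI nza) E k l.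
have -> : M k i *+ (l == j) = (M *m delta_mx i j) k l.
  rewrite mxE (bigD1 i) //= big1 ?addr0 => [|s /negPf nsi]; rewrite mxE ?eqxx ?nsi ?mulr0 //=.
  by case: (l == j); rewrite ?mulr1 ?mulr0.
rewrite E mxE (bigD1 j) //= big1 ?addr0 => [|s /negPf nsi]; rewrite mxE ?eqxx ?nsi ?andbF ?mul0r //=.
by case: (k == i); rewrite ?mul1r ?mul0r.
Qed.

(** [M] carries the fixed vector [v] to an eigenvector of [N] for [c^-1], and 1 is the only
    eigenvalue. *)
Lemma twist_eigen M N v c : M \in unitmx -> v != 0 -> N *m v = v ->
  (forall k (y : 'cV[K]_3), y != 0 -> N *m y = k *: y -> k = 1) ->
  M *m N = c *: (N *m M) -> M *m N = N *m M.
Proof.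
move=> uM nzv Nv eigN E; have nzMv : M *m v != 0.
  by apply: contraNneq nzv => /(unit_mulmx_eq0 uM) ->.
have E' : M *m v = c *: (N *m (M *m v)) by rewrite -{1}Nv mulmxA E -scalemxAl mulmxA.
have nzc : c != 0 by apply: contraNneq nzMv => c0; rewrite E' c0 scale0r.
have /(eigN _ _ nzMv) : N *m (M *m v) = c^-1 *: (M *m v).
  by rewrite {2}E' scalerA mulVf // scale1r.
by move/(congr1 (fun x => x^-1)); rewrite invrK invr1 E => ->; rewrite scale1r.
Qed.

(** Cancelling [M] between the two relations leaves [1 - c' = (c' - c) N]. As [N] is not scalar,
    [c = c' = 1]. *)
Lemma twist_sum M N c c' : M \in unitmx -> (forall k, N != k%:M) ->
  M *m N = c *: (N *m M) -> M *m (1%:M + N) = c' *: ((1%:M + N) *m M) ->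
  M *m N = N *m M.
Proof.
move=> uM nN E; rewrite mulmxDr mulmxDl mulmx1 mul1mx E scalerDr => E'.
have c'1 : c' = 1 /\ c' = c.
  have E2 : (1 - c')%:M = (c' - c) *: N.
    apply: (unit_mulmx_inj uM); rewrite mul_scalar_mx scalerBl scale1r -scalemxAl scalerBl.
    by apply/eqP; rewrite -subr_eq0 opprB addrACA -opprD E' subrr.
  have [|ncc] := eqVneq c' c.
    move=> cc; split=> //; move: E2; rewrite cc subrr scale0r => /matrixP/(_ o0 o0).
    by rewrite !mxE mulr1n => /eqP; rewrite subr_eq0 => /eqP.
  case/negP: (nN ((c' - c)^-1 * (1 - c'))).
  by rewrite -scale_scalar_mx E2 scalerA mulVf ?subr_eq0 // scale1r.
by case: c'1 => c1 <-; rewrite c1 scale1r.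
Qed.

Lemma exists_neq01 : #|K| != 2%N -> exists2 a : K, a != 0 & a != 1.
Proof.
move=> nK2; have: ~~ ([set: K] \subset [set 0; 1]).
  apply: contra nK2 => /subset_leq_card; rewrite cardsT cards2 eq_sym oner_neq0 => leK.
  by rewrite eqn_leq leK finNzRing_gt1.
by case/subsetPn=> a _; rewrite !inE negb_or => /andP[nza na1]; exists a.
Qed.

(** The test elements diag(a, 1, 1) and diag(1, 1, a), with [a] other than 0 and 1, kill all
    off-diagonal entries; such an [a] is what q > 2 provides. *)
Lemma diagonals_max : #|K| != 2%N -> max_abelian (diagonals K / Z3 K)%g.
Proof.
case/exists_neq01=> a nza na1; apply: max_abelian_of_lift.
- exact: diagonals_group.
- by apply: abelian_of_commuting; exact: diagonals_comm.
move=> X uX cX; have nza1 : a - 1 != 0 by rewrite subr_eq0.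
have [c0 e0] : exists c, X *m (1%:M + (a - 1) *: delta_mx o0 o0) =
    c *: ((1%:M + (a - 1) *: delta_mx o0 o0) *m X).
  apply: cX; apply/lift_diagonals; exists a, 1, 1; rewrite !mulr1; split=> //.
  by apply: eq_mx3; rewrite !mxE /=; ring.
have [c2 e2] : exists c, X *m (1%:M + (a - 1) *: delta_mx o2 o2) =
    c *: ((1%:M + (a - 1) *: delta_mx o2 o2) *m X).
  apply: cX; apply/lift_diagonals; exists 1, 1, a; rewrite !mul1r; split=> //.
  by apply: eq_mx3; rewrite !mxE /=; ring.
have {}e0 := twist_delta uX nza1 e0; have {}e2 := twist_delta uX nza1 e2.
have XE : X = mx3 [:: [:: X o0 o0; 0; 0]; [:: 0; X o1 o1; 0]; [:: 0; 0; X o2 o2]].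
  apply: eq_mx3; rewrite mx3E //=.
  - by have := e0 o0 o1; rewrite /= !(mulr1n, mulr0n) => <-.
  - by have := e0 o0 o2; rewrite /= !(mulr1n, mulr0n) => <-.
  - by have := e0 o1 o0; rewrite /= !(mulr1n, mulr0n) => ->.
  - by have := e2 o1 o2; rewrite /= !(mulr1n, mulr0n) => ->.
  - by have := e2 o2 o0; rewrite /= !(mulr1n, mulr0n) => <-.
  - by have := e2 o2 o1; rewrite /= !(mulr1n, mulr0n) => <-.
apply/lift_diagonals; exists (X o0 o0), (X o1 o1), (X o2 o2); split=> //.
by rewrite -(unitmx_triangular _ _ _ 0 0 0) -XE.
Qed.

Lemma jordan21_max : #|K| != 2%N -> max_abelian (jordan21 K / Z3 K)%g.
Proof.
case/exists_neq01=> a nza na1; apply: max_abelian_of_lift.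
- exact: jordan21_group.
- by apply: abelian_of_commuting; exact: jordan21_comm.
move=> X uX cX; have nza1 : a - 1 != 0 by rewrite subr_eq0.
have [c0 e0] : exists c, X *m (1%:M + 1 *: delta_mx o0 o1) =
    c *: ((1%:M + 1 *: delta_mx o0 o1) *m X).
  apply: cX; apply/lift_jordan21; exists 1, 1, 1; rewrite !mulr1 oner_neq0; split=> //.
  by apply: eq_mx3; rewrite !mxE /=; ring.
have [c2 e2] : exists c, X *m (1%:M + (a - 1) *: delta_mx o2 o2) =
    c *: ((1%:M + (a - 1) *: delta_mx o2 o2) *m X).
  apply: cX; apply/lift_jordan21; exists 1, 0, a; rewrite !mul1r; split=> //.
  by apply: eq_mx3; rewrite !mxE /=; ring.
have {}e0 := twist_delta uX (oner_neq0 _) e0; have {}e2 := twist_delta uX nza1 e2.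
have XE : X = mx3 [:: [:: X o0 o0; X o0 o1; 0]; [:: 0; X o0 o0; 0]; [:: 0; 0; X o2 o2]].
  apply: eq_mx3; rewrite mx3E //=.
  - by have := e2 o0 o2; rewrite /= !(mulr1n, mulr0n) => ->.
  - by have := e0 o0 o0; rewrite /= !(mulr1n, mulr0n) => <-.
  - by have := e0 o0 o1; rewrite /= !(mulr1n, mulr0n) => <-.
  - by have := e2 o1 o2; rewrite /= !(mulr1n, mulr0n) => ->.
  - by have := e2 o2 o0; rewrite /= !(mulr1n, mulr0n) => <-.
  - by have := e2 o2 o1; rewrite /= !(mulr1n, mulr0n) => <-.
apply/lift_jordan21; exists (X o0 o0), (X o0 o1), (X o2 o2); split=> //.
move: uX; rewrite {1}XE unitmx_triangular; apply: contra => /eqP E.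
by rewrite -mulrA E mulr0.
Qed.

Lemma column_unipotents_max : max_abelian (column_unipotents K / Z3 K)%g.
Proof.
apply: max_abelian_of_lift.
- exact: column_unipotents_group.
- by apply: abelian_of_commuting; exact: column_unipotents_comm.
move=> X uX cX.
have [c0 e0] : exists c, X *m (1%:M + 1 *: delta_mx o0 o2) =
    c *: ((1%:M + 1 *: delta_mx o0 o2) *m X).
  apply: cX; apply/lift_column_unipotents; exists 1, 0, 1; rewrite oner_neq0; split=> //.
  by apply: eq_mx3; rewrite !mxE /=; ring.
have [c2 e2] : exists c, X *m (1%:M + 1 *: delta_mx o1 o2) =
    c *: ((1%:M + 1 *: delta_mx o1 o2) *m X).
  apply: cX; apply/lift_column_unipotents; exists 1, 1, 0; rewrite oner_neq0; split=> //.
  by apply: eq_mx3; rewrite !mxE /=; ring.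
have {}e0 := twist_delta uX (oner_neq0 _) e0; have {}e2 := twist_delta uX (oner_neq0 _) e2.
have XE : X = mx3 [:: [:: X o0 o0; 0; X o0 o2]; [:: 0; X o0 o0; X o1 o2]; [:: 0; 0; X o0 o0]].
  have X22 : X o2 o2 = X o0 o0 by have := e0 o0 o2; rewrite /= !(mulr1n, mulr0n) => <-.
  apply: eq_mx3; rewrite mx3E //=.
  - by have := e2 o0 o2; rewrite /= !(mulr1n, mulr0n) => ->.
  - by have := e0 o1 o2; rewrite /= !(mulr1n, mulr0n) => ->.
  - by have := e2 o1 o2; rewrite /= !(mulr1n, mulr0n) => ->; exact: X22.
  - by have := e0 o2 o2; rewrite /= !(mulr1n, mulr0n) => ->.
  - by have := e2 o2 o2; rewrite /= !(mulr1n, mulr0n) => ->.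
apply/lift_column_unipotents; exists (X o0 o0), (X o1 o2), (X o0 o2); split=> //.
by move: uX; rewrite {1}XE unitmx_triangular; apply: contraNneq => ->; rewrite !mul0r.
Qed.

Lemma row_unipotents_max : max_abelian (row_unipotents K / Z3 K)%g.
Proof.
apply: max_abelian_of_lift.
- exact: row_unipotents_group.
- by apply: abelian_of_commuting; exact: row_unipotents_comm.
move=> X uX cX.
have [c0 e0] : exists c, X *m (1%:M + 1 *: delta_mx o0 o1) =
    c *: ((1%:M + 1 *: delta_mx o0 o1) *m X).
  apply: cX; apply/lift_row_unipotents; exists 1, 1, 0; rewrite oner_neq0; split=> //.
  by apply: eq_mx3; rewrite !mxE /=; ring.
have [c2 e2] : exists c, X *m (1%:M + 1 *: delta_mx o0 o2) =
    c *: ((1%:M + 1 *: delta_mx o0 o2) *m X).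
  apply: cX; apply/lift_row_unipotents; exists 1, 0, 1; rewrite oner_neq0; split=> //.
  by apply: eq_mx3; rewrite !mxE /=; ring.
have {}e0 := twist_delta uX (oner_neq0 _) e0; have {}e2 := twist_delta uX (oner_neq0 _) e2.
have XE : X = mx3 [:: [:: X o0 o0; X o0 o1; X o0 o2]; [:: 0; X o0 o0; 0]; [:: 0; 0; X o0 o0]].
  apply: eq_mx3; rewrite mx3E //=.
  - by have := e0 o0 o0; rewrite /= !(mulr1n, mulr0n) => <-.
  - by have := e0 o0 o1; rewrite /= !(mulr1n, mulr0n) => <-.
  - by have := e0 o0 o2; rewrite /= !(mulr1n, mulr0n) => <-.
  - by have := e2 o0 o0; rewrite /= !(mulr1n, mulr0n) => <-.
  - by have := e2 o0 o1; rewrite /= !(mulr1n, mulr0n) => <-.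
  - by have := e2 o0 o2; rewrite /= !(mulr1n, mulr0n) => <-.
apply/lift_row_unipotents; exists (X o0 o0), (X o0 o1), (X o0 o2); split=> //.
by move: uX; rewrite {1}XE unitmx_triangular; apply: contraNneq => ->; rewrite !mul0r.
Qed.

(** The block [N] minus 1 has rank 2, so the rank-one test is replaced by the uniqueness of the
    eigenvalue 1. Commuting with a single Jordan block then forces an upper triangular Toeplitz
    matrix. *)
Lemma jordan3_max : max_abelian (jordan3 K / Z3 K)%g.
Proof.
apply: max_abelian_of_lift.
- exact: jordan3_group.
- by apply: abelian_of_commuting; exact: jordan3_comm.
move=> X uX cX; pose N : 'M[K]_3 := mx3 [:: [:: 1; 1; 0]; [:: 0; 1; 1]; [:: 0; 0; 1]].
have [c e] : exists c, X *m N = c *: (N *m X).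
  by apply: cX; apply/lift_jordan3; exists 1, 1, 0; rewrite oner_neq0.
have {e}XN : X *m N = N *m X.
  apply: (twist_eigen (v := delta_mx o0 0)) e => //.
  - by apply/eqP=> /colP/(_ o0)/eqP; rewrite !mxE /= oner_eq0.
  - by apply: eq_cV3; rewrite !(mxE, sum_ord3) /=; ring.
  move=> k y nzy Ny; apply/eqP/negPn/negP => nk1; case/negP: nzy.
  have nz : k - 1 != 0 by rewrite subr_eq0.
  have E i : (N *m y) i 0 = k * y i 0 by rewrite Ny mxE.
  have y2 : y o2 0 = 0.
    apply: (mulfI nz); rewrite mulr0 mulrBl -E mxE sum_ord3 !mx3E /=; ring.
  have y1 : y o1 0 = 0.
    apply: (mulfI nz); rewrite mulr0 mulrBl -E mxE sum_ord3 !mx3E /= y2; ring.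
  have y0 : y o0 0 = 0.
    apply: (mulfI nz); rewrite mulr0 mulrBl -E mxE sum_ord3 !mx3E /= y1; ring.
  by apply/eqP/eq_cV3; rewrite mxE.
have E k l : X k o0 * N o0 l + X k o1 * N o1 l + X k o2 * N o2 l =
    N k o0 * X o0 l + N k o1 * X o1 l + N k o2 * X o2 l.
  by have /matrixP/(_ k l) := XN; rewrite [LHS]mxE [RHS]mxE !sum_ord3.
have e10 := E o0 o0; have e11 := E o0 o1; have e12 := E o0 o2; have e20 := E o1 o0.
have e21 := E o1 o1; have e22 := E o1 o2.
rewrite !mx3E /= !(mul0r, mulr0, mul1r, mulr1, addr0, add0r) in e10 e11 e12 e20 e21 e22.
have X10 : X o1 o0 = 0 by apply: (addrI (X o0 o0)); rewrite addr0 -e10.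
have X20 : X o2 o0 = 0 by apply: (addrI (X o1 o0)); rewrite addr0 -e20.
have X11 : X o1 o1 = X o0 o0 by apply: (addrI (X o0 o1)); rewrite -e11 addrC.
have X21 : X o2 o1 = 0 by apply: (addrI (X o1 o1)); rewrite -e21 X10 add0r addr0.
have X12 : X o1 o2 = X o0 o1 by apply: (addrI (X o0 o2)); rewrite -e12 addrC.
have X22 : X o2 o2 = X o0 o0 by apply: (addrI (X o1 o2)); rewrite -e22 X11 addrC.
have XE : X = mx3 [:: [:: X o0 o0; X o0 o1; X o0 o2]; [:: 0; X o0 o0; X o0 o1]; [:: 0; 0; X o0 o0]].
  by apply: eq_mx3; rewrite mx3E.
apply/lift_jordan3; exists (X o0 o0), (X o0 o1), (X o0 o2); split=> //.
by move: uX; rewrite {1}XE unitmx_triangular; apply: contraNneq => ->; rewrite !mul0r.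
Qed.

End Twists.

(** * Nonsplit tori *)

Section Realization.
Variables (K : finFieldType) (V : vectType K) (phi : {linear 'cV[K]_3 -> V}).
Hypothesis bij_phi : bijective phi.
Implicit Types (X Y : 'M[K]_3) (f g : V -> V).

Definition acts_by f X := forall v, phi (X *m v) = f (phi v).

Lemma realizesP f (m : {'GL_3[K]}) : reflect (acts_by f (GLval m)) (realizes phi f m).
Proof. by apply: (iffP forallP) => fm v; apply/eqP. Qed.

Lemma acts_by_inj f X Y : acts_by f X -> acts_by f Y -> X = Y.
Proof.
move=> fX fY; have XY (v : 'cV[K]_3) : X *m v = Y *m v by apply: (bij_inj bij_phi); rewrite fX fY.
have delta (M : 'M[K]_3) i j : M i j = (M *m delta_mx j 0) i (0 : 'I_1).
  by rewrite -colE mxE.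
by apply/matrixP=> i j; rewrite !delta XY.
Qed.

Lemma acts_by_ex f : (forall a x y, f (a *: x + y) = a *: f x + f y) -> injective f ->
  exists2 X, X \in unitmx & acts_by f X.
Proof.
move=> lin_f inj_f; have [psi phiK psiK] := bij_phi.
have f0 : f 0 = 0 by have := lin_f (-1) 0 0; rewrite scaler0 addr0 scaleN1r addNr.
have fZ a x : f (a *: x) = a *: f x by rewrite -[a *: x]addr0 lin_f f0 addr0.
have fD x y : f (x + y) = f x + f y by rewrite -[x]scale1r lin_f !scale1r.
pose e i : 'cV[K]_3 := delta_mx i 0; pose g i := psi (f (phi (e i))).
have fX : acts_by f (col3 (g o0) (g o1) (g o2)).
  move=> v; rewrite col3_mul !linearD !linearZ /= !psiK -!fZ -!fD -!linearZ -!linearD /=.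
  by congr (f (phi _)); apply: eq_cV3; rewrite !mxE /=; ring.
exists (col3 (g o0) (g o1) (g o2)) => //; apply: unitmx_inj => u Xu.
apply: (bij_inj bij_phi); apply: inj_f; rewrite -fX Xu.
by rewrite !linear0 f0.
Qed.

Lemma acts_by_comp f g X Y : acts_by f X -> acts_by g Y -> acts_by (f \o g) (X *m Y).
Proof. by move=> fX gY v; rewrite -mulmxA fX gY. Qed.

End Realization.

Section CubicTorusRep.
Variables (K : finFieldType) (L : fieldExtType K) (phi : {linear 'cV[K]_3 -> L}).
Hypothesis bij_phi : bijective phi.
Hypothesis dimL : \dim {:L} = 3%N.
Implicit Types (X Y : 'M[K]_3) (x y : L).
Local Notation R := (cubic_units phi / Z3 K)%g.
Local Notation mulby x := (acts_by phi (fun y : L => x * y)).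

Lemma mulby_ex x : x != 0 -> exists2 X, X \in unitmx & mulby x X.
Proof.
move=> nzx; apply: acts_by_ex => // [a y z|]; last exact: mulfI.
by rewrite mulrDr scalerAr.
Qed.

Lemma mulbyM x y X Y : mulby x X -> mulby y Y -> mulby (x * y) (X *m Y).
Proof. by move=> fX gY v; rewrite -mulmxA fX gY mulrA. Qed.

Lemma mulby_scalar c : mulby c%:A c%:M.
Proof. by move=> v; rewrite mul_scalar_mx linearZ /= mulr_algl. Qed.

Lemma mulbyZ c x X : mulby x X -> mulby (c *: x) (c *: X).
Proof. by move=> fX v; rewrite -scalemxAl linearZ /= fX scalerAl. Qed.

Lemma mulbyD x y X Y : mulby x X -> mulby y Y -> mulby (x + y) (X + Y).
Proof. by move=> fX gY v; rewrite mulmxDl linearD /= fX gY mulrDl. Qed.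

Lemma mulby_poly2 a b c x X : mulby x X ->
  mulby (a%:A + b *: x + c *: (x * x)) (poly2 a b c X).
Proof.
move=> xX; apply: mulbyD; last exact/mulbyZ/mulbyM.
by apply: mulbyD; [exact: mulby_scalar | exact: mulbyZ].
Qed.

Lemma lift_cubic X : lift R X <-> exists2 x, x != 0 & mulby x X.
Proof.
split=> [|[x nzx xX]].
  case/lift_quotient=> n [c [+ nzc ->]]; rewrite inE => /existsP[x /andP[nzx /realizesP xn]].
  exists (c *: (x : L)); first by rewrite scaler_eq0 negb_or nzc.
  exact: mulbyZ.
have [Y uY xY] := mulby_ex nzx; have [n nY] := GL_of_unit uY.
rewrite (acts_by_inj bij_phi xX xY) -nY; apply/lift_quotient; exists n, 1.
rewrite oner_neq0 scale1r inE; split=> //; apply/existsP; exists x; rewrite nzx.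
by apply/realizesP; rewrite nY.
Qed.

Lemma cubic_comm X Y : lift R X -> lift R Y -> X *m Y = Y *m X.
Proof.
move=> /lift_cubic[x _ xX] /lift_cubic[y _ yY].
by apply: (acts_by_inj bij_phi (mulbyM xX yY)); rewrite mulrC; exact: mulbyM.
Qed.

Lemma cubic_group : group_set R.
Proof.
apply: group_set_lift => [|X Y /lift_cubic[x nzx xX] /lift_cubic[y nzy yY]].
  apply/lift_cubic; exists 1; first exact: oner_neq0.
  by have := mulby_scalar 1; rewrite scale1r.
by apply/lift_cubic; exists (x * y); [rewrite mulf_neq0 | exact: mulbyM].
Qed.

Lemma cubic_krylov x X v : (forall c, x != c%:A) -> mulby x X -> phi v = 1 ->
  krylov X v \in unitmx.
Proof.
move=> nKx xX v1; apply: col3_unitP => a b c /(congr1 phi).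
rewrite !linearD !linearZ /= !xX v1 linear0 mulr1.
exact: cubic_free.
Qed.

(** Comparing the twists with [x] and [1 + x] shows that [X] commutes with [N]. It is then a
    polynomial in [N], that is, multiplication by an element of [L], which is nonzero because [X] is
    invertible. *)
Lemma cubic_max : max_abelian R.
Proof.
apply: max_abelian_of_lift; first exact: cubic_group.
  by apply: abelian_of_commuting; exact: cubic_comm.
move=> X uX cX; have [|x nKx] := @nonscalar_ex K L; first by rewrite dimL.
have nzx : x != 0 by have := nKx 0; rewrite scale0r.
have nzx1 : 1 + x != 0 by have := nKx (-1); rewrite scaleN1r -addr_eq0 addrC.
have [N uN xN] := mulby_ex nzx.
have xN1 : mulby (1 + x) (1%:M + N).
  by apply: mulbyD => //; have := mulby_scalar 1; rewrite scale1r.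
have [c e] : exists c, X *m N = c *: (N *m X).
  by apply: cX; apply/lift_cubic; exists x.
have [c' e'] : exists c', X *m (1%:M + N) = c' *: ((1%:M + N) *m X).
  by apply: cX; apply/lift_cubic; exists (1 + x).
have nN k : N != k%:M.
  apply: contraNneq (nKx k) => Nk; move: xN; rewrite Nk => /(_ _) xk.
  have [psi _ psiK] := bij_phi; have := xk (psi 1).
  by rewrite (mulby_scalar k) psiK !mulr1 => ->.
have XN := twist_sum uX nN e e'.
have [psi _ psiK] := bij_phi.
have [a [b [d XE]]] := krylov_commutant (cubic_krylov nKx xN (psiK 1)) XN.
apply/lift_cubic; exists (a%:A + b *: x + d *: (x * x)); last first.
  by rewrite XE; exact: mulby_poly2.
apply/eqP=> E; have Xp : X *m psi 1 = 0.
  apply: (bij_inj bij_phi); rewrite linear0 XE.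
  by rewrite (mulby_poly2 a b d xN) E mul0r.
have := unit_mulmx_eq0 uX Xp => /(congr1 phi)/eqP.
by rewrite psiK linear0 oner_eq0.
Qed.

(** Evaluation at the vector that stands for 1 embeds [cubic_units] in the multiplicative group of a
    field, where finite subgroups are cyclic. *)
Lemma cubic_cyclic : cyclic R.
Proof.
have gH : group_set (cubic_units phi).
  apply/group_setP; split=> [|m n]; rewrite !inE.
    apply/existsP; exists 1; rewrite oner_neq0; apply/realizesP; rewrite GL1.
    by have := mulby_scalar 1; rewrite scale1r.
  case/existsP=> x /andP[nzx /realizesP xm] /existsP[y /andP[nzy /realizesP yn]].
  apply/existsP; exists ((x : L) * (y : L)); apply/andP; split; first by rewrite mulf_neq0.
  by apply/realizesP; rewrite GLM; exact: mulbyM.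
have [psi psiphi psiK] := bij_phi.
suff cH : cyclic (Group gH) by exact: (quotient_cyclic _ cH).
apply: (@field_mul_group_cyclic _ (Group gH) L (fun m : {'GL_3[K]} => phi (GLval m *m psi 1))).
  move=> m n; rewrite !inE => /existsP[x /andP[nzx /realizesP xm]] /existsP[y /andP[nzy /realizesP yn]].
  by rewrite GLM -mulmxA !xm !yn psiK !mulr1.
move=> m; rewrite !inE => /existsP[x /andP[nzx /realizesP xm]].
rewrite xm psiK mulr1; split=> [x1|m1]; last first.
  by have := xm (psi 1); rewrite m1 GL1 mul1mx psiK mulr1.
apply: GL_inj; apply: (acts_by_inj bij_phi xm); rewrite x1 GL1.
by have := mulby_scalar 1; rewrite scale1r.
Qed.

End CubicTorusRep.

Section QuadraticTorusRep.
Variables (K : finFieldType) (L : fieldExtType K).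
Variable phi : {linear 'cV[K]_3 -> (L * K^o)%type}.
Hypothesis bij_phi : bijective phi.
Hypothesis dimL : \dim {:L} = 2%N.
Implicit Types (X Y : 'M[K]_3) (x y : L) (d : K).
Local Notation R := (quadratic_units phi / Z3 K)%g.
Definition mulby2 x d := acts_by phi (fun y : (L * K^o)%type => (x * y.1, d * y.2)).

Lemma mulby2_ex x d : x != 0 -> d != 0 -> exists2 X, X \in unitmx & mulby2 x d X.
Proof.
move=> nzx nzd; apply: acts_by_ex => // [a y z|[y1 y2] [z1 z2] /= [e1 e2]].
  by congr (_, _); rewrite /= !mulrDr scalerAr.
by congr (_, _); [exact: (mulfI nzx) | exact: (mulfI nzd)].
Qed.

Lemma mulby2M x d y d' X Y : mulby2 x d X -> mulby2 y d' Y ->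
  mulby2 (x * y) (d * d') (X *m Y).
Proof. by move=> fX gY v; rewrite -mulmxA fX gY /= !mulrA. Qed.

Lemma mulby2_scalar c : mulby2 c%:A c c%:M.
Proof.
by move=> v; rewrite mul_scalar_mx linearZ /= mulr_algl; case: (phi v).
Qed.

Lemma mulby2Z c x d X : mulby2 x d X -> mulby2 (c *: x) (c * d) (c *: X).
Proof.
move=> fX v; rewrite -scalemxAl linearZ /= fX.
by congr (_, _); rewrite /= ?scalerAl // -mulrA.
Qed.

Lemma mulby2D x d y d' X Y : mulby2 x d X -> mulby2 y d' Y ->
  mulby2 (x + y) (d + d') (X + Y).
Proof. by move=> fX gY v; rewrite mulmxDl linearD /= fX gY !mulrDl. Qed.

Lemma mulby2_poly2 a b c x d X : mulby2 x d X ->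
  mulby2 (a%:A + b *: x + c *: (x * x)) (a + b * d + c * (d * d)) (poly2 a b c X).
Proof.
move=> xX; apply: mulby2D; last exact/mulby2Z/mulby2M.
by apply: mulby2D; [exact: mulby2_scalar | exact: mulby2Z].
Qed.

Lemma lift_quadratic X : lift R X <-> exists x d, [/\ x != 0, d != 0 & mulby2 x d X].
Proof.
split=> [|[x [d [nzx nzd xX]]]].
  case/lift_quotient=> n [c [+ nzc ->]]; rewrite inE.
  case/existsP=> x /existsP[d /and3P[nzx nzd /realizesP xn]].
  exists (c *: (x : L)), (c * d); rewrite scaler_eq0 negb_or nzc nzx mulf_neq0 //.
  by split=> //; exact: mulby2Z.
have [Y uY xY] := mulby2_ex nzx nzd; have [n nY] := GL_of_unit uY.
rewrite (acts_by_inj bij_phi xX xY) -nY; apply/lift_quotient; exists n, 1.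
rewrite oner_neq0 scale1r inE; split=> //; apply/existsP; exists x; apply/existsP; exists d.
by rewrite nzx nzd; apply/realizesP; rewrite nY.
Qed.

Lemma quadratic_comm X Y : lift R X -> lift R Y -> X *m Y = Y *m X.
Proof.
move=> /lift_quadratic[x [d [_ _ xX]]] /lift_quadratic[y [d' [_ _ yY]]].
apply: (acts_by_inj bij_phi (mulby2M xX yY)); rewrite mulrC [d * _]mulrC.
exact: mulby2M.
Qed.

Lemma quadratic_group : group_set R.
Proof.
apply: group_set_lift => [|X Y].
  apply/lift_quadratic; exists 1, 1; rewrite !oner_neq0; split=> //.
  by have := mulby2_scalar 1; rewrite scale1r.
move=> /lift_quadratic[x [d [nzx nzd xX]]] /lift_quadratic[y [d' [nzy nzd' yY]]].
by apply/lift_quadratic; exists (x * y), (d * d'); rewrite !mulf_neq0 //; split=> //; exact: mulby2M.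
Qed.

(** A relation says that a + b X + c X^2 vanishes at [x] and at [d]. Dividing by X - d leaves a
    polynomial of degree at most 1 with the root [x] outside [K], hence zero. *)
Lemma quadratic_krylov x d X v : (forall c, x != c%:A) -> mulby2 x d X -> phi v = (1, 1) ->
  krylov X v \in unitmx.
Proof.
move=> nKx xX v1; apply: col3_unitP => a b c /(congr1 phi).
rewrite !linearD !linearZ /= !xX v1 linear0 /= !mulr1 => -[E1 E2].
have [[k /eqP]|free2] := ext_scalarP x; first by rewrite (negPf (nKx k)).
have {}E2 : a + b * d + c * (d * d) = 0.
  by rewrite -[RHS]E2 -[a *: 1]/(a * 1) mulr1.
have aA : a%:A = - (b%:A * d%:A) - c%:A * (d%:A * d%:A) :> L.
  rewrite !mulr_algl !scalerA -!scaleNr -scalerDl; congr (_ *: _).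
  by apply/eqP; rewrite -subr_eq0 -[X in _ == X]E2; apply/eqP; ring.
have : (x - d%:A) * ((b + c * d)%:A + c *: x) = 0.
  rewrite -[RHS]E1 aA scalerDl -scalerA -[c *: d%:A]mulr_algl.
  by rewrite -[b *: x]mulr_algl -[c *: x]mulr_algl -[c *: (x * x)]mulr_algl; ring.
move/eqP; rewrite mulf_eq0 subr_eq0 (negPf (nKx d)) => /eqP/free2[E3 c0].
move: E3 E2; rewrite c0 !mul0r !addr0 => ->; rewrite mul0r addr0 => ->.
by split.
Qed.

(** The test element multiplies by (x, 1) with [x] outside [K]; its only eigenvalue in [K] is 1,
    attained at (0, 1). *)
Lemma quadratic_max : max_abelian R.
Proof.
apply: max_abelian_of_lift; first exact: quadratic_group.
  by apply: abelian_of_commuting; exact: quadratic_comm.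
move=> X uX cX; have [|x nKx] := @nonscalar_ex K L; first by rewrite dimL.
have nzx : x != 0 by have := nKx 0; rewrite scale0r.
have nz1 : (1 : K) != 0 := oner_neq0 _.
have [N uN xN] := mulby2_ex nzx nz1.
have [c e] : exists c, X *m N = c *: (N *m X).
  by apply: cX; apply/lift_quadratic; exists x, 1.
have [psi phiK psiK] := bij_phi.
have XN : X *m N = N *m X.
  apply: (twist_eigen (v := psi (0, 1))) e => //.
  - by apply/eqP=> /(congr1 phi); rewrite psiK linear0 => -[/eqP]; rewrite oner_eq0.
  - by apply: (bij_inj bij_phi); rewrite xN !psiK /= mulr0 mulr1.
  move=> k y nzy /(congr1 phi); rewrite xN linearZ => -[].
  case Ey: (phi y) => [y1 y2] /= e1 e2.
  have y10 : y1 = 0.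
    apply/eqP; apply: contraT => nzy1; case/negP: (nKx k); apply/eqP.
    by apply: (mulIf nzy1); rewrite e1 mulr_algl.
  have nzy2 : y2 != 0.
    apply: contraNneq nzy => y20; apply/eqP/(bij_inj bij_phi).
    by rewrite Ey y10 y20 linear0.
  by apply: (mulIf nzy2); rewrite e2.
have [a [b [d XE]]] := krylov_commutant (quadratic_krylov nKx xN (psiK (1, 1))) XN.
have pX := mulby2_poly2 a b d xN; rewrite -XE in pX.
have inj v : phi (X *m psi v) = 0 -> v = 0.
  move=> Xv; have /(unit_mulmx_eq0 uX)/(congr1 phi) : X *m psi v = 0.
    by apply: (bij_inj bij_phi); rewrite Xv linear0.
  by rewrite psiK linear0.
apply/lift_quadratic; do 2!eexists; split; last exact: pX.
- apply/eqP=> E; have: phi (X *m psi (1, 0)) = 0 by rewrite pX E psiK /= mul0r mulr0.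
  by move/inj/(congr1 fst)/eqP; rewrite /= oner_eq0.
apply/eqP=> E; have: phi (X *m psi (0, 1)) = 0 by rewrite pX E psiK /= mul0r mulr0.
by move/inj/(congr1 snd)/eqP; rewrite /= oner_eq0.
Qed.

End QuadraticTorusRep.

(** * Representatives with noncommuting lifts *)

(** [f] is a projective representation of [gT]: multiplicative up to scalars, scalar only at 1, and
    reaching all of [A] up to scalars. It therefore induces an isomorphism onto [A]. *)
Lemma isog_of_lift (K : finFieldType) (gT : finGroupType) (f : gT -> 'M[K]_3)
    (A : {set coset_of (Z3 K)}) :
  (forall x, lift A (f x)) ->
  (forall x y, exists c, f (x * y)%g = c *: (f x *m f y)) ->
  (forall x c, f x = c%:M -> x = 1%g) ->
  (forall X, lift A X -> exists x c, X = c *: f x) ->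
  A \isog [set: gT].
Proof.
(* The default value of [insubd] never occurs: [lift A (f x)] makes [f x] invertible. *)
move=> Af fM f1 fA; pose F x : {'GL_3[K]} := insubd (1%g : {'GL_3[K]}) (f x).
have FE x : GLval (F x) = f x by apply: insubdK; exact: lift_unit (Af x).
have FM : {in [set: gT] &, {morph (fun x => coset (Z3 K) (F x)) : x y / (x * y)%g}}.
  move=> x y _ _; rewrite /= -pcosetM; have [c e] := fM x y.
  apply/eqP/pcosetP; exists c; last by rewrite GLM !FE.
  apply/eqP=> c0; have := lift_unit (Af (x * y)%g).
  by rewrite e c0 scale0r unitmxE det0 unitr0.
have injF : 'injm (Morphism FM).
  apply/injmP=> x y _ _ /= /eqP; rewrite eq_mulgV1 => /eqP e.
  apply/eqP; rewrite eq_mulgV1; apply/eqP.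
  have: coset (Z3 K) (F (x * y^-1)%g) == 1%g.
    have /= -> := FM x y^-1%g (in_setT _) (in_setT _).
    by have /= -> := morphV (Morphism FM) (in_setT y); rewrite e.
  by case/pcoset1P=> c; rewrite FE; exact: f1.
have imF : (Morphism FM @* [set: gT])%g = A.
  apply/eqP; rewrite eqEsubset; apply/andP; split; apply/subsetP=> z.
    by case/morphimP=> x _ _ -> /=; apply/mem_lift; rewrite FE.
  have [m ->] := pcoset_surj z => /mem_lift Am; have [x [c e]] := fA _ Am.
  apply/morphimP; exists x; rewrite ?inE //=; apply/eqP/pcosetP.
  exists c; last by rewrite FE.
  by apply/eqP=> c0; have := lift_unit Am; rewrite e c0 scale0r unitmxE det0 unitr0.
by rewrite -imF isog_sym; apply/isogP; exists (Morphism FM).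
Qed.

Section HeisenbergReps.
Variables (K : finFieldType) (om : K).
Hypothesis prim_om : 3.-primitive_root om.
Implicit Types (g h X Y : 'M[K]_3) (A : {set coset_of (Z3 K)}).

Lemma mxpowD g i j : mxpow g (i + j) = mxpow g i *m mxpow g j.
Proof. by elim: i => [|i IHi]; rewrite ?mul1mx // addSn !mxpowS IHi mulmxA. Qed.

Lemma mxpow3 g b i : g *m g *m g = b%:M -> mxpow g (3 * i) = (b ^+ i)%:M.
Proof.
move=> gb; elim: i => [|i IHi] //; rewrite mulnS mxpowD IHi.
by rewrite /mxpow /= mulmx1 mulmxA gb -scalar_mxM exprS.
Qed.

Lemma mxpow_modn g b i : g *m g *m g = b%:M ->
  mxpow g i = b ^+ (i %/ 3) *: mxpow g (i %% 3).
Proof.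
move=> gb; rewrite [in LHS](divn_eq i 3) mxpowD mulnC (mxpow3 _ gb).
by rewrite mul_scalar_mx.
Qed.

(** Solves [X h^i g^j = c] for [X], multiplying by [g^(2j)] and then [h^(2i)]: here [g^(3j) = 1] and
    [h^(3i) = b^i]. *)
Lemma heis_span b g h v X l m : heis_pair om b g h v -> X \in unitmx ->
  X *m g = l *: (g *m X) -> X *m h = m *: (h *m X) ->
  exists i j c, c != 0 /\ X = c *: (mxpow g i *m mxpow h j).
Proof.
move=> hp uX Xg Xh; have [_ _ nzb gh hhh] := hp; have ggg := heis_diag prim_om hp.
have [c [i [j e]]] := heis_twisted prim_om hp uX Xg Xh.
have {}e : X *m mxpow h i = c *: mxpow g (2 * j).
  have := congr1 (mulmx^~ (mxpow g (2 * j))) e; rewrite mul_scalar_mx -mulmxA -mxpowD -mulSn.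
  by rewrite (mxpow3 _ ggg) expr1n mulmx1.
have {}e : X = (c / b ^+ i) *: (mxpow g (2 * j) *m mxpow h (2 * i)).
  have := congr1 (mulmx^~ (mxpow h (2 * i))) e; rewrite -mulmxA -mxpowD -mulSn.
  rewrite (mxpow3 _ hhh) mul_mx_scalar -scalemxAl => /(congr1 ( *:%R (b ^+ i)^-1)).
  by rewrite !scalerA mulVf ?expf_neq0 // scale1r mulrC.
exists (2 * j)%N, (2 * i)%N, (c / b ^+ i); split=> //.
by apply/eqP=> c0; move: uX; rewrite e c0 scale0r unitmxE det0 unitr0.
Qed.

Lemma lift_mxpow A X i : group_set A -> lift A X -> lift A (mxpow X i).
Proof.
move=> gA AX; elim: i => [|i IHi]; first exact: (@lift_scalar _ (Group gA) _ (oner_neq0 _)).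
exact: (@liftM _ (Group gA)).
Qed.

Lemma lift_heis A b g h v X : group_set A -> abelian A -> heis_pair om b g h v ->
  lift A g -> lift A h -> lift A X ->
  exists i j c, c != 0 /\ X = c *: (mxpow g i *m mxpow h j).
Proof.
move=> gA /abelian_lift cA hp Ag Ah AX.
have [l e] := cA _ _ AX Ag; have [m e'] := cA _ _ AX Ah.
exact: heis_span hp (lift_unit AX) e e'.
Qed.

Lemma heis_max A b g h v : group_set A -> abelian A -> heis_pair om b g h v ->
  lift A g -> lift A h -> max_abelian A.
Proof.
move=> gA abA hp Ag Ah; apply: max_abelian_of_lift => // X uX cX.
have [l e] := cX _ Ag; have [m e'] := cX _ Ah.
have [i [j [c [nzc ->]]]] := heis_span hp uX e e'; apply: liftZ => //.
by apply: (@liftM _ (Group gA)); exact: lift_mxpow.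
Qed.

(** The pair (i, j) goes to [g^i h^j]. This is multiplicative up to the twist between [h^j] and
    [g^i'] and the power of [b] produced by the carry of [j + j'] modulo 3. *)
Lemma heis_isog A b g h v : group_set A -> abelian A -> heis_pair om b g h v ->
  lift A g -> lift A h -> A \isog [set: 'Z_3 * 'Z_3].
Proof.
move=> gA abA hp Ag Ah; have [_ _ nzb gh hhh] := hp; have ggg := heis_diag prim_om hp.
have uh := lift_unit Ah; have ug := lift_unit Ag.
apply: (@isog_of_lift _ _ (fun x : 'Z_3 * 'Z_3 => mxpow g x.1 *m mxpow h x.2)).
- by move=> x; apply: (@liftM _ (Group gA)); exact: lift_mxpow.
- move=> [i j] [i' j'] /=.
  have [c e] : exists c, mxpow h j *m mxpow g i' = c *: (mxpow g i' *m mxpow h j).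
    have /abelian_lift cA := abA; by apply: cA; exact: lift_mxpow.
  have nzc : c != 0.
    have: mxpow h j *m mxpow g i' \in unitmx.
      by rewrite unitmx_mul !(lift_unit (lift_mxpow _ gA _)).
    by apply: contraTneq => c0; rewrite e c0 scale0r unitmxE det0 unitr0.
  exists (c^-1 / b ^+ ((j + j') %/ 3)).
  have eh : mxpow h ((j + j') %% 3) = (b ^+ ((j + j') %/ 3))^-1 *: (mxpow h j *m mxpow h j').
    by rewrite -mxpowD (mxpow_modn (j + j') hhh) scalerA mulVf ?expf_neq0 // scale1r.
  have eg : mxpow g ((i + i') %% 3) = mxpow g i *m mxpow g i'.
    by rewrite -mxpowD [RHS](mxpow_modn _ ggg) expr1n scale1r.
  rewrite -[RHS]scalerA -![((_ + _) %% _)%N]/((_ + _) %% 3)%N eg eh.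
  rewrite -!mulmxA [mxpow h j *m (mxpow g i' *m _)]mulmxA e.
  rewrite -!scalemxAl -!scalemxAr !scalerA mulrAC mulVf // mul1r.
  by rewrite !mulmxA.
(* Moving [h] and [g] past [g^i h^j] costs factors [om^i] and [om^j]. A scalar commutes with both,
   so the two exponents are 0. *)
- move=> [i j] /= c e.
  have uc : mxpow g i *m mxpow h j \in unitmx.
    by rewrite unitmx_mul !(lift_unit (lift_mxpow _ gA _)).
  have nzc : c != 0.
    by apply: contraTneq uc => c0; rewrite e c0 raddf0 unitmxE det0 unitr0.
  have om1 k : om ^+ k = 1 -> (k < 3)%N -> k = 0%N.
    move=> /eqP; rewrite -(prim_order_dvd prim_om) => dvd3k ltk.
    by apply/eqP; rewrite -leqn0 leqNgt; apply/negP=> /dvdn_leq/(_ dvd3k); rewrite leqNgt ltk.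
  have cancel k Y : Y \in unitmx -> c *: Y = om ^+ k *: (c *: Y) -> om ^+ k = 1.
    move=> uY /eqP; rewrite -subr_eq0 -[X in X - _]scale1r -scalerBl !scaler_eq0 subr_eq0.
    rewrite (negPf nzc) /= => /orP[/eqP // |/eqP Y0].
    by rewrite Y0 unitmxE det0 unitr0 in uY.
  congr (_, _); apply: val_inj; apply: om1; try exact: ltn_ord.
    have : mxpow g i *m mxpow h j *m h = om ^+ i *: (h *m (mxpow g i *m mxpow h j)).
      by rewrite -mulmxA mxpow_comm mulmxA (mxpow_twistl i gh) -scalemxAl !mulmxA.
    by rewrite e mul_scalar_mx mul_mx_scalar; exact: cancel.
  have : g *m (mxpow g i *m mxpow h j) = om ^+ j *: (mxpow g i *m mxpow h j *m g).
    by rewrite mulmxA -mxpow_comm -mulmxA (mxpow_twist j gh) -scalemxAr !mulmxA.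
  by rewrite e mul_scalar_mx mul_mx_scalar; exact: cancel.
move=> X AX; have [i [j [c [_ ->]]]] := lift_heis gA abA hp Ag Ah AX.
exists (inZp i, inZp j), (c * b ^+ (j %/ 3)).
rewrite (mxpow_modn i ggg) (mxpow_modn j hhh) expr1n scale1r -scalemxAr scalerA.
by [].
Qed.

End HeisenbergReps.

(** * The clock and shift group *)

Section ClockShiftRep.
Variables (K : finFieldType) (om : K).
Hypothesis prim_om : 3.-primitive_root om.
Implicit Types (g h X Y : 'M[K]_3).

Lemma quotient_gen_group (H : {set {'GL_3[K]}}) : group_set (<<H>> / Z3 K)%g.
Proof. exact: valP (<<H>> / Z3 K)%G. Qed.

Lemma lift_quotient_gen (H : {set {'GL_3[K]}}) m : m \in H -> lift (<<H>> / Z3 K)%g (GLval m).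
Proof.
by move=> Hm; apply/lift_quotient; exists m, 1; rewrite mem_gen // oner_neq0 scale1r.
Qed.

(** The image of a generated group is generated by the images, so commuting up to scalars need only
    be checked on generators. *)
Lemma quotient_gen_abelian (H : {set {'GL_3[K]}}) :
  (forall m n, m \in H -> n \in H -> exists c,
     GLval m *m GLval n = c *: (GLval n *m GLval m)) -> abelian (<<H>> / Z3 K)%g.
Proof.
move=> cH; rewrite quotient_gen ?abelian_gen; last first.
  by apply/subsetP=> m _; exact: in_norm_Z3.
apply/abelian_lift=> X Y /lift_quotient[m [c [Hm _ ->]]] /lift_quotient[n [d [Hn _ ->]]].
have [e mn] := cH m n Hm Hn; exists e.
by rewrite -!scalemxAl -!scalemxAr mn !scalerA; congr (_ *: _); ring.
Qed.

Definition clock := mx3 [:: [:: 1; 0; 0]; [:: 0; om; 0]; [:: 0; 0; om ^+ 2]].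
Definition shift := mx3 [:: [:: 0; 0; 1 : K]; [:: 1; 0; 0]; [:: 0; 1; 0]].

Lemma clock_shift_pair : heis_pair om 1 clock shift (delta_mx o0 0).
Proof.
split.
- by apply: eq_cV3; rewrite !(mxE, sum_ord3) /=; ring.
- by apply/eqP=> /colP/(_ o0)/eqP; rewrite !mxE /= oner_eq0.
- exact: oner_neq0.
- have o3 := cube_root_cube prim_om.
  apply: eq_mx3; rewrite !(mxE, sum_ord3) /=; rewrite ?expr2; try ring.
  by rewrite !(mul0r, mulr0, addr0, add0r, mul1r, mulr1) !mulrA o3.
by apply: eq_mx3; rewrite !(mxE, sum_ord3) /= ?mulr1n ?mulr0n; ring.
Qed.

Lemma lift_clock_shift : lift (<<clock_shift om>> / Z3 K)%g clock /\
  lift (<<clock_shift om>> / Z3 K)%g shift.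
Proof.
have uh := heis_unit clock_shift_pair.
have ug : clock \in unitmx.
  have := unitmx1 K 3; rewrite -(heis_diag prim_om clock_shift_pair) !unitmx_mul.
  by case/andP.
have [m mE] := GL_of_unit ug; have [n nE] := GL_of_unit uh.
by split; [rewrite -mE | rewrite -nE]; apply: lift_quotient_gen;
  rewrite inE ?mE ?nE eqxx ?orbT.
Qed.

Lemma clock_shift_abelian : abelian (<<clock_shift om>> / Z3 K)%g.
Proof.
have [_ _ _ gh _] := clock_shift_pair.
apply: quotient_gen_abelian => m n; rewrite !inE.
case/orP=> /eqP ->; case/orP=> /eqP ->; rewrite -?/clock -?/shift.
- by exists 1; rewrite scale1r.
- by exists om.
- by exists om^-1; rewrite gh scalerA mulVf ?scale1r ?(cube_root_neq0 prim_om).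
by exists 1; rewrite scale1r.
Qed.

End ClockShiftRep.

(** * The group of Frobenius and the cube roots of scalars *)

Section FrobeniusRep.
Variables (K : finFieldType) (om : K).
Hypothesis prim_om : 3.-primitive_root om.
Variables (L : fieldExtType K) (phi : {linear 'cV[K]_3 -> L}).
Hypothesis bij_phi : bijective phi.
Hypothesis dimL : \dim {:L} = 3%N.
Implicit Types (X Y : 'M[K]_3) (x y : L).
Local Notation H := (cube_root_units phi :|: frobenius phi).
Local Notation R := (<<cube_root_units phi :|: frobenius phi>> / Z3 K)%g.
Local Notation mulby x := (acts_by phi (fun y : L => x * y)).
Local Notation frob := (acts_by phi (fun y : L => y ^+ #|K|)).

Lemma frob_ex : exists2 X, X \in unitmx & frob X.
Proof.
apply: acts_by_ex => // [a x y|x y xy]; first exact: frobenius_linear.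
have D : (x - y) ^+ #|K| = 0.
  by have := frobenius_linear (-1) y x; rewrite !scaleN1r addrC xy addNr addrC.
by apply/eqP; rewrite -subr_eq0; move/eqP: D; rewrite expf_eq0 => /andP[_].
Qed.

Lemma frob_mulby F X x m : frob F -> mulby x X -> x ^+ #|K| = m *: x ->
  F *m X = m *: (X *m F).
Proof.
move=> fF xX xq; apply: (acts_by_inj bij_phi (f := fun y => (x * y) ^+ #|K|)).
  exact: acts_by_comp fF xX.
move=> v; rewrite -scalemxAl -mulmxA linearZ /= xX fF exprMn xq.
by rewrite scalerAl.
Qed.

(** The cube of x^(q-1) is c^(q-1) = 1, so x^(q-1) is a cube root of unity in [L]; these are the
    powers of [om]. *)
Lemma cube_root_twist x c : x != 0 -> x ^+ 3 = c%:A -> exists i, x ^+ #|K| = om ^+ i *: x.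
Proof.
move=> nzx x3; have q1 : (#|K| = #|K|.-1.+1)%N by rewrite prednK ?(leq_trans _ (finNzRing_gt1 K)).
have nzc : c != 0.
  by apply: contraNneq nzx => c0; move/eqP: x3; rewrite c0 scale0r expf_eq0.
have y3 : (x ^+ #|K|.-1) ^+ 3 = 1.
  rewrite exprAC x3 -in_algE -rmorphXn; apply/eqP; rewrite -[X in _ == X](rmorph1 (in_alg L)).
  rewrite (inj_eq (fmorph_inj _)) -(inj_eq (mulfI nzc)) -exprS -q1 expf_card mulr1.
  exact: eqxx.
have prim_omL : 3.-primitive_root (in_alg L om) by rewrite fmorph_primitive_root.
have [i e] := prim_rootP prim_omL y3; exists i.
by rewrite q1 exprSr e -rmorphXn /= mulr_algl.
Qed.

Lemma frobenius_abelian : abelian R.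
Proof.
have cub m : m \in cube_root_units phi -> exists x c, [/\ x != 0, x ^+ 3 = c%:A & mulby x (GLval m)].
  rewrite inE => /existsP[x /existsP[c /and4P[nzx nzc /eqP x3 /realizesP xm]]].
  by exists x, c.
apply: quotient_gen_abelian => m n; rewrite !in_setU.
case/orP=> [/cub[x [c [nzx x3 xm]]]|]; last rewrite inE => /realizesP fm.
  case/orP=> [/cub[y [d [nzy y3 yn]]]|]; last rewrite inE => /realizesP fn.
    exists 1; rewrite scale1r; apply: (acts_by_inj bij_phi (mulbyM xm yn)).
    by rewrite mulrC; exact: mulbyM.
  have [i e] := cube_root_twist nzx x3; exists (om ^+ i)^-1.
  by rewrite (frob_mulby fn xm e) scalerA mulVf ?scale1r // expf_neq0 // (cube_root_neq0 prim_om).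
case/orP=> [/cub[y [d [nzy y3 yn]]]|]; last rewrite inE => /realizesP fn.
  by have [i e] := cube_root_twist nzy y3; exists (om ^+ i); exact: frob_mulby.
by exists 1; rewrite scale1r; rewrite (acts_by_inj bij_phi fm fn).
Qed.

Lemma lift_frob F : frob F -> lift R F.
Proof.
move=> fF; have [F' uF' fF'] := frob_ex; rewrite (acts_by_inj bij_phi fF fF').
have [n nE] := GL_of_unit uF'; rewrite -nE; apply: lift_quotient_gen.
by rewrite !inE; apply/orP; right; apply/realizesP; rewrite nE.
Qed.

Lemma lift_cube_root x c X : x != 0 -> x ^+ 3 = c%:A -> mulby x X -> lift R X.
Proof.
move=> nzx x3 xX; have [Y uY xY] := mulby_ex bij_phi nzx.
rewrite (acts_by_inj bij_phi xX xY).
have [n nE] := GL_of_unit uY; rewrite -nE; apply: lift_quotient_gen.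
rewrite !inE; apply/orP; left; apply/existsP; exists x; apply/existsP; exists c.
rewrite nzx x3 eqxx /=; apply/andP; split; last by apply/realizesP; rewrite nE.
by apply: contraNneq nzx => c0; move/eqP: x3; rewrite c0 scale0r expf_eq0.
Qed.

Lemma noncube_root b : (forall d, b != d ^+ 3) -> exists x : L, x ^+ 3 = b%:A.
Proof.
move=> ncb; pose p : {poly K} := 'X^3 - b%:P.
have sz_p : size p = 4%N by rewrite size_XnsubC.
have [||x] := @irreducible_root K L p; last 1 first.
- rewrite rootE rmorphB /= map_polyXn map_polyC !hornerE subr_eq0 => /eqP x3.
  by exists x.
- apply: cubic_irreducible; first by rewrite sz_p.
  by move=> d; rewrite rootE !hornerE subr_eq0 eq_sym.
by rewrite sz_p dimL.
Qed.

(** The pair is Frobenius and multiplication by a cube root [x] of [b], with the vector that stands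
    for 1. Since [b] is any non-cube, both nontrivial classes modulo cubes are met inside one
    group. *)
Lemma noncube_pair b : (forall d, b != d ^+ 3) -> exists g h v,
  [/\ lift R g, lift R h & heis_pair om b g h v].
Proof.
move=> ncb; have [x x3] := noncube_root ncb; have [psi _ psiK] := bij_phi.
have nzb : b != 0 by have := ncb 0; rewrite expr0n.
have nzx : x != 0.
  apply: contraNneq nzb => x0; move/eqP: x3.
  by rewrite x0 expr0n /= eq_sym scaler_eq0 oner_eq0 orbF.
have [F uF fF] := frob_ex; have [X uX xX] := mulby_ex bij_phi nzx.
have RF := lift_frob fF; have RX := lift_cube_root nzx x3 xX.
have Fv : F *m psi 1 = psi 1.
  by apply: (bij_inj bij_phi); rewrite fF !psiK expr1n.
have nzv : psi 1 != 0.
  by apply/eqP=> /(congr1 phi)/eqP; rewrite psiK linear0 oner_eq0.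
have XXX : X *m X *m X = b%:M.
  apply: (acts_by_inj bij_phi (mulbyM (mulbyM xX xX) xX)).
  by rewrite -expr2 -exprSr x3; exact: mulby_scalar.
have [i e] := cube_root_twist nzx x3; have FX := frob_mulby fF xX e.
have o3 := cube_root_cube prim_om.
have : (i %% 3 < 3)%N by rewrite ltn_mod.
rewrite -(prim_expr_mod prim_om i) in e FX.
case: (i %% 3)%N e FX => [|[|[|//]]] e FX _.
- have [c xc] : exists c, x = c%:A.
    by apply: frobenius_fixed; rewrite e expr0 scale1r.
  case/negP: (ncb c); apply/eqP; apply: (fmorph_inj (in_alg L)).
  by rewrite /= -x3 xc -in_algE -rmorphXn.
- by exists F, X, (psi 1); split=> //; split; rewrite // FX expr1.
(* Here the twist of [F] with [X] is [om^2]; the square of Frobenius has twist [om^4 = om]. *)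
exists (F *m F), X, (psi 1); split=> //.
  exact: (@liftM _ (Group (quotient_gen_group H))).
split=> //; first by rewrite -mulmxA !Fv.
rewrite -mulmxA FX -scalemxAr mulmxA FX -scalemxAl scalerA -mulmxA; congr (_ *: _).
by rewrite expr2 !mulrA o3 mul1r.
Qed.

(** Otherwise cubing is onto the finite field [K], hence injective, although [om] and 1 have the
    same cube. *)
Lemma noncube_ex : exists b : K, forall d, b != d ^+ 3.
Proof.
have [/existsP[b /forallP ncb]|] := boolP [exists b : K, [forall d : K, b != d ^+ 3]].
  by exists b.
rewrite negb_exists => /forallP cubes.
have card3 : #|[set d ^+ 3 | d in [set: K]]| == #|[set: K]|.
  apply/eqP; congr #|pred_of_set _|; apply/setP=> b; rewrite inE.
  have := cubes b; rewrite negb_forall => /existsP[d /negPn/eqP bd].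
  by apply/imsetP; exists d.
have inj3 := imset_injP card3.
have := cube_root_neq1 prim_om; rewrite (inj3 om 1) ?inE ?eqxx //.
by rewrite (prim_expr_order prim_om) expr1n.
Qed.

End FrobeniusRep.

(** * Rank-one matrices *)

Section RankOne.
Variable K : finFieldType.
Implicit Types (X Y M N P : 'M[K]_3) (a b u v z : 'cV[K]_3) (w : 'rV[K]_3).

Lemma dotZl c w v : dot (c *: w) v = c * dot w v.
Proof. by rewrite /dot -scalemxAl mxE. Qed.

Lemma mul_col3_mx3 X a b z (p q r : seq K) :
  X *m a = p`_0 *: a + p`_1 *: b + p`_2 *: z ->
  X *m b = q`_0 *: a + q`_1 *: b + q`_2 *: z ->
  X *m z = r`_0 *: a + r`_1 *: b + r`_2 *: z ->
  X *m col3 a b z = col3 a b z *m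
    mx3 [:: [:: p`_0; q`_0; r`_0]; [:: p`_1; q`_1; r`_1]; [:: p`_2; q`_2; r`_2]].
Proof.
move=> Xa Xb Xz; rewrite mul_col3 Xa Xb Xz.
by apply/matrixP=> i; apply: ord3P;
   rewrite [RHS]mxE sum_ord3 !mx3E !col3E /= !mxE; ring.
Qed.

Lemma codot_dual u : u != 0 -> exists w, dot w u = 1.
Proof.
case/cV0Pn=> i ui; exists ((u i 0)^-1 *: delta_mx 0 i).
by rewrite dotZl /dot -rowE mxE mulVf.
Qed.

Lemma colinear_dec a b : (forall c, b != c *: a) \/ exists c, b = c *: a.
Proof.
have [/existsP[c /eqP ->]|] := boolP [exists c : K, b == c *: a]; first by right; exists c.
by rewrite negb_exists => /forallP; left.
Qed.

(** Taking [b] in the kernel of a form that is 1 at [a] keeps it off the line of [a]. *)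
Lemma ker_basis w : w != 0 -> exists a b, [/\ dot w a = 0, dot w b = 0 &
  forall z, dot w z = 1 -> col3 a b z \in unitmx].
Proof.
move=> nzw; have [a nza [wa _]] := ker_dot2 w w; have [w' w'a] := codot_dual nza.
have [b nzb [wb w'b]] := ker_dot2 w w'; exists a, b; split=> // z wz.
apply: dual_basis wz => // c; apply: contraNneq nzb => bc.
have := w'b; rewrite bc dotZr w'a mulr1 => c0.
by rewrite c0 scale0r.
Qed.

(** If [b] were off the line of [a], then [w] and a multiple of [w'] would agree on a basis [a],
    [b], [z] with [w' z = 1]. *)
Lemma ker2_colinear w w' a b : w' != 0 -> (forall c, w != c *: w') ->
  dot w a = 0 -> dot w' a = 0 -> dot w b = 0 -> dot w' b = 0 -> a != 0 ->
  exists c, b = c *: a.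
Proof.
move=> nzw' nww' wa w'a wb w'b nza; have [nba|//] := colinear_dec a b.
have [z w'z] := dot_dual nzw'; have uP := dual_basis nba nza w'a w'b w'z.
case/negP: (nww' (dot w z)); apply/eqP; apply: (eq_on_col3 uP);
rewrite -?scalemxAl [LHS]mx11_scalar [X in _ = _ *: X]mx11_scalar -!/(dot _ _).
- by rewrite wa w'a raddf0 scaler0.
- by rewrite wb w'b raddf0 scaler0.
by rewrite w'z scalemx1.
Qed.

Lemma span_ker w a b x : (forall z, dot w z = 1 -> col3 a b z \in unitmx) ->
  w != 0 -> dot w a = 0 -> dot w b = 0 -> dot w x = 0 ->
  exists c d, x = c *: a + d *: b.
Proof.
move=> uP nzw wa wb wx; have [z wz] := dot_dual nzw.
have [c [d [e xE]]] := unit_col3_span x (uP z wz); exists c, d.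
have := wx; rewrite xE !dotDr !dotZr wa wb wz !mulr0 !add0r mulr1 => ->.
by rewrite scale0r addr0.
Qed.

Lemma comm_rank1 X u w : u != 0 -> w != 0 -> X *m (u *m w) = u *m w *m X ->
  exists c, X *m u = c *: u /\ w *m X = c *: w.
Proof.
move=> nzu nzw E; have [z wz] := dot_dual nzw; have [y yu] := codot_dual nzu.
exists (dot w (X *m z)); have Xu : X *m u = dot w (X *m z) *: u.
  have := congr1 (mulmx^~ z) E; rewrite mulmxA -[X *m u *m w *m z]mulmxA -mulmxA.
  rewrite -[u *m w *m X *m z]mulmxA mulmx_dot mulmxA [w *m z]mx11_scalar -/(dot _ _) wz.
  by rewrite mulmx1.
split=> //; have := congr1 (mulmx y) E.
rewrite [X *m _]mulmxA Xu -scalemxAl -scalemxAr dot_mulmx yu scale1r => ->.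
by rewrite -[u *m w *m X]mulmxA dot_mulmx yu scale1r.
Qed.

Lemma rank1_colinear u w u' w' : u *m w *m (u' *m w') = u' *m w' *m (u *m w) ->
  dot w u' *: (u *m w') = dot w' u *: (u' *m w).
Proof.
by rewrite -!mulmxA !dot_mulmx -!scalemxAr => ->.
Qed.

End RankOne.

(** * Conjugacy invariants *)

Section Invariants.
Variable K : finFieldType.
Implicit Types (X Y M N P : 'M[K]_3) (u v : 'cV[K]_3) (w : 'rV[K]_3).
Implicit Types (A B : {set coset_of (Z3 K)}) (Pr : {set coset_of (Z3 K)} -> Prop).

Definition commuting_lifts A := forall X Y, lift A X -> lift A Y -> X *m Y = Y *m X.

Definition split_lifts A := forall X, lift A X ->
  exists a b c, (X - a%:M) *m (X - b%:M) *m (X - c%:M) = 0.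

Definition eigen_lifts A := exists2 v : 'cV[K]_3, v != 0 & forall X, lift A X -> exists a, X *m v = a *: v.

Definition unipotent_lifts A := forall X, lift A X ->
  exists a, (X - a%:M) *m (X - a%:M) *m (X - a%:M) = 0.

Definition quadratic_lifts A := forall X, lift A X ->
  exists a, (X - a%:M) *m (X - a%:M) = 0.

(** As lifts are invertible, such an [X] is a scalar times a transvection. *)
Definition has_quadratic_lift A := exists X a,
  [/\ lift A X, (X - a%:M) *m (X - a%:M) = 0 & X != a%:M].

(** Every lift acts as a scalar on the plane [w = 0]. This tells the group that fixes a plane
    pointwise from its dual. *)
Definition common_row_lifts A := exists2 w : 'rV[K]_3, w != 0 &
  forall X, lift A X -> exists a u, X = a%:M + u *m w.

Definition conj_invariant Pr := forall A B, conj_in_PGL3 A B -> Pr A -> Pr B.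

Lemma conj_in_PGL3_sym A B : conj_in_PGL3 A B -> conj_in_PGL3 B A.
Proof.
case=> x _ ->; exists (x^-1)%g; first exact: in_PGL3.
by rewrite -conjsgM mulgV conjsg1.
Qed.

Lemma conj_invariantP Pr A B : conj_invariant Pr -> conj_in_PGL3 A B -> (Pr A <-> Pr B).
Proof. by move=> inv cAB; split; apply: inv => //; exact: conj_in_PGL3_sym. Qed.

Lemma conj_lift_ex A B : conj_in_PGL3 A B -> exists2 P, P \in unitmx &
  (forall X, lift B X -> exists2 Y, lift A Y & P *m X = Y *m P) /\
  (forall Y, lift A Y -> exists2 X, lift B X & P *m X = Y *m P).
Proof.
move=> /conj_in_PGL3_sym/conj_lift[P uP liftP]; exists P => //; split=> [X /liftP BX|Y AY].
  by exists (P *m X *m invmx P); rewrite // mulmxKV.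
exists (invmx P *m Y *m P); last by rewrite !mulmxA mulmxV // mul1mx.
by apply/liftP; rewrite !mulmxA mulmxV // mul1mx mulmxK.
Qed.

Lemma intertwine_sub X Y P a : P *m X = Y *m P -> P *m (X - a%:M) = (Y - a%:M) *m P.
Proof. by move=> PX; rewrite mulmxBr mulmxBl PX mul_mx_scalar mul_scalar_mx. Qed.

Lemma unit_mulmx_eq0l P X : P \in unitmx -> P *m X = 0 -> X = 0.
Proof. by move=> uP PX; rewrite -[X](mulKmx uP) PX mulmx0. Qed.

Lemma intertwine_eq0 X Y P a b : P \in unitmx -> P *m X = Y *m P ->
  (Y - a%:M) *m (Y - b%:M) = 0 -> (X - a%:M) *m (X - b%:M) = 0.
Proof.
move=> uP PX Y0; apply: (unit_mulmx_eq0l uP).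
by rewrite mulmxA (intertwine_sub a PX) -mulmxA (intertwine_sub b PX) mulmxA Y0 mul0mx.
Qed.

Lemma intertwine_eq0_3 X Y P a b c : P \in unitmx -> P *m X = Y *m P ->
  (Y - a%:M) *m (Y - b%:M) *m (Y - c%:M) = 0 ->
  (X - a%:M) *m (X - b%:M) *m (X - c%:M) = 0.
Proof.
move=> uP PX Y0; apply: (unit_mulmx_eq0l uP).
rewrite !mulmxA (intertwine_sub a PX) -[_ *m P *m _]mulmxA (intertwine_sub b PX).
by rewrite -!mulmxA (intertwine_sub c PX) !mulmxA Y0 mul0mx.
Qed.

Lemma commuting_lifts_conj : conj_invariant commuting_lifts.
Proof.
move=> A B /conj_lift_ex[P uP [BA _]] cA X X' /BA[Y AY PX] /BA[Y' AY' PX'].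
rewrite -[X *m X'](mulKmx uP) -[X' *m X](mulKmx uP); congr (_ *m _).
by rewrite !mulmxA PX PX' -!mulmxA PX PX' !mulmxA (cA _ _ AY AY').
Qed.

Lemma split_lifts_conj : conj_invariant split_lifts.
Proof.
move=> A B /conj_lift_ex[P uP [BA _]] sA X /BA[Y AY PX].
have [a [b [c Y0]]] := sA Y AY; exists a, b, c.
exact: intertwine_eq0_3 uP PX Y0.
Qed.

Lemma unipotent_lifts_conj : conj_invariant unipotent_lifts.
Proof.
move=> A B /conj_lift_ex[P uP [BA _]] sA X /BA[Y AY PX].
by have [a Y0] := sA Y AY; exists a; exact: intertwine_eq0_3 uP PX Y0.
Qed.

Lemma quadratic_lifts_conj : conj_invariant quadratic_lifts.
Proof.
move=> A B /conj_lift_ex[P uP [BA _]] sA X /BA[Y AY PX].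
by have [a Y0] := sA Y AY; exists a; exact: intertwine_eq0 uP PX Y0.
Qed.

Lemma has_quadratic_lift_conj : conj_invariant has_quadratic_lift.
Proof.
move=> A B /conj_lift_ex[P uP [_ AB]] [Y [a [/AB[X BX PX] Y0 nY]]]; exists X, a; split=> //.
  exact: intertwine_eq0 uP PX Y0.
apply: contraNneq nY => Xa; apply/eqP/(unit_mulmx_inj uP).
by rewrite -PX Xa mul_mx_scalar mul_scalar_mx.
Qed.

Lemma eigen_lifts_conj : conj_invariant eigen_lifts.
Proof.
move=> A B /conj_lift_ex[P uP [BA _]] [v nzv eA]; exists (invmx P *m v).
  apply: contraNneq nzv => Pv; apply/eqP.
  by rewrite -[v](mulKVmx uP) Pv mulmx0.
move=> X /BA[Y AY PX]; have [a Yv] := eA Y AY; exists a.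
by rewrite -[X](mulKmx uP) PX -!mulmxA mulKVmx // Yv scalemxAr.
Qed.

Lemma common_row_lifts_conj : conj_invariant common_row_lifts.
Proof.
move=> A B /conj_lift_ex[P uP [BA _]] [w nzw rA]; exists (w *m P).
  by apply: contraNneq nzw => wP; rewrite -[w](mulmxK uP) wP mul0mx.
move=> X /BA[Y AY PX]; have [a [u Yu]] := rA Y AY; exists a, (invmx P *m u).
rewrite -[X](mulKmx uP) PX Yu mulmxDl mulmxDr mul_scalar_mx -scalemxAr mulVmx // scalemx1.
by rewrite !mulmxA.
Qed.

Lemma quadratic_unipotent A : quadratic_lifts A -> unipotent_lifts A.
Proof. by move=> qA X /qA[a X0]; exists a; rewrite X0 mul0mx. Qed.

Lemma unipotent_split A : unipotent_lifts A -> split_lifts A.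
Proof. by move=> uA X /uA[a X0]; exists a, a, a. Qed.

Lemma cube_eq0 (x : K) : x * x * x = 0 -> x = 0.
Proof. by move/eqP; rewrite !mulf_eq0 orbb => /orP[] /eqP. Qed.

Lemma mul_triangular (r s t a b c r' s' t' a' b' c' : K) :
  mx3 [:: [:: r; a; b]; [:: 0; s; c]; [:: 0; 0; t]] *m
  mx3 [:: [:: r'; a'; b']; [:: 0; s'; c']; [:: 0; 0; t']] =
  mx3 [:: [:: r * r'; r * a' + a * s'; r * b' + a * c' + b * t'];
          [:: 0; s * s'; s * c' + c * t']; [:: 0; 0; t * t']].
Proof. mx3_ring. Qed.

Lemma sub_triangular (r s t a b c x : K) :
  mx3 [:: [:: r; a; b]; [:: 0; s; c]; [:: 0; 0; t]] - x%:M =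
  mx3 [:: [:: r - x; a; b]; [:: 0; s - x; c]; [:: 0; 0; t - x]].
Proof. by rewrite scalar_mx3; mx3_ring. Qed.

Lemma triangular_eq0 (r s t a b c : K) :
  mx3 [:: [:: r; a; b]; [:: 0; s; c]; [:: 0; 0; t]] = 0 <->
  [/\ r = 0, s = 0 & t = 0] /\ [/\ a = 0, b = 0 & c = 0].
Proof.
split=> [/matrixP E|[[-> -> ->] [-> -> ->]]]; last by apply: eq_mx3; rewrite !mxE.
by do ![split]; [move: (E o0 o0)|move: (E o1 o1)|move: (E o2 o2)|move: (E o0 o1)|
  move: (E o0 o2)|move: (E o1 o2)]; rewrite !mxE.
Qed.

Lemma diag_unipotent (p q r a : K) (X := mx3 [:: [:: p; 0; 0]; [:: 0; q; 0]; [:: 0; 0; r]]) :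
  (X - a%:M) *m (X - a%:M) *m (X - a%:M) = 0 -> [/\ p = a, q = a & r = a].
Proof.
rewrite /X !sub_triangular !mul_triangular => /triangular_eq0[[/cube_eq0/eqP p0 /cube_eq0/eqP q0 /cube_eq0/eqP r0] _].
by move: p0 q0 r0; rewrite !subr_eq0 => /eqP-> /eqP-> /eqP->.
Qed.

Lemma diagonals_split : split_lifts (diagonals K / Z3 K)%g.
Proof.
move=> X /lift_diagonals[a [b [c [_ ->]]]]; exists a, b, c.
by rewrite !sub_triangular !mul_triangular; apply/triangular_eq0; do ![split]; ring.
Qed.

Lemma jordan21_split : split_lifts (jordan21 K / Z3 K)%g.
Proof.
move=> X /lift_jordan21[r [a [t [_ ->]]]]; exists r, r, t.
by rewrite !sub_triangular !mul_triangular; apply/triangular_eq0; do ![split]; ring.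
Qed.

Lemma jordan3_unipotent : unipotent_lifts (jordan3 K / Z3 K)%g.
Proof.
move=> X /lift_jordan3[r [a [b [_ ->]]]]; exists r.
by rewrite !sub_triangular !mul_triangular; apply/triangular_eq0; do ![split]; ring.
Qed.

Lemma column_unipotents_quadratic : quadratic_lifts (column_unipotents K / Z3 K)%g.
Proof.
move=> X /lift_column_unipotents[r [a [b [_ ->]]]]; exists r.
by rewrite !sub_triangular !mul_triangular; apply/triangular_eq0; do ![split]; ring.
Qed.

Lemma row_unipotents_quadratic : quadratic_lifts (row_unipotents K / Z3 K)%g.
Proof.
move=> X /lift_row_unipotents[r [a [b [_ ->]]]]; exists r.
by rewrite !sub_triangular !mul_triangular; apply/triangular_eq0; do ![split]; ring.
Qed.

Lemma diagonals_not_unipotent : #|K| != 2%N -> ~ unipotent_lifts (diagonals K / Z3 K)%g.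
Proof.
case/exists_neq01=> a nza na1 uD; have [|t] := uD (mx3 [:: [:: a; 0; 0]; [:: 0; 1; 0]; [:: 0; 0; 1]]).
  by apply/lift_diagonals; exists a, 1, 1; rewrite !mulr1.
by case/diag_unipotent=> at1 t1 _; move: na1; rewrite at1 t1 eqxx.
Qed.

Lemma jordan21_not_unipotent : #|K| != 2%N -> ~ unipotent_lifts (jordan21 K / Z3 K)%g.
Proof.
case/exists_neq01=> a nza na1 uD; have [|t] := uD (mx3 [:: [:: a; 0; 0]; [:: 0; a; 0]; [:: 0; 0; 1]]).
  by apply/lift_jordan21; exists a, 0, 1; rewrite mulr1.
by case/diag_unipotent=> at1 _ t1; move: na1; rewrite at1 t1 eqxx.
Qed.

Lemma jordan3_not_quadratic : ~ quadratic_lifts (jordan3 K / Z3 K)%g.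
Proof.
move=> qJ; have [|t] := qJ (mx3 [:: [:: 1; 1; 0]; [:: 0; 1; 1]; [:: 0; 0; 1]]).
  by apply/lift_jordan3; exists 1, 1, 0; rewrite oner_neq0.
rewrite !sub_triangular !mul_triangular => /triangular_eq0[_ [_ /eqP]].
by rewrite !mulr0 !mul0r mulr1 add0r addr0 oner_eq0.
Qed.

Lemma diagonals_no_quadratic : ~ has_quadratic_lift (diagonals K / Z3 K)%g.
Proof.
case=> X [t [/lift_diagonals[a [b [c [_ XE]]]] X0 nX]]; case/eqP: nX.
rewrite [X in X = _]XE; have [|-> -> ->] := @diag_unipotent a b c t; last by rewrite scalar_mx3.
by rewrite -XE X0 mul0mx.
Qed.

Lemma jordan21_has_quadratic : has_quadratic_lift (jordan21 K / Z3 K)%g.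
Proof.
exists (mx3 [:: [:: 1; 1; 0]; [:: 0; 1; 0]; [:: 0; 0; 1]]), 1; split.
- by apply/lift_jordan21; exists 1, 1, 1; rewrite mulr1 oner_neq0.
- by rewrite !sub_triangular !mul_triangular; apply/triangular_eq0; do ![split]; ring.
by rewrite scalar_mx3; apply/eqP=> /matrixP/(_ o0 o1)/eqP; rewrite !mx3E /= oner_eq0.
Qed.

Lemma column_unipotents_row : common_row_lifts (column_unipotents K / Z3 K)%g.
Proof.
exists (delta_mx 0 o2).
  by apply/eqP=> /rowP/(_ o2)/eqP; rewrite !mxE /= oner_eq0.
move=> X /lift_column_unipotents[r [a [b [_ ->]]]].
exists r, (\col_i nth 0 [:: b; a; 0] i); rewrite scalar_mx3.
by apply: eq_mx3; rewrite !mxE big_ord1 !mxE /=; ring.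
Qed.

(** The elements 1 + E_01 and 1 + E_02 of the group contradict each other: the first forces the last
    entry of [w] to be 0, the second forces it to be nonzero. *)
Lemma row_unipotents_no_row : ~ common_row_lifts (row_unipotents K / Z3 K)%g.
Proof.
case=> w nzw rR.
have [|a [u E]] := rR (mx3 [:: [:: 1; 1; 0]; [:: 0; 1; 0]; [:: 0; 0; 1]]).
  by apply/lift_row_unipotents; exists 1, 1, 0; rewrite oner_neq0.
have [|b [v E']] := rR (mx3 [:: [:: 1; 0; 1]; [:: 0; 1; 0]; [:: 0; 0; 1]]).
  by apply/lift_row_unipotents; exists 1, 0, 1; rewrite oner_neq0.
have e i j : mx3 [:: [:: 1; 1; 0]; [:: 0; 1; 0]; [:: 0; 0; 1]] i j = a *+ (i == j) + u i 0 * w 0 j.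
  by rewrite E !mxE big_ord1.
have e' i j : mx3 [:: [:: 1; 0; 1]; [:: 0; 1; 0]; [:: 0; 0; 1]] i j = b *+ (i == j) + v i 0 * w 0 j.
  by rewrite E' !mxE big_ord1.
have := e o0 o1; have := e o0 o2; have := e' o0 o1; have := e' o0 o2.
rewrite !mx3E /= !mulr0n !add0r => vw2 vw1 uw2 uw1.
have nzw1 : w 0 o1 != 0 by apply/eqP=> w1; move/eqP: uw1; rewrite w1 mulr0 oner_eq0.
have nzu0 : u o0 0 != 0 by apply/eqP=> u0; move/eqP: uw1; rewrite u0 mul0r oner_eq0.
have nzw2 : w 0 o2 != 0 by apply/eqP=> w1; move/eqP: vw2; rewrite w1 mulr0 oner_eq0.
by move/esym/eqP: uw2; rewrite mulf_eq0 (negPf nzu0) (negPf nzw2).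
Qed.

End Invariants.

(** * Isomorphism types *)

Section IsomorphismTypes.
Variable K : finFieldType.
Implicit Types (X Y : 'M[K]_3).

Lemma card_of_lift (T : finType) (f : T -> 'M[K]_3) (A : {set coset_of (Z3 K)}) :
  (forall x, lift A (f x)) -> (forall x y c, f x = c *: f y -> x = y) ->
  (forall X, lift A X -> exists x c, X = c *: f x) -> #|A| = #|T|.
Proof.
move=> Af injf fA; pose F x : {'GL_3[K]} := insubd (1%g : {'GL_3[K]}) (f x).
have FE x : GLval (F x) = f x by apply: insubdK; exact: lift_unit (Af x).
have injF : injective (fun x => coset (Z3 K) (F x)).
  by move=> x y /eqP/pcosetP[c _]; rewrite !FE; exact: injf.
rewrite -(card_codom injF); apply: eq_card => z.
apply/idP/codomP=> [|[x ->]]; last by apply/mem_lift; rewrite FE.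
have [m ->] := pcoset_surj z => /mem_lift Am; have [x [c e]] := fA _ Am; exists x.
apply/eqP/pcosetP; exists c; last by rewrite FE.
by apply/eqP=> c0; have := lift_unit Am; rewrite e c0 scale0r unitmxE det0 unitr0.
Qed.

Lemma diagonals_isog : (diagonals K / Z3 K)%g \isog [set: {unit K} * {unit K}].
Proof.
apply: (@isog_of_lift _ _ (fun x : {unit K} * {unit K} =>
  mx3 [:: [:: val x.1; 0; 0]; [:: 0; val x.2; 0]; [:: 0; 0; 1]])) => [[x y]|[x y] [x' y']|[x y] c|X].
- apply/lift_diagonals; exists (val x), (val y), 1; split=> //.
  by rewrite mulr1 mulf_neq0 // -unitfE (valP x, valP y).
- by exists 1; rewrite scale1r mul_triangular /=; apply: eq_mx3; rewrite !mx3E /=; ring.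
- rewrite scalar_mx3 => /matrixP E; have := E o0 o0; have := E o1 o1; have := E o2 o2.
  by rewrite !mx3E /= => <- y1 x1; congr (_, _); apply: val_inj.
case/lift_diagonals=> a [b [c [nz ->]]].
have [nza nzb nzc] : [/\ a != 0, b != 0 & c != 0].
  by move: nz; rewrite !mulf_eq0 !negb_or -andbA => /and3P.
have ua : a / c \is a GRing.unit by rewrite unitfE mulf_neq0 ?invr_neq0.
have ub : b / c \is a GRing.unit by rewrite unitfE mulf_neq0 ?invr_neq0.
exists (FinRing.unit K ua, FinRing.unit K ub), c.
by apply: eq_mx3; rewrite !(mxE, sum_ord3) /=; field.
Qed.

(** The off-diagonal entry carries the factor [r]: the block is [r (1 + x E)] with [E] nilpotent,
    which makes the map multiplicative. *)
Lemma jordan21_isog : (jordan21 K / Z3 K)%g \isog [set: {unit K} * K].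
Proof.
apply: (@isog_of_lift _ _ (fun x : {unit K} * K =>
  mx3 [:: [:: val x.1; val x.1 * x.2; 0]; [:: 0; val x.1; 0]; [:: 0; 0; 1]])) => [[x y]|[x y] [x' y']|[x y] c|X].
- apply/lift_jordan21; exists (val x), (val x * y), 1; split=> //.
  by rewrite mulr1 -unitfE (valP x).
- exists 1; rewrite scale1r mul_triangular /= ?FinRing.zmodMgE.
  by apply: eq_mx3; rewrite !mx3E /=; ring.
- rewrite scalar_mx3 => /matrixP E; have := E o0 o0; have := E o0 o1; have := E o2 o2.
  rewrite !mx3E /= => <- + x1; rewrite x1 mul1r => y0.
  by congr (_, _); [apply: val_inj | exact: y0].
case/lift_jordan21=> r [a [t [nz ->]]].
have [nzr nzt] : r != 0 /\ t != 0 by apply/andP; rewrite -negb_or -mulf_eq0.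
have ur : r / t \is a GRing.unit by rewrite unitfE mulf_neq0 ?invr_neq0.
exists (FinRing.unit K ur, a / r), t.
by apply: eq_mx3; rewrite !(mxE, sum_ord3) /=; field; rewrite ?nzr ?nzt.
Qed.

Lemma column_unipotents_isog : (column_unipotents K / Z3 K)%g \isog [set: K * K].
Proof.
apply: (@isog_of_lift _ _ (fun x : K * K =>
  mx3 [:: [:: 1; 0; x.2]; [:: 0; 1; x.1]; [:: 0; 0; 1]])) => [[x y]|[x y] [x' y']|[x y] c|X].
- by apply/lift_column_unipotents; exists 1, x, y; rewrite oner_neq0.
- exists 1; rewrite scale1r mul_triangular /= ?FinRing.zmodMgE.
  by apply: eq_mx3; rewrite !mx3E /=; ring.
- rewrite scalar_mx3 => /matrixP E; have := E o0 o2; have := E o1 o2.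
  by rewrite !mx3E /= => -> ->.
case/lift_column_unipotents=> r [a [b [nz ->]]]; exists (a / r, b / r), r.
by apply: eq_mx3; rewrite !(mxE, sum_ord3) /=; field.
Qed.

Lemma row_unipotents_isog : (row_unipotents K / Z3 K)%g \isog [set: K * K].
Proof.
apply: (@isog_of_lift _ _ (fun x : K * K =>
  mx3 [:: [:: 1; x.1; x.2]; [:: 0; 1; 0]; [:: 0; 0; 1]])) => [[x y]|[x y] [x' y']|[x y] c|X].
- by apply/lift_row_unipotents; exists 1, x, y; rewrite oner_neq0.
- exists 1; rewrite scale1r mul_triangular /= ?FinRing.zmodMgE.
  by apply: eq_mx3; rewrite !mx3E /=; ring.
- rewrite scalar_mx3 => /matrixP E; have := E o0 o1; have := E o0 o2.
  by rewrite !mx3E /= => -> ->.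
case/lift_row_unipotents=> r [a [b [nz ->]]]; exists (a / r, b / r), r.
by apply: eq_mx3; rewrite !(mxE, sum_ord3) /=; field.
Qed.

Lemma two_neq0_of_odd : odd #|K| -> 1 + 1 != 0 :> K.
Proof.
move=> oddK; apply/eqP=> K2; pose x : K := 1.
have ox : #[x]%g = 2%N.
  by apply: nt_prime_order => //; exact: oner_neq0.
by have := order_dvdG (in_setT x); rewrite ox cardsT dvdn2 oddK.
Qed.

(* The isomorphism is (a, b) |-> exp (a N + b N^2), with N the nilpotent Jordan block. *)
Lemma jordan3_isog_odd : odd #|K| -> (jordan3 K / Z3 K)%g \isog [set: K * K].
Proof.
move/two_neq0_of_odd=> nz2.
apply: (@isog_of_lift _ _ (fun x : K * K =>
  mx3 [:: [:: 1; x.1; x.2 + x.1 * x.1 / (1 + 1)]; [:: 0; 1; x.1]; [:: 0; 0; 1]])) => [[x y]|[x y] [x' y']|[x y] c|X].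
- by apply/lift_jordan3; exists 1, x, (y + x * x / (1 + 1)); rewrite oner_neq0.
- exists 1; rewrite scale1r mul_triangular /= ?FinRing.zmodMgE.
  by apply: eq_mx3; rewrite !mx3E /=; field.
- rewrite scalar_mx3 => /matrixP E; have := E o0 o1; have := E o0 o2.
  by rewrite !mx3E /= => + x0; rewrite x0 !mul0r addr0 => ->.
case/lift_jordan3=> r [a [b [nz ->]]].
exists (a / r, b / r - (a / r) * (a / r) / (1 + 1)), r.
by apply: eq_mx3; rewrite !(mxE, sum_ord3) /=; field; rewrite ?nz ?nz2.
Qed.

(** An abelian 2-group of exponent 4 is homocyclic when its elements of order at most 2 are exactly
    the squares; [Ohm1_homocyclicP] says this with the [Mho] of index [(logn 2 4).-1 = 1]. *)
Lemma homocyclic4 (gT : finGroupType) (G : {group gT}) : abelian G ->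
  {in G, forall x, x ^+ 4 = 1}%g ->
  {in G, forall x, x ^+ 2 = 1 -> exists2 y, y \in G & x = y ^+ 2}%g ->
  (exists2 x, x \in G & x ^+ 2 != 1)%g -> homocyclic G /\ exponent G = 4%N.
Proof.
move=> abG G4 G2 [z Gz z2].
have e4 : (exponent G %| 4)%N by apply/exponentP.
have nd2 : ~~ (exponent G %| 2)%N by apply: contra z2 => /exponentP/(_ z Gz)->.
have eG : exponent G = 4%N.
  have : (exponent G <= 4)%N by exact: dvdn_leq.
  by case: (exponent G) e4 nd2 => [|[|[|[|[|]]]]].
have pG : 2.-group G by rewrite -pnat_exponent eG.
split=> //; apply/(Ohm1_homocyclicP pG abG); rewrite eG.
rewrite (_ : (logn 2 4).-1 = 1)%N // (OhmE 1 pG) (MhoE 1 pG); congr <<_>>%g.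
apply/setP=> x; rewrite !inE expn1; apply/andP/imsetP=> [[Gx /eqP x2]|[y Gy ->]].
  by have [y Gy ->] := G2 x Gx x2; exists y.
by rewrite groupX // -expgM; split=> //; apply/eqP/G4.
Qed.

(** A homocyclic group of exponent 4 and rank r has order 4^r, so its order determines its type. *)
Lemma homocyclic4_isog (gT rT : finGroupType) (G : {group gT}) (H : {group rT}) :
  abelian G -> abelian H -> homocyclic G /\ exponent G = 4%N ->
  homocyclic H /\ exponent H = 4%N -> #|G| = #|H| -> G \isog H.
Proof.
move=> abG abH [hG eG] [hH eH] GH.
rewrite (eq_abelian_type_isog abG abH) (abelian_type_homocyclic hG) (abelian_type_homocyclic hH).
have := card_homocyclic hG; rewrite GH (card_homocyclic hH) eG eH => /eqP.
by rewrite eqn_exp2l // => /eqP->.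
Qed.

Lemma rV_Z4_homocyclic d : (0 < d)%N ->
  homocyclic [set: 'rV['Z_4]_d] /\ exponent [set: 'rV['Z_4]_d] = 4%N.
Proof.
move=> d_gt0; apply: (@homocyclic4 _ [set: 'rV['Z_4]_d]%G).
- exact: FinRing.zmod_abelian.
- move=> x _; rewrite FinRing.zmodXgE; apply/rowP=> i; rewrite !mxE.
  by case: (x 0 i) => [[|[|[|[|]]]] lti] //; apply: val_inj.
- move=> x _; rewrite FinRing.zmodXgE => x2.
  (* Twice [x] being 0 leaves only the entries 0 and 2, and 2 = 1 + 1. *)
  exists (\row_i (if x 0 i == 0 then 0 else 1)); rewrite ?inE // FinRing.zmodXgE.
  apply/rowP=> i; have := congr1 (fun y : 'rV['Z_4]_d => y 0 i) x2; rewrite !mxE.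
  by case: (x 0 i) => [[|[|[|[|]]]] lti] // _; apply: val_inj.
exists (const_mx 1); rewrite ?inE // FinRing.zmodXgE.
by apply/eqP=> /rowP/(_ (Ordinal d_gt0)); rewrite !mxE => /(congr1 val).
Qed.

(* In characteristic 2, (1 + a N + b N^2)^2 = 1 + a^2 N^2, so the squares are
   exactly the elements of order at most 2. *)
Lemma jordan3_isog_even d : #|K| = (2 ^ d)%N ->
  (jordan3 K / Z3 K)%g \isog [set: 'rV['Z_4]_d].
Proof.
move=> cardK; have d_gt0 : (0 < d)%N.
  by case: d cardK => // K1; have := finNzRing_gt1 K; rewrite K1.
have K2 : 1 + 1 = 0 :> K.
  by have := card_finPcharP cardK isT; rewrite inE => /andP[_ /eqP].
have twice (x : K) : x + x = 0 by rewrite -[x]mul1r -mulrDl K2 mul0r.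
pose J (r a b : K) := mx3 [:: [:: r; a; b]; [:: 0; r; a]; [:: 0; 0; r]].
have sqJ r a b : J r a b *m J r a b = J (r * r) 0 (a * a).
  rewrite mul_triangular /J; apply: eq_mx3; rewrite !mx3E //=; last by rewrite mulrC twice.
    by rewrite mulrC twice.
  by rewrite addrAC [r * b]mulrC twice add0r.
have gJ := jordan3_group K; pose G := Group gJ.
have abG : abelian G by apply: abelian_of_commuting; exact: jordan3_comm.
have J1 (r a b : K) c : J r a b = c%:M -> a = 0 /\ b = 0.
  rewrite scalar_mx3 => /matrixP E; have := E o0 o1; have := E o0 o2.
  by rewrite !mx3E.
have sq (m : {'GL_3[K]}) : GLval (m ^+ 2)%g = GLval m *m GLval m by rewrite expgS expg1 GLM.
have hG : homocyclic G /\ exponent G = 4%N.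
  apply: homocyclic4 => //.
  - move=> x Gx; have [m xm] := pcoset_surj x; rewrite xm in Gx *.
    have /lift_jordan3[r [a [b [_ mE]]]] := proj1 (mem_lift _ _) Gx.
    rewrite -pcosetX; apply/eqP/pcoset1P; exists (r * r * (r * r)).
    rewrite (expgM m 2 2) !sq mE -/(J r a b) !sqJ mulr0 scalar_mx3.
    by [].
  - move=> x Gx; have [m xm] := pcoset_surj x; rewrite xm in Gx *.
    have /lift_jordan3[r [a [b [nzr mE]]]] := proj1 (mem_lift _ _) Gx.
    rewrite -pcosetX => /eqP/pcoset1P[c]; rewrite sq mE -/(J r a b) sqJ => /J1[_ /eqP].
    rewrite mulf_eq0 orbb => /eqP a0.
    (* The square root of [b / r]: [d] squarings are the identity on [K], so [d - 1] of them invert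
       squaring. *)
    pose t := (b / r) ^+ (2 ^ d.-1).
    have t2 : t * t = b / r.
      by rewrite -expr2 -exprM -expnSr prednK // -cardK expf_card.
    have /GL_of_unit[n nE] : J 1 t 0 \in unitmx by rewrite unitmx_triangular !mulr1 oner_neq0.
    exists (coset (Z3 K) n).
      by apply/mem_lift/lift_jordan3; exists 1, t, 0; rewrite oner_neq0.
    rewrite -pcosetX; apply/eqP/pcosetP; exists r => //.
    by rewrite sq nE sqJ mE a0 t2; apply: eq_mx3; rewrite !(mxE, sum_ord3) /=; field.
  have /GL_of_unit[n nE] : J 1 1 0 \in unitmx by rewrite unitmx_triangular !mulr1 oner_neq0.
  exists (coset (Z3 K) n).
    by apply/mem_lift/lift_jordan3; exists 1, 1, 0; rewrite oner_neq0.
  rewrite -pcosetX; apply/pcoset1P=> -[c]; rewrite sq nE sqJ => /J1[_ /eqP].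
  by rewrite mulr1 oner_eq0.
apply: (@homocyclic4_isog _ _ G [set: 'rV['Z_4]_d]%G) => //.
- exact: FinRing.zmod_abelian.
- exact: rV_Z4_homocyclic.
rewrite cardsT card_mx mul1n card_ord.
rewrite (@card_of_lift (K * K)%type (fun x => J 1 x.1 x.2)).
- by rewrite card_prod cardK -expnD addnn -mul2n expnM.
- by move=> [a b]; apply/lift_jordan3; exists 1, a, b; rewrite oner_neq0.
- move=> [a b] [a' b'] c /matrixP E; have := E o0 o0; have := E o0 o1; have := E o0 o2.
  by rewrite !mxE /= => + + c1; rewrite mulr1 in c1; rewrite -c1 !mul1r => -> ->.
move=> X /lift_jordan3[r [a [b [nz ->]]]]; exists (a / r, b / r), r.
by apply: eq_mx3; rewrite !(mxE, sum_ord3) /=; field.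
Qed.

End IsomorphismTypes.

(** * The classification *)

Section Classification.
Variables (K : finFieldType) (L2 L3 : fieldExtType K).
Hypotheses (dimL2 : \dim {:L2} = 2%N) (dimL3 : \dim {:L3} = 3%N).
Variables (phi2 : {linear 'cV[K]_3 -> (L2 * K^o)%type}) (bij2 : bijective phi2).
Variables (phi3 : {linear 'cV[K]_3 -> L3}) (bij3 : bijective phi3).
Variable omega : K.
Hypothesis prim_omega : #|K| = 1 %[mod 3] -> 3.-primitive_root omega.
Implicit Types (X Y M N P : 'M[K]_3) (u v : 'cV[K]_3) (w : 'rV[K]_3).
Implicit Types (A : {set coset_of (Z3 K)}).

Local Notation rep := (representative omega phi2 phi3).

Lemma rep_abelian c : occurs K c -> group_set (rep c) /\ abelian (rep c).
Proof.
case: c => /= occ; split; try exact: quotient_gen_group.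
- exact: cubic_group.
- by apply: abelian_of_commuting; exact: cubic_comm.
- exact: quadratic_group.
- by apply: abelian_of_commuting; exact: quadratic_comm.
- exact: diagonals_group.
- by apply: abelian_of_commuting; exact: diagonals_comm.
- exact: jordan21_group.
- by apply: abelian_of_commuting; exact: jordan21_comm.
- exact: jordan3_group.
- by apply: abelian_of_commuting; exact: jordan3_comm.
- exact: column_unipotents_group.
- by apply: abelian_of_commuting; exact: column_unipotents_comm.
- exact: row_unipotents_group.
- by apply: abelian_of_commuting; exact: row_unipotents_comm.
- by apply: clock_shift_abelian; apply/prim_omega/eqP.
by apply: (frobenius_abelian (prim_omega _)) => //; apply/eqP.
Qed.

Lemma rep_max c : occurs K c -> max_abelian (rep c).
Proof.
move=> occ; have [gR abR] := rep_abelian occ.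
case: c occ gR abR => /= occ gR abR.
- exact: cubic_max.
- exact: quadratic_max.
- exact: diagonals_max.
- exact: jordan21_max.
- exact: jordan3_max.
- exact: column_unipotents_max.
- exact: row_unipotents_max.
- have prim := prim_omega (eqP occ); have [Rg Rh] := lift_clock_shift prim.
  by apply: (heis_max prim gR abR (clock_shift_pair prim)); [exact: Rg | exact: Rh].
have prim := prim_omega (eqP occ); have [b ncb] := noncube_ex prim.
have [g [h [v [Rg Rh hp]]]] := noncube_pair prim bij3 dimL3 ncb.
by apply: (heis_max prim gR abR hp); [exact: Rg | exact: Rh].
Qed.

Lemma conj_rep A c P : max_abelian A -> occurs K c -> P \in unitmx ->
  (forall X, lift A X -> exists2 Y, lift (rep c) Y & X *m P = P *m Y) ->
  exists2 c, occurs K c & conj_in_PGL3 A (rep c).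
Proof.
move=> maxA occ uP AP; exists c => //; have [gR abR] := rep_abelian occ.
exact: (@conj_of_sub _ A (Group gR) P).
Qed.

Lemma poly2_similar a b c M N P : M *m P = P *m N ->
  poly2 a b c M *m P = P *m poly2 a b c N.
Proof.
move=> MP; rewrite !mulmxDl !mulmxDr -!scalemxAl -!scalemxAr mul_mx_scalar mul_scalar_mx.
by rewrite -[M *m M *m P]mulmxA MP [M *m (P *m N)]mulmxA MP -mulmxA.
Qed.

(** Comparison with a model [N] satisfying the same cubic relation as [M]: the lifts of [A] are
    polynomials in [M], and conjugation carries them to invertible polynomials in [N], which lie in
    the representative. *)
Lemma conj_of_cyclic A M N v v' c x y z : max_abelian A -> occurs K c ->
  (forall X Y, lift A X -> lift A Y -> X *m Y = Y *m X) -> lift A M ->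
  krylov M v \in unitmx -> krylov N v' \in unitmx ->
  M *m (M *m (M *m v)) = x *: v + y *: (M *m v) + z *: (M *m (M *m v)) ->
  N *m (N *m (N *m v')) = x *: v' + y *: (N *m v') + z *: (N *m (N *m v')) ->
  (forall a b d, poly2 a b d N \in unitmx -> lift (rep c) (poly2 a b d N)) ->
  exists2 c, occurs K c & conj_in_PGL3 A (rep c).
Proof.
move=> maxA occ cA AM uM uN relM relN polyN.
have [P uP MP] := krylov_similar uM uN relM relN.
apply: (conj_rep maxA occ uP) => X AX.
have [a [b [d XE]]] := krylov_commutant uM (cA _ _ AX AM).
have XP : X *m P = P *m poly2 a b d N by rewrite XE (poly2_similar _ _ _ MP).
exists (poly2 a b d N) => //; apply: polyN.
have: X *m P \in unitmx by rewrite unitmx_mul (lift_unit AX) uP.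
by rewrite XP unitmx_mul => /andP[].
Qed.

Lemma card_neq2 (a b : K) : a != 0 -> b != 0 -> a != b -> #|K| != 2%N.
Proof.
move=> nza nzb nab; apply/eqP=> K2.
have := max_card (mem [set 0; a; b]); rewrite K2 -setUA cardsU1 cards2 nab.
by rewrite !inE !(eq_sym 0) (negPf nza) (negPf nzb).
Qed.

(** The relation says that [M] has characteristic polynomial (X - r)(X - s)(X - t), and coincidences
    among the roots select the Jordan form. Two distinct nonzero roots already give q > 2, as
    [occurs] asks. *)
Lemma conj_of_roots A M v (r s t : K) : max_abelian A ->
  (forall X Y, lift A X -> lift A Y -> X *m Y = Y *m X) -> lift A M ->
  krylov M v \in unitmx -> r != 0 -> s != 0 -> t != 0 ->
  M *m (M *m (M *m v)) = (r * s * t) *: v + (- (r * s + r * t + s * t)) *: (M *m v)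
     + (r + s + t) *: (M *m (M *m v)) ->
  exists2 c, occurs K c & conj_in_PGL3 A (rep c).
Proof.
move=> maxA cA AM uM nzr nzs nzt rel.
have two_equal (p q : K) : p != 0 -> q != 0 -> p != q ->
    M *m (M *m (M *m v)) = (p * p * q) *: v + (- (p * p + p * q + p * q)) *: (M *m v)
     + (p + p + q) *: (M *m (M *m v)) ->
    exists2 c, occurs K c & conj_in_PGL3 A (rep c).
  move=> nzp nzq npq relpq.
  pose N := mx3 [:: [:: p; 1; 0]; [:: 0; p; 0]; [:: 0; 0; q]].
  (* A cyclic vector needs a component on the generator of each Jordan chain, here the second and
     third basis vectors. *)
  pose v' : 'cV[K]_3 := \col_i nth 0 [:: 0; 1; 1] i.
  apply: (@conj_of_cyclic A M N v v' Jordan21) relpq _ _ => //.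
  - exact: (card_neq2 nzp nzq).
  - have nz : - ((q - p) * (q - p)) != 0 by rewrite oppr_eq0 mulf_neq0 // subr_eq0 eq_sym.
    rewrite unitmxE unitfE det_mx3 !col3E /= !(mxE, sum_ord3) /=.
    by move: nz; congr (~~ (_ == 0)); ring.
  - by apply: eq_cV3; rewrite !(mxE, sum_ord3) /=; ring.
  move=> a b d upN.
  have E : poly2 a b d N = mx3 [:: [:: a + b * p + d * p * p; b + d * (p + p); 0];
      [:: 0; a + b * p + d * p * p; 0]; [:: 0; 0; a + b * q + d * q * q]].
    by apply: eq_mx3; rewrite !(mxE, sum_ord3) /= ?mulr1n ?mulr0n; ring.
  move: upN; rewrite E unitmx_triangular => nz.
  apply/lift_jordan21; do 3!eexists; split; last reflexivity.
  by apply: contra nz => /eqP e; rewrite -mulrA e mulr0.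
have [ers|nrs] := eqVneq r s.
  have [ert|nrt] := eqVneq r t; last first.
    by apply: (two_equal r t); rewrite // rel -ers.
  pose N := mx3 [:: [:: r; 1; 0]; [:: 0; r; 1]; [:: 0; 0; r]].
  pose v' : 'cV[K]_3 := \col_i nth 0 [:: 0; 0; 1] i.
  apply: (@conj_of_cyclic A M N v v' Jordan3) rel _ _ => //.
  - have nz : -1 != 0 :> K by rewrite oppr_eq0 oner_eq0.
    rewrite unitmxE unitfE det_mx3 !col3E /= !(mxE, sum_ord3) /=.
    by move: nz; congr (~~ (_ == 0)); ring.
  - by rewrite -ers -ert; apply: eq_cV3; rewrite !(mxE, sum_ord3) /=; ring.
  move=> a b d upN.
  have E : poly2 a b d N = mx3 [:: [:: a + b * r + d * r * r; b + d * (r + r); d];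
      [:: 0; a + b * r + d * r * r; b + d * (r + r)]; [:: 0; 0; a + b * r + d * r * r]].
    by apply: eq_mx3; rewrite !(mxE, sum_ord3) /= ?mulr1n ?mulr0n; ring.
  move: upN; rewrite E unitmx_triangular => nz.
  apply/lift_jordan3; do 3!eexists; split; last reflexivity.
  by apply: contra nz => /eqP ->; rewrite mulr0.
have [ert|nrt] := eqVneq r t.
  by apply: (two_equal r s); rewrite // rel -ert; congr (_ *: _ + _ *: _ + _ *: _); ring.
have [est|nst] := eqVneq s t.
  apply: (two_equal s r) => //; first by rewrite eq_sym.
  by rewrite rel -est; congr (_ *: _ + _ *: _ + _ *: _); ring.
pose N := mx3 [:: [:: r; 0; 0]; [:: 0; s; 0]; [:: 0; 0; t]].
(* The Krylov matrix of the all-ones vector is a Vandermonde matrix. *)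
pose v' : 'cV[K]_3 := \col_i 1.
apply: (@conj_of_cyclic A M N v v' SplitTorus) rel _ _ => //.
- exact: (card_neq2 nzr nzs).
- have nz : (s - r) * (t - r) * (t - s) != 0 by rewrite !mulf_neq0 // subr_eq0 eq_sym.
  rewrite unitmxE unitfE det_mx3 !col3E /= !(mxE, sum_ord3) /=.
  by move: nz; congr (~~ (_ == 0)); ring.
- by apply: eq_cV3; rewrite !(mxE, sum_ord3) /=; ring.
move=> a b d upN.
have E : poly2 a b d N = mx3 [:: [:: a + b * r + d * r * r; 0; 0];
    [:: 0; a + b * s + d * s * s; 0]; [:: 0; 0; a + b * t + d * t * t]].
  by apply: eq_mx3; rewrite !(mxE, sum_ord3) /= ?mulr1n ?mulr0n; ring.
move: upN; rewrite E unitmx_triangular => nz.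
by apply/lift_diagonals; do 3!eexists; split; last reflexivity.
Qed.

Lemma conj_of_cyclic_element A M v : max_abelian A ->
  (forall X Y, lift A X -> lift A Y -> X *m Y = Y *m X) -> lift A M ->
  krylov M v \in unitmx -> exists2 c, occurs K c & conj_in_PGL3 A (rep c).
Proof.
move=> maxA cA AM uM; have [x [y [z rel]]] := krylov_rel uM.
have nzx : x != 0.
  (* With [x = 0] one factor [M] cancels from the relation, leaving a dependence among [v], [M v]
     and [M (M v)]. *)
  apply/eqP=> x0; have := rel; rewrite x0 scale0r add0r !scalemxAr -mulmxDr => /eqP.
  rewrite -subr_eq0 -mulmxBr => /eqP/(unit_mulmx_eq0 (lift_unit AM)) E.
  have [] := @unit_col3_free _ _ _ _ (- y) (- z) 1 uM.
    by rewrite -[RHS]E -scalemxAr !scaleNr scale1r opprD [LHS]addrC.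
  by move=> _ _ /eqP; rewrite oner_eq0.
pose p : {poly K} := 'X^3 - (z *: 'X^2 + y *: 'X + x%:P).
have sz_low (a b c : K) : (size (a *: 'X^2 + b *: 'X + c%:P)%R < 4)%N.
  rewrite (leq_ltn_trans (size_polyD _ _)) // gtn_max.
  rewrite (leq_ltn_trans (size_polyC_leq1 _)) // andbT.
  rewrite (leq_ltn_trans (size_polyD _ _)) // gtn_max.
  by rewrite !(leq_ltn_trans (size_scale_leq _ _)) ?size_polyX ?size_polyXn.
have [psi3 _ psi3K] := bij3; have [psi2 _ psi2K] := bij2.
have [/existsP[d pd]|] := boolP [exists d : K, root p d]; last first.
  rewrite negb_exists => /forallP np.
  have sz_p : size p = 4%N by rewrite size_polyDl size_polyXn // size_polyN.
  have irr_p : irreducible_poly p by apply: cubic_irreducible; rewrite // sz_p.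
  have [|a pa] := irreducible_root (L := L3) irr_p; first by rewrite sz_p dimL3.
  have nKa c : a != c%:A.
    by apply: contraNneq (np c) => ac; move: pa; rewrite ac -in_algE fmorph_root.
  have a3 : a * a * a = x%:A + y *: a + z *: (a * a).
    move: pa; rewrite rootE /p rmorphB !rmorphD /= map_polyC !map_polyZ /= map_polyX !map_polyXn.
    rewrite !hornerE /= => /eqP e; apply/eqP; rewrite -subr_eq0 -[X in _ == X]e; apply/eqP.
    by rewrite -[y *: a]mulr_algl -[z *: (a * a)]mulr_algl; ring.
  have nza : a != 0 by have := nKa 0; rewrite scale0r.
  have [N uN aN] := mulby_ex bij3 nza.
  have uK := cubic_krylov dimL3 nKa aN (psi3K 1).
  apply: (conj_of_cyclic (c := CubicTorus) (N := N) (v' := psi3 1) _ _ cA AM uM uK rel) => //.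
    apply: (bij_inj bij3); rewrite !linearD !linearZ /= !aN psi3K mulr1.
    by rewrite mulrA a3.
  move=> b c e upN; apply/(lift_cubic bij3); exists (b%:A + c *: a + e *: (a * a)); last exact: mulby_poly2.
  apply/eqP=> E; have Xp : poly2 b c e N *m psi3 1 = 0.
    by apply: (bij_inj bij3); rewrite linear0 (mulby_poly2 b c e aN) E mul0r.
  have := unit_mulmx_eq0 upN Xp => /(congr1 phi3)/eqP.
  by rewrite psi3K linear0 oner_eq0.
(* The coefficients of the quotient X^2 + e X + f of [p] by X - d. *)
pose e := d - z; pose f := d * d - z * d - y.
have xE : x = d * f.
  apply/eqP; rewrite -subr_eq0 /f; move: pd; rewrite rootE /p !hornerE /= -oppr_eq0.
  by congr (_ == 0); ring.
have zE : z = d - e by rewrite /e; ring.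
have yE : y = d * e - f by rewrite /e /f; ring.
have [nzd nzf] : d != 0 /\ f != 0.
  by apply/andP; rewrite -negb_or -mulf_eq0 -xE.
clearbody e f; pose q : {poly K} := 'X^2 + (e *: 'X + f%:P).
have [/existsP[s qs]|] := boolP [exists s : K, root q s].
  pose t := - e - s.
  have fE : f = s * t.
    apply/eqP; rewrite -subr_eq0 /t; move: qs; rewrite rootE /q !hornerE /=.
    by congr (_ == 0); ring.
  have eE : e = - (s + t) by rewrite /t; ring.
  have [nzs nzt] : s != 0 /\ t != 0.
    by apply/andP; rewrite -negb_or -mulf_eq0 -fE.
  apply: (conj_of_roots maxA cA AM uM nzd nzs nzt) => //.
  rewrite rel xE zE yE fE eE.
  by congr (_ *: _ + _ *: _ + _ *: _); ring.
rewrite negb_exists => /forallP nq.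
have sz_q : size q = 3%N.
  rewrite size_polyDl size_polyXn // (leq_ltn_trans (size_polyD _ _)) // gtn_max.
  rewrite (leq_ltn_trans (size_polyC_leq1 _)) // andbT.
  by rewrite (leq_ltn_trans (size_scale_leq _ _)) ?size_polyX.
have irr_q : irreducible_poly q by apply: cubic_irreducible; rewrite // sz_q.
have [|a qa] := irreducible_root (L := L2) irr_q; first by rewrite sz_q dimL2.
have nKa c : a != c%:A.
  by apply: contraNneq (nq c) => ac; move: qa; rewrite ac -in_algE fmorph_root.
have a2 : a * a = - (e *: a) - f%:A.
  move: qa; rewrite rootE /q !rmorphD /= map_polyC !map_polyZ /= map_polyX !map_polyXn.
  rewrite !hornerE /= => /eqP h; apply/eqP; rewrite -subr_eq0 -[X in _ == X]h; apply/eqP.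
  by rewrite -[e *: a]mulr_algl; ring.
have nza : a != 0 by have := nKa 0; rewrite scale0r.
have [N uN aN] := mulby2_ex bij2 nza nzd.
have uK := quadratic_krylov nKa aN (psi2K (1, 1)).
apply: (conj_of_cyclic (c := QuadraticTorus) (N := N) (v' := psi2 (1, 1)) _ _ cA AM uM uK rel) => //.
  (* Both coordinates [a] and [d] of the model are roots of [p = (X - d) q]. *)
  have E1 : a * (a * a) = x%:A + y *: a + z *: (a * a).
    have E0 : a * a + e%:A * a + f%:A = 0 by rewrite a2 mulr_algl addrAC subrK addNr.
    rewrite -[y *: a]mulr_algl -[z *: (a * a)]mulr_algl xE yE zE.
    rewrite -!in_algE !rmorphB !rmorphM /=; apply/eqP; rewrite -subr_eq0.
    by rewrite -(mulr0 (a - d%:A)) -E0; apply/eqP; ring.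
  have E2 : d * (d * d) = x * 1 + y * d + z * (d * d) by rewrite xE yE zE; ring.
  apply: (bij_inj bij2); rewrite !linearD !linearZ /= !aN psi2K /= !mulr1.
  by congr (_, _); [exact: E1 | exact: E2].
move=> b c g upN; have pX := mulby2_poly2 b c g aN.
have inj (v0 : (L2 * K^o)%type) : phi2 (poly2 b c g N *m psi2 v0) = 0 -> v0 = 0.
  move=> Xv; have /(unit_mulmx_eq0 upN)/(congr1 phi2) : poly2 b c g N *m psi2 v0 = 0.
    by apply: (bij_inj bij2); rewrite Xv linear0.
  by rewrite psi2K linear0.
apply/(lift_quadratic bij2); do 2!eexists; split; last exact: pX.
- apply/eqP=> E; have: phi2 (poly2 b c g N *m psi2 (1, 0)) = 0 by rewrite pX E psi2K /= mul0r mulr0.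
  by move/inj/(congr1 fst)/eqP; rewrite /= oner_eq0.
apply/eqP=> E; have: phi2 (poly2 b c g N *m psi2 (0, 1)) = 0 by rewrite pX E psi2K /= mul0r mulr0.
by move/inj/(congr1 snd)/eqP; rewrite /= oner_eq0.
Qed.

(** The given element splits the space into the line of [u] and the plane [w0 = 0], both stable
    under all lifts because they commute with it. It remains to see how the lifts act on the
    plane. *)
Lemma conj_of_homology A m c0 u w0 : max_abelian A ->
  (forall X Y, lift A X -> lift A Y -> X *m Y = Y *m X) ->
  (forall X, lift A X -> exists c u w, X = c%:M + u *m w) ->
  coset (Z3 K) m \in A -> GLval m = c0%:M + u *m w0 -> dot w0 u != 0 ->
  exists2 c, occurs K c & conj_in_PGL3 A (rep c).
Proof.
move=> maxA cA rk1 /mem_lift AX XE nzk.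
have conjR c P : occurs K c -> P \in unitmx ->
    (forall X, lift A X -> exists2 Y, lift (rep c) Y & X *m P = P *m Y) ->
    exists2 c, occurs K c & conj_in_PGL3 A (rep c).
  by move=> occ uP; apply: conj_rep.
have comm1 X c v w : lift A X -> X = c%:M + v *m w -> forall Y, lift A Y ->
    Y *m (v *m w) = v *m w *m Y.
  move=> AX' XE' Y AY; have := cA _ _ AY AX'; rewrite XE' mulmxDr mulmxDl.
  by rewrite mul_mx_scalar mul_scalar_mx => /addrI.
set X0 := GLval m in AX XE; pose k := dot w0 u; pose w := k^-1 *: w0.
have {XE} XE : X0 = c0%:M + (k *: u) *m w.
  by rewrite XE -scalemxAl -scalemxAr scalerA divff // scale1r.
have wu : dot w u = 1 by rewrite dotZl mulVf.
have nzu : u != 0 by apply/eqP=> u0; move: nzk; rewrite u0 dot0r eqxx.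
have nzw : w != 0.
  by apply/eqP=> w1; move: wu; rewrite w1 /dot mul0mx mxE => /eqP; rewrite eq_sym oner_eq0.
have nzku : k *: u != 0 by rewrite scaler_eq0 negb_or nzk.
have X0u : X0 *m u = (c0 + k) *: u.
  by rewrite XE mulmxDl mul_scalar_mx mulmx_dot wu scale1r scalerDl.
have X0ker x : dot w x = 0 -> X0 *m x = c0 *: x.
  by move=> wx; rewrite XE mulmxDl mul_scalar_mx mulmx_dot wx scale0r addr0.
have uX0 := lift_unit AX.
have nzck : c0 + k != 0.
  apply: contraNneq nzu => E; apply/eqP/(unit_mulmx_eq0 uX0).
  by rewrite X0u E scale0r.
have [a [b [wa wb uP]]] := ker_basis nzw.
have nza : a != 0.
  apply/eqP=> a0; have [] := @unit_col3_free _ _ _ _ 1 0 0 (uP u wu).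
    by rewrite a0 scaler0 !scale0r !addr0.
  by move/eqP; rewrite oner_eq0.
have nzc0 : c0 != 0.
  apply: contraNneq nza => E; apply/eqP/(unit_mulmx_eq0 uX0).
  by rewrite X0ker // E scale0r.
(* [c0] and [c0 + k] are distinct eigenvalues of [X0], nonzero because it is invertible. *)
have nK2 : #|K| != 2%N.
  apply: (card_neq2 nzc0 nzck).
  by rewrite -[X in X == _]addr0 (inj_eq (addrI c0)) eq_sym.
have eig Y : lift A Y -> exists l, Y *m u = l *: u /\ w *m Y = l *: w.
  move=> AY; have [l [Yu wY]] := comm_rank1 nzku nzw (comm1 _ _ _ _ AX XE _ AY).
  exists l; split=> //; apply: (scalerI nzk).
  by rewrite scalemxAr Yu scalerA mulrC -scalerA.
(* Either some lift moves a vector [x] of the plane off its line, or all vectors of the plane are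
   eigenvectors of every lift and the group is diagonal. *)
have [|scal] := boolP [exists n : {'GL_3[K]}, [exists x : 'cV[K]_3,
    [&& coset (Z3 K) n \in A, dot w x == 0 & [forall c : K, GLval n *m x != c *: x]]]].
  case/existsP=> n /existsP[x /and3P[/mem_lift AY /eqP wx /forallP nx]].
  set Y := GLval n in AY nx; have [c' [u' [w' YE]]] := rk1 _ AY.
  have w'x : dot w' x != 0.
    apply: contra (nx c') => /eqP w'x.
    by rewrite YE mulmxDl mul_scalar_mx mulmx_dot w'x scale0r addr0.
  have nzu' : u' != 0.
    by apply: contra (nx c') => /eqP u'0; rewrite YE u'0 mul0mx addr0 mul_scalar_mx.
  have nzw' : w' != 0 by apply: contraNneq w'x => ->; rewrite /dot mul0mx mxE.
  have comm : (k *: u) *m w *m (u' *m w') = u' *m w' *m ((k *: u) *m w).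
    have := comm1 _ _ _ _ AY YE _ AX; rewrite XE mulmxDl mulmxDr mul_mx_scalar mul_scalar_mx.
    by move/addrI.
  have E := rank1_colinear comm.
  have wu' : dot w u' = 0.
    have := congr1 (mulmx^~ x) E; rewrite -!scalemxAl !mulmx_dot wx scale0r scaler0.
    move/eqP; rewrite !scaler_eq0 (negPf w'x) (negPf nzu) (negPf nzk) /= orbF.
    by move/eqP.
  have w'u : dot w' u = 0.
    move: E; rewrite wu' scale0r => /esym/eqP; rewrite scaler_eq0 dotZr mulf_eq0 (negPf nzk) /=.
    case/orP=> /eqP // /mulmx_cVrV_eq0[] /eqP; first by rewrite (negPf nzu').
    by rewrite (negPf nzw).
  have eig' Z : lift A Z -> exists l, Z *m u' = l *: u' /\ w' *m Z = l *: w'.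
    by move=> AZ; exact: comm_rank1 nzu' nzw' (comm1 _ _ _ _ AY YE _ AZ).
  (* If [w' u' = 0], then [Y] acts on the plane as a scalar times a transvection and the basis [u'],
     [x], [u] gives the Jordan shape. Otherwise [Y] splits the plane into the line of [u'] and the
     kernel of [w'], and the group is diagonal. *)
  have [k'0|nzk'] := eqVneq (dot w' u') 0.
    have uQ : col3 u' x u \in unitmx.
      apply: dual_basis wu => // t; apply: contraNneq w'x => ->.
      by rewrite dotZr k'0 mulr0.
    apply: (conjR Jordan21 (col3 u' x u)) => // Z AZ.
    have [l [Zu wZ]] := eig _ AZ; have [l' [Zu' w'Z]] := eig' _ AZ.
    have [p [q [r Zx]]] := unit_col3_span (Z *m x) uQ.
    have r0 : r = 0.
      have : dot w (Z *m x) = 0 by rewrite /dot mulmxA wZ -scalemxAl mxE -/(dot _ _) wx mulr0.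
      by rewrite Zx !dotDr !dotZr wu' wx wu !mulr0 !add0r mulr1.
    have ql : q = l'.
      apply: (mulIf w'x).
      have : dot w' (Z *m x) = l' * dot w' x by rewrite /dot mulmxA w'Z -scalemxAl mxE.
      by rewrite Zx !dotDr !dotZr k'0 w'u !mulr0 addr0 add0r.
    have ZE := @mul_col3_mx3 _ Z u' x u [:: l'; 0; 0] [:: p; l'; 0] [:: 0; 0; l].
    rewrite /= !scale0r !addr0 !add0r in ZE.
    have {}ZE := ZE Zu' _ Zu.
    have {}ZE : Z *m col3 u' x u = col3 u' x u *m mx3 [:: [:: l'; p; 0]; [:: 0; l'; 0]; [:: 0; 0; l]].
      by apply: ZE; rewrite Zx r0 ql scale0r addr0.
    eexists; last exact: ZE.
    have: Z *m col3 u' x u \in unitmx by rewrite unitmx_mul (lift_unit AZ) uQ.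
    rewrite ZE unitmx_mul uQ unitmx_triangular /= => nz.
    apply/lift_jordan21; exists l', p, l; split=> //.
    by apply: contra nz => /eqP e; rewrite -mulrA e mulr0.
  have [y nzy [wy w'y]] := ker_dot2 w w'.
  have uQ : col3 u' y u \in unitmx.
    apply: dual_basis wu => // t; apply: contraNneq nzy => yu'.
    have := w'y; rewrite yu' dotZr => /eqP; rewrite mulf_eq0 (negPf nzk') orbF => /eqP->.
    by rewrite scale0r.
  apply: (conjR SplitTorus (col3 u' y u)) => // Z AZ.
  have [l [Zu wZ]] := eig _ AZ; have [l' [Zu' w'Z]] := eig' _ AZ.
  have [p [q [r Zy]]] := unit_col3_span (Z *m y) uQ.
  have r0 : r = 0.
    have : dot w (Z *m y) = 0 by rewrite /dot mulmxA wZ -scalemxAl mxE -/(dot _ _) wy mulr0.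
    by rewrite Zy !dotDr !dotZr wu' wy wu !mulr0 !add0r mulr1.
  have p0 : p = 0.
    have : dot w' (Z *m y) = 0 by rewrite /dot mulmxA w'Z -scalemxAl mxE -/(dot _ _) w'y mulr0.
    rewrite Zy !dotDr !dotZr w'y w'u !mulr0 !addr0 => /eqP.
    by rewrite mulf_eq0 (negPf nzk') orbF => /eqP.
  have ZE := @mul_col3_mx3 _ Z u' y u [:: l'; 0; 0] [:: 0; q; 0] [:: 0; 0; l].
  rewrite /= !scale0r !addr0 !add0r in ZE.
  have {}ZE : Z *m col3 u' y u = col3 u' y u *m mx3 [:: [:: l'; 0; 0]; [:: 0; q; 0]; [:: 0; 0; l]].
    by apply: ZE => //; rewrite Zy r0 p0 !scale0r addr0 add0r.
  eexists; last exact: ZE.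
  have: Z *m col3 u' y u \in unitmx by rewrite unitmx_mul (lift_unit AZ) uQ.
  rewrite ZE unitmx_mul uQ unitmx_triangular /= => nz.
  by apply/lift_diagonals; exists l', q, l.
have {}uP := uP u wu.
apply: (conjR SplitTorus (col3 a b u)) => // Z AZ.
have [l [Zu wZ]] := eig _ AZ.
have scalZ x : dot w x = 0 -> exists c, Z *m x = c *: x.
  case: AZ => n An <- wx; move: scal; rewrite negb_exists => /forallP/(_ n).
  rewrite negb_exists => /forallP/(_ x); rewrite An wx eqxx /= negb_forall.
  by case/existsP=> c /negPn/eqP; exists c.
have [p Za] := scalZ a wa; have [q Zb] := scalZ b wb.
have ZE := @mul_col3_mx3 _ Z a b u [:: p; 0; 0] [:: 0; q; 0] [:: 0; 0; l].
rewrite /= !scale0r !addr0 !add0r in ZE.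
have {}ZE := ZE Za Zb Zu.
eexists; last exact: ZE.
have: Z *m col3 a b u \in unitmx by rewrite unitmx_mul (lift_unit AZ) uP.
rewrite ZE unitmx_mul uP unitmx_triangular /= => nz.
by apply/lift_diagonals; exists p, q, l.
Qed.

(* Commuting transvections c + u w and d + u' w' satisfy w u' = 0 = w' u, hence
   u and u' are proportional if w and w' are not. *)
Lemma conj_of_transvections A : max_abelian A ->
  (forall X Y, lift A X -> lift A Y -> X *m Y = Y *m X) ->
  (forall X, lift A X -> exists c u w, X = c%:M + u *m w /\ dot w u = 0) ->
  exists2 c, occurs K c & conj_in_PGL3 A (rep c).
Proof.
move=> maxA cA rk1.
have conjR c P : occurs K c -> P \in unitmx ->
    (forall X, lift A X -> exists2 Y, lift (rep c) Y & X *m P = P *m Y) ->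
    exists2 c, occurs K c & conj_in_PGL3 A (rep c).
  by move=> occ uP; apply: conj_rep.
have orth X Y c d u w u' w' : lift A X -> lift A Y -> X = c%:M + u *m w ->
    Y = d%:M + u' *m w' -> dot w u = 0 -> dot w' u' = 0 -> u != 0 -> w != 0 ->
    w' != 0 -> dot w u' = 0.
  move=> AX AY XE YE wu w'u' nzu nzw nzw'.
  have comm : u *m w *m (u' *m w') = u' *m w' *m (u *m w).
    have: u *m w *m Y = Y *m (u *m w).
      have := cA _ _ AX AY; rewrite XE mulmxDl mulmxDr mul_mx_scalar mul_scalar_mx.
      by move/addrI.
    by rewrite YE mulmxDl mulmxDr mul_mx_scalar mul_scalar_mx => /addrI.
  have E := rank1_colinear comm.
  apply/eqP/negPn/negP=> nz; have [z w'z] := dot_dual nzw'.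
  have {}E : u = ((dot w u')^-1 * dot w' u * dot w z) *: u'.
    have := congr1 (mulmx^~ z) E; rewrite -!scalemxAl !mulmx_dot w'z scale1r => E'.
    by rewrite -!scalerA -E' scalerA mulVf // scale1r.
  case/negP: nz; move: wu; rewrite E dotZr => /eqP; rewrite mulf_eq0 => /orP[] //.
  by move/eqP=> k0; case/negP: nzu; rewrite E k0 scale0r.
have [|allZ] := boolP [exists m : {'GL_3[K]}, [exists c : K, [exists u : 'cV[K]_3, [exists w : 'rV[K]_3,
  [&& coset (Z3 K) m \in A, GLval m == c%:M + u *m w, dot w u == 0, u != 0 & w != 0]]]]]; last first.
  (* All lifts are scalar here, so they lie over any representative that occurs for every [K]. *)
  apply: (conjR ColumnUnipotent 1%:M) => // [|X AX]; first exact: unitmx1.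
  have [c [u [w [XE wu]]]] := rk1 _ AX.
  have Xc : X = c%:M.
    rewrite XE; have [->|nzu] := eqVneq u 0; first by rewrite mul0mx addr0.
    have [->|nzw] := eqVneq w 0; first by rewrite mulmx0 addr0.
    case/negP: allZ; case: AX XE => m Am mX XE; apply/existsP; exists m.
    apply/existsP; exists c; apply/existsP; exists u; apply/existsP; exists w.
    by rewrite Am mX XE wu !eqxx nzu nzw.
  exists X; last by rewrite mulmx1 mul1mx.
  apply/lift_column_unipotents; exists c, 0, 0; split; last by rewrite Xc scalar_mx3.
  by have := lift_unit AX; rewrite Xc scalar_mx3 unitmx_triangular; apply: contraNneq => ->; rewrite !mul0r.
case/existsP=> m0 /existsP[c0 /existsP[u0 /existsP[w0]]].
case/and5P=> /mem_lift AX0 /eqP X0E /eqP wu0 nzu0 nzw0; set X0 := GLval m0 in AX0 X0E.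
have colin X Y c d u w u' w' : lift A X -> lift A Y -> X = c%:M + u *m w ->
    Y = d%:M + u' *m w' -> dot w u = 0 -> dot w' u' = 0 -> u != 0 -> w != 0 ->
    u' != 0 -> w' != 0 -> (forall k, w != k *: w') -> exists k, u = k *: u'.
  move=> AX AY XE YE wu w'u' nzu nzw nzu' nzw' nww'.
  have wu' := orth _ _ _ _ _ _ _ _ AX AY XE YE wu w'u' nzu nzw nzw'.
  have w'u := orth _ _ _ _ _ _ _ _ AY AX YE XE w'u' wu nzu' nzw' nzw.
  exact: ker2_colinear nzw' nww' wu' w'u' wu w'u nzu'.
have unit_c X c u w : lift A X -> X = c%:M + u *m w -> dot w u = 0 -> u != 0 -> c != 0.
  move=> AX XE wu nzu; apply: contraNneq nzu => cc; apply/eqP/(unit_mulmx_eq0 (lift_unit AX)).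
  by rewrite XE mulmxDl mul_scalar_mx mulmx_dot wu cc !scale0r addr0.
(* A second row not proportional to [w0] forces a common column [u0], hence row unipotents;
   otherwise [w0] is a common row. *)
have [|] := boolP [exists m : {'GL_3[K]}, [exists c : K, [exists u : 'cV[K]_3, [exists w : 'rV[K]_3,
  [&& coset (Z3 K) m \in A, GLval m == c%:M + u *m w, dot w u == 0, u != 0 & [forall k : K, w != k *: w0]]]]]].
  case/existsP=> m1 /existsP[c1 /existsP[u1 /existsP[w1]]].
  case/and5P=> /mem_lift AX1 /eqP X1E /eqP wu1 nzu1 /forallP nw10.
  have nzw1 : w1 != 0 by have := nw10 0; rewrite scale0r.
  have [k1 u1E] := colin _ _ _ _ _ _ _ _ AX1 AX0 X1E X0E wu1 wu0 nzu1 nzw1 nzu0 nzw0 nw10.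
  have col0 X : lift A X -> exists c w, X = c%:M + u0 *m w /\ dot w u0 = 0.
    move=> AX; have [c [u [w [XE wu]]]] := rk1 _ AX; exists c.
    have triv : u *m w = 0 -> exists w, X = c%:M + u0 *m w /\ dot w u0 = 0.
      by move=> uw; exists 0; rewrite XE uw mulmx0 /dot mul0mx mxE.
    have [u_0|nzu] := eqVneq u 0; first by apply: triv; rewrite u_0 mul0mx.
    have [w_0|nzw] := eqVneq w 0; first by apply: triv; rewrite w_0 mulmx0.
    have [k uE] : exists k, u = k *: u0.
      have [/forallP nw0|] := boolP [forall k : K, w != k *: w0].
        exact: colin AX AX0 XE X0E wu wu0 nzu nzw nzu0 nzw0 nw0.
      rewrite negb_forall => /existsP[l /negPn/eqP wE].
      have nzl : l != 0 by apply: contraNneq nzw => l0; rewrite wE l0 scale0r.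
      (* A nonzero row proportional to [w0] is not proportional to [w1], so [X] can be compared with
         [X1], whose column is a multiple of [u0]. *)
      have nw1 k : w != k *: w1.
        apply/eqP=> wE'; have nzk : k != 0.
          by apply: contraNneq nzw => k0; rewrite wE' k0 scale0r.
        case/negP: (nw10 (k^-1 * l)); apply/eqP.
        by rewrite -scalerA -wE wE' scalerA mulVf // scale1r.
      have [k uE] := colin _ _ _ _ _ _ _ _ AX AX1 XE X1E wu wu1 nzu nzw nzu1 nzw1 nw1.
      by exists (k * k1); rewrite uE u1E scalerA.
    exists (k *: w); split; first by rewrite XE uE -scalemxAl -scalemxAr.
    by rewrite dotZl -dotZr -uE.
  have [w' w'u0] := codot_dual nzu0.
  have nzw' : w' != 0.
    by apply: contra_eq_neq w'u0 => ->; rewrite /dot mul0mx mxE eq_sym oner_eq0.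
  have [a [b [w'a w'b uP]]] := ker_basis nzw'.
  have uQ : col3 u0 a b \in unitmx.
    apply: col3_unitP => x y z E.
    have [] := @unit_col3_free _ _ _ _ y z x (uP _ w'u0); last by move=> -> -> ->.
    by rewrite addrC addrA E.
  apply: (conjR RowUnipotent (col3 u0 a b)) => // X AX.
  have [c [w [XE wu]]] := col0 _ AX.
  have act x : X *m x = c *: x + dot w x *: u0.
    by rewrite XE mulmxDl mul_scalar_mx mulmx_dot.
  have ZE := @mul_col3_mx3 _ X u0 a b [:: c; 0; 0] [:: dot w a; c; 0] [:: dot w b; 0; c].
  rewrite /= !scale0r !addr0 in ZE.
  have {}ZE : X *m col3 u0 a b = col3 u0 a b *m
      mx3 [:: [:: c; dot w a; dot w b]; [:: 0; c; 0]; [:: 0; 0; c]].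
    by apply: ZE; rewrite act ?wu ?scale0r ?addr0 // addrC.
  eexists; last exact: ZE.
  have: X *m col3 u0 a b \in unitmx by rewrite unitmx_mul (lift_unit AX) uQ.
  rewrite ZE unitmx_mul uQ unitmx_triangular /= => nz.
  apply/lift_row_unipotents; exists c, (dot w a), (dot w b); split=> //.
  by apply: contra nz => /eqP ->; rewrite mulr0.
move=> none.
have row0 X : lift A X -> exists c u, X = c%:M + u *m w0 /\ dot w0 u = 0.
  move=> AX; have [c [u [w [XE wu]]]] := rk1 _ AX; exists c.
  have triv : u *m w = 0 -> exists u, X = c%:M + u *m w0 /\ dot w0 u = 0.
    by move=> uw; exists 0; rewrite XE uw mul0mx dot0r.
  have [u_0|nzu] := eqVneq u 0; first by apply: triv; rewrite u_0 mul0mx.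
  have [/forallP nw0|] := boolP [forall k : K, w != k *: w0].
    case: AX XE => m Am mX XE; case/negP: none.
    apply/existsP; exists m; apply/existsP; exists c; apply/existsP; exists u.
    apply/existsP; exists w; rewrite Am mX XE wu nzu !eqxx /=.
    exact/forallP.
  rewrite negb_forall => /existsP[k /negPn/eqP wE].
  exists (k *: u); rewrite XE wE -scalemxAl -scalemxAr; split=> //.
  by rewrite dotZr -dotZl -wE.
have [a [b [wa wb uP]]] := ker_basis nzw0; have [z wz] := dot_dual nzw0.
have uQ := uP z wz.
apply: (conjR ColumnUnipotent (col3 a b z)) => // X AX.
have [c [u [XE wu]]] := row0 _ AX.
have [p [q uE]] := span_ker uP nzw0 wa wb wu.
have act x : X *m x = c *: x + dot w0 x *: u.
  by rewrite XE mulmxDl mul_scalar_mx mulmx_dot.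
have ZE := @mul_col3_mx3 _ X a b z [:: c; 0; 0] [:: 0; c; 0] [:: p; q; c].
rewrite /= !scale0r !addr0 !add0r in ZE.
have {}ZE : X *m col3 a b z = col3 a b z *m
    mx3 [:: [:: c; 0; p]; [:: 0; c; q]; [:: 0; 0; c]].
  by apply: ZE; rewrite act ?wa ?wb ?wz ?scale0r ?addr0 // scale1r -uE addrC.
eexists; last exact: ZE.
have: X *m col3 a b z \in unitmx by rewrite unitmx_mul (lift_unit AX) uQ.
rewrite ZE unitmx_mul uQ unitmx_triangular /= => nz.
apply/lift_column_unipotents; exists c, q, p; split=> //.
by apply: contra nz => /eqP ->; rewrite mulr0.
Qed.

Lemma mxpow_similar g g' P i : g *m P = P *m g' -> mxpow g i *m P = P *m mxpow g' i.
Proof.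
move=> gP; elim: i => [|i IHi]; first by rewrite mulmx1 mul1mx.
by rewrite !mxpowS -mulmxA IHi mulmxA gP -mulmxA.
Qed.

(** Modulo scalars every lift of [A] is a product of powers of [g] and [h]; the matrix carrying one
    pair to the other sends it to the same product in [g'] and [h']. *)
Lemma conj_of_heis_pair A c b g h v g' h' v' : max_abelian A -> occurs K c ->
  3.-primitive_root omega ->
  heis_pair omega b g h v -> lift A g -> lift A h ->
  heis_pair omega b g' h' v' -> lift (rep c) g' -> lift (rep c) h' ->
  exists2 c, occurs K c & conj_in_PGL3 A (rep c).
Proof.
move=> maxA occ prim hp Ag Ah hp' Rg Rh.
have [P [uP gP hP]] := heis_similar prim hp hp'.
have [gR _] := rep_abelian occ.
have /max_abelianP[G [AG abG _]] := maxA; rewrite AG in Ag Ah.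
apply: conj_rep maxA occ uP _ => // X AX; rewrite AG in AX.
have [i [j [k [nzk ->]]]] := lift_heis prim (valP G) abG hp Ag Ah AX.
exists (k *: (mxpow g' i *m mxpow h' j)).
  apply: liftZ => //; apply: (@liftM _ (Group gR)); exact: (lift_mxpow _ gR).
by rewrite -scalemxAl -scalemxAr -mulmxA (mxpow_similar _ hP) mulmxA (mxpow_similar _ gP) mulmxA.
Qed.

Lemma conj_of_twisted A g h : max_abelian A -> lift A g -> lift A h ->
  g *m h != h *m g -> exists2 c, occurs K c & conj_in_PGL3 A (rep c).
Proof.
move=> maxA Ag Ah ncomm; have [ug uh] := (lift_unit Ag, lift_unit Ah).
case/max_abelianP: (maxA) => G [AG abG _].
have cA : forall X Y, lift A X -> lift A Y -> exists c, X *m Y = c *: (Y *m X).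
  by apply/abelian_lift; rewrite AG.
have [l gh] := cA _ _ Ag Ah.
have l3 : l ^+ 3 = 1.
  have := congr1 determinant gh; rewrite detZ !det_mulmx [_ * \det g]mulrC -[LHS]mul1r.
  by move/(mulIf _) => -> //; rewrite mulf_neq0 // -unitfE -unitmxE.
have nl1 : l != 1 by apply: contraNneq ncomm => l1; rewrite gh l1 scale1r.
(* [l] has order 3 in the unit group, whose order is q - 1. *)
have card1 : #|K| = 1 %[mod 3].
  have ul : l \is a GRing.unit.
    by rewrite unitfE; apply/eqP=> l0; move/eqP: l3; rewrite l0 expr0n eq_sym oner_eq0.
  pose U := FinRing.unit K ul.
  have oU : #[U]%g = 3%N.
    apply: nt_prime_order => //.
    by apply: val_inj; rewrite FinRing.val_unitX.
  have := order_dvdG (in_setT U); rewrite oU card_finField_unit => /dvdnP[q qE].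
  by rewrite -(prednK (ltnW (finNzRing_gt1 K))) qE -addn1 modnMDl.
have prim := prim_omega card1; have o3 := cube_root_cube prim.
(* If the twist is [omega ^+ 2], exchanging [g] and [h] turns it into its inverse [omega]. *)
have [g1 [h1 [Ag1 Ah1 gh1]]] : exists g1 h1, [/\ lift A g1, lift A h1 & g1 *m h1 = omega *: (h1 *m g1)].
  have [[[|[|[|//]]] /= _] lE] := prim_rootP prim l3.
  - by rewrite lE expr0 eqxx in nl1.
  - by exists g, h; rewrite gh lE expr1.
  by exists h, g; rewrite gh lE scalerA expr2 mulrA o3 scale1r.
have [b [g2 [h2 [v [Ag2 Ah2 hp]]]]] : exists b g2 h2 v,
    [/\ lift A g2, lift A h2 & heis_pair omega b g2 h2 v].
  apply: (twisted_heis_pair prim) Ag1 Ah1 (lift_unit Ag1) (lift_unit Ah1) gh1.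
    by rewrite AG; exact: liftM.
  by move=> c X nzc; exact: liftZ.
have [/existsP[d /eqP bd]|] := boolP [exists d : K, b == d ^+ 3].
  have [gv nzv nzb gh2 hhh] := hp.
  have nzd : d != 0 by move: nzb; rewrite bd expf_eq0.
  (* Dividing [h2] by a cube root of [b] brings the parameter to 1, that of clock and shift. *)
  have hp1 : heis_pair omega 1 g2 (d^-1 *: h2) v.
    split; rewrite ?oner_neq0 //.
      by rewrite -scalemxAl -scalemxAr gh2 !scalerA mulrC.
    rewrite !(=^~ scalemxAl, =^~ scalemxAr) hhh !scalerA scale_scalar_mx bd.
    by congr _%:M; field.
  have [Rg Rh] := lift_clock_shift prim.
  apply: (conj_of_heis_pair (c := ClockShift) maxA _ prim hp1 Ag2 _ (clock_shift_pair prim)) => //.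
  - exact/eqP.
  - by apply: liftZ; rewrite ?invr_eq0.
rewrite negb_exists => /forallP ncb.
have [g' [h' [v' [Rg Rh hp']]]] := noncube_pair prim bij3 dimL3 ncb.
by apply: (conj_of_heis_pair (c := CubeRootFrobenius) maxA _ prim hp Ag2 Ah2 hp') => //; apply/eqP.
Qed.

Theorem max_abelian_conj A : max_abelian A ->
  exists2 c, occurs K c & conj_in_PGL3 A (rep c).
Proof.
move=> maxA.
have [|allC] := boolP [exists m : {'GL_3[K]}, [exists n : {'GL_3[K]},
  [&& coset (Z3 K) m \in A, coset (Z3 K) n \in A & GLval m *m GLval n != GLval n *m GLval m]]].
  case/existsP=> m /existsP[n /and3P[/mem_lift Am /mem_lift An ncomm]].
  exact: conj_of_twisted maxA Am An ncomm.
have cA X Y : lift A X -> lift A Y -> X *m Y = Y *m X.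
  case=> m Am <- [n An <-]; apply/eqP/negPn/negP=> nc; case/negP: allC.
  by apply/existsP; exists m; apply/existsP; exists n; rewrite Am An.
have [|noncyc] := boolP [exists m : {'GL_3[K]}, [exists v : 'cV[K]_3,
  (coset (Z3 K) m \in A) && (krylov (GLval m) v \in unitmx)]].
  case/existsP=> m /existsP[v /andP[/mem_lift Am uv]].
  exact: (conj_of_cyclic_element maxA cA Am uv).
have rk1 X : lift A X -> exists c u w, X = c%:M + u *m w.
  case=> m Am <-; have [[v uv]|//] := cyclic_or_rank1 (GLval m).
  by case/negP: noncyc; apply/existsP; exists m; apply/existsP; exists v; rewrite Am.
have [|nohom] := boolP [exists m : {'GL_3[K]}, [exists c : K, [exists u : 'cV[K]_3, [exists w : 'rV[K]_3,
  [&& coset (Z3 K) m \in A, GLval m == c%:M + u *m w & dot w u != 0]]]]].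
  case/existsP=> m /existsP[c /existsP[u /existsP[w /and3P[Am /eqP XE nz]]]].
  exact: conj_of_homology maxA cA rk1 Am XE nz.
apply: conj_of_transvections => // X AX; have [c [u [w XE]]] := rk1 X AX.
exists c, u, w; split=> //; case: AX XE => m Am mX XE.
apply/eqP/negPn/negP=> nz; case/negP: nohom; apply/existsP; exists m; apply/existsP; exists c.
by apply/existsP; exists u; apply/existsP; exists w; rewrite Am mX XE eqxx.
Qed.

(** * Invariants of the representatives and separation of the classes *)

Lemma mulby_not_split (R : {set coset_of (Z3 K)}) (x : L3) X : (forall c, x != c%:A) ->
  lift R X -> acts_by phi3 (fun y => x * y) X -> ~ split_lifts R.
Proof.
move=> nKx RX xX /(_ _ RX)[a [b [c X0]]]; have [psi _ psiK] := bij3.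
have sub k : acts_by phi3 (fun y => (x - k%:A) * y) (X - k%:M).
  by move=> v; rewrite mulmxBl mul_scalar_mx linearB linearZ /= xX mulrBl mulr_algl.
(* The product acts as (x - a)(x - b)(x - c), which is nonzero in the field [L3]. *)
have := mulbyM (mulbyM (sub a) (sub b)) (sub c) (psi 1).
rewrite X0 mul0mx linear0 psiK mulr1 => /esym/eqP.
by rewrite !mulf_eq0 !subr_eq0 !(negPf (nKx _)).
Qed.

Lemma cubic_not_split : ~ split_lifts (rep CubicTorus).
Proof.
have [|x nKx] := @nonscalar_ex K L3; first by rewrite dimL3.
have nzx : x != 0 by have := nKx 0; rewrite scale0r.
have [X uX xX] := mulby_ex bij3 nzx.
by apply: (mulby_not_split nKx _ xX); apply/(lift_cubic bij3); exists x.
Qed.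

Lemma quadratic_not_split : ~ split_lifts (rep QuadraticTorus).
Proof.
have [|x nKx] := @nonscalar_ex K L2; first by rewrite dimL2.
have nzx : x != 0 by have := nKx 0; rewrite scale0r.
have [X uX xX] := mulby2_ex bij2 nzx (oner_neq0 K).
have RX : lift (rep QuadraticTorus) X.
  by apply/(lift_quadratic bij2); exists x, 1; rewrite oner_neq0.
case/(_ _ RX)=> a [b [c X0]]; have [psi _ psiK] := bij2.
have sub k : mulby2 phi2 (x - k%:A) (1 - k) (X - k%:M).
  move=> v; rewrite mulmxBl mul_scalar_mx linearB linearZ /= xX.
  by congr (_, _); rewrite /= mulrBl ?mulr_algl.
(* Evaluation at (1, 0) keeps the [L2] coordinate, where the product is nonzero. *)
have := mulby2M (mulby2M (sub a) (sub b)) (sub c) (psi (1, 0)).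
rewrite X0 mul0mx linear0 psiK => /(congr1 fst) /= /esym/eqP.
by rewrite !mulf_eq0 !subr_eq0 !(negPf (nKx _)) oner_eq0.
Qed.

Lemma cubic_no_eigen : ~ eigen_lifts (rep CubicTorus).
Proof.
have [|x nKx] := @nonscalar_ex K L3; first by rewrite dimL3.
have nzx : x != 0 by have := nKx 0; rewrite scale0r.
have [X uX xX] := mulby_ex bij3 nzx.
have RX : lift (rep CubicTorus) X by apply/(lift_cubic bij3); exists x.
case=> v nzv /(_ _ RX)[a /(congr1 phi3)]; rewrite xX linearZ /= -mulr_algl.
move/mulIf=> xa; case/negP: (nKx a); apply/eqP/xa.
by apply: contraNneq nzv => v0; apply/eqP/(bij_inj bij3); rewrite v0 linear0.
Qed.

Lemma quadratic_eigen : eigen_lifts (rep QuadraticTorus).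
Proof.
have [psi _ psiK] := bij2; exists (psi (0, 1)).
  by apply/eqP=> /(congr1 phi2); rewrite psiK linear0 => -[/eqP]; rewrite oner_eq0.
move=> X /(lift_quadratic bij2)[x [d [_ _ xX]]]; exists d.
apply: (bij_inj bij2); rewrite xX linearZ /= psiK /=.
by congr (_, _); rewrite /= mulr0 ?scaler0.
Qed.

Lemma heis_not_commuting c b g h v : 3.-primitive_root omega ->
  heis_pair omega b g h v -> lift (rep c) g -> lift (rep c) h ->
  ~ commuting_lifts (rep c).
Proof.
move=> prim [gv nzv nzb gh hhh] Rg Rh /(_ _ _ Rg Rh); rewrite gh => /eqP.
rewrite -subr_eq0 -[X in _ - X]scale1r -scalerBl scaler_eq0 subr_eq0.
rewrite (negPf (cube_root_neq1 prim)) => /eqP hg0.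
have: h *m g \in unitmx by rewrite unitmx_mul (lift_unit Rg) (lift_unit Rh).
by rewrite hg0 unitmxE det0 unitr0.
Qed.

(** Every lift is [k g^i h^j], whose cube is [k^3] because [g^3 = h^3 = 1]; the roots of X^3 - k^3
    are [k] times the cube roots of unity. *)
Lemma clock_shift_split : occurs K ClockShift -> split_lifts (rep ClockShift).
Proof.
move=> occ X RX; have prim := prim_omega (eqP occ); have [Rg Rh] := lift_clock_shift prim.
have hp := clock_shift_pair prim; have [_ _ _ gh hhh] := hp.
have [gR abR] := rep_abelian occ.
have [i [j [k [nzk XE]]]] := lift_heis prim gR abR hp Rg Rh RX.
have [l [l3 GH]] : exists l, l ^+ 3 = 1 /\
    mxpow (clock omega) i *m mxpow (shift K) j = l *: (mxpow (shift K) j *m mxpow (clock omega) i).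
  exists ((omega ^+ i) ^+ j); split.
    by rewrite exprAC [(omega ^+ i) ^+ 3]exprAC (prim_expr_order prim) !expr1n.
  exact: mxpow_twist (mxpow_twistl i gh).
have cube g : g *m g *m g = 1%:M -> forall n, mxpow g n *m mxpow g n *m mxpow g n = 1%:M.
  move=> ggg n; rewrite -!mxpowD (_ : n + n + n = 3 * n)%N; last by rewrite !mulSn addn0 addnA.
  by rewrite (mxpow3 _ ggg) expr1n.
have XXX : X *m X *m X = (k * k * k)%:M.
  rewrite XE !(=^~ scalemxAl, =^~ scalemxAr) (twisted_mul_cube l3 GH).
  rewrite !cube ?mulmx1 ?scalerA ?scalemx1 ?mulrA //.
  exact: (heis_diag prim hp).
have o3 := cube_root_cube prim; have os := cube_root_sum prim.
exists k, (k * omega), (k * (omega * omega)).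
have E a b c : (X - a%:M) *m (X - b%:M) *m (X - c%:M) =
    X *m X *m X - (a + b + c) *: (X *m X) + (a * b + a * c + b * c) *: X - (a * b * c)%:M.
  rewrite !(mulmxBl, mulmxBr, mul_scalar_mx, mul_mx_scalar, =^~ scalemxAl, =^~ scalemxAr).
  move: (X *m X *m X) (X *m X) => T S; apply/matrixP=> m n; rewrite !mxE.
  by case: (m == n); rewrite ?mulr1n ?mulr0n; ring.
rewrite E XXX.
have -> : k + k * omega + k * (omega * omega) = 0.
  by rewrite -[X in X + _ + _]mulr1 -!mulrDr os mulr0.
have -> : k * (k * omega) + k * (k * (omega * omega)) + k * omega * (k * (omega * omega)) = 0.
  transitivity (k * k * omega * (1 + omega + omega * omega)); first by ring.
  by rewrite os mulr0.
have -> : k * (k * omega) * (k * (omega * omega)) = k * k * k.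
  transitivity (k * k * k * (omega * omega * omega)); first by ring.
  by rewrite o3 mulr1.
by rewrite !scale0r subr0 addr0 subrr.
Qed.

Lemma clock_shift_not_unipotent : occurs K ClockShift -> ~ unipotent_lifts (rep ClockShift).
Proof.
move=> occ; have prim := prim_omega (eqP occ); have [Rg _] := lift_clock_shift prim.
case/(_ _ Rg)=> t /diag_unipotent[t1 to _].
by have := cube_root_neq1 prim; rewrite to t1 eqxx.
Qed.

Lemma cube_root_frobenius_not_split : occurs K CubeRootFrobenius ->
  ~ split_lifts (rep CubeRootFrobenius).
Proof.
move=> occ; have prim := prim_omega (eqP occ); have [b ncb] := noncube_ex prim.
have [x x3] := noncube_root dimL3 ncb.
have nKx c : x != c%:A.
  apply: contraNneq (ncb c) => xc; apply/eqP/(fmorph_inj (in_alg L3)).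
  by rewrite /= -x3 xc -in_algE -rmorphXn.
have nzx : x != 0 by have := nKx 0; rewrite scale0r.
have [X uX xX] := mulby_ex bij3 nzx.
by apply: (mulby_not_split nKx _ xX); apply: (lift_cube_root bij3) x3 xX.
Qed.

Definition commuting_class c := if c is (ClockShift | CubeRootFrobenius) then false else true.
Definition split_class c :=
  if c is (CubicTorus | QuadraticTorus | CubeRootFrobenius) then false else true.
Definition unipotent_class c :=
  if c is (Jordan3 | ColumnUnipotent | RowUnipotent) then true else false.

Lemma commuting_classP c : occurs K c -> commuting_lifts (rep c) <-> commuting_class c.
Proof.
case: c => occ; split=> // cR; try (by exfalso).
- exact: cubic_comm.
- exact: quadratic_comm.
- exact: diagonals_comm.
- exact: jordan21_comm.
- exact: jordan3_comm.
- exact: column_unipotents_comm.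
- exact: row_unipotents_comm.
- have prim := prim_omega (eqP occ); have [Rg Rh] := lift_clock_shift prim.
  by case: (heis_not_commuting (c := ClockShift) prim (clock_shift_pair prim) Rg Rh).
have prim := prim_omega (eqP occ); have [b ncb] := noncube_ex prim.
have [g [h [v [Rg Rh hp]]]] := noncube_pair prim bij3 dimL3 ncb.
by case: (heis_not_commuting (c := CubeRootFrobenius) prim hp Rg Rh).
Qed.

Lemma split_classP c : occurs K c -> split_lifts (rep c) <-> split_class c.
Proof.
case: c => occ; split=> // sR.
- by case: cubic_not_split.
- by case: quadratic_not_split.
- exact: diagonals_split.
- exact: jordan21_split.
- exact/unipotent_split/jordan3_unipotent.
- exact/unipotent_split/quadratic_unipotent/column_unipotents_quadratic.
- exact/unipotent_split/quadratic_unipotent/row_unipotents_quadratic.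
- exact: clock_shift_split.
by case: (cube_root_frobenius_not_split occ).
Qed.

Lemma unipotent_classP c : occurs K c -> unipotent_lifts (rep c) <-> unipotent_class c.
Proof.
case: c => occ; split=> // uR.
- by case: cubic_not_split; exact: unipotent_split.
- by case: quadratic_not_split; exact: unipotent_split.
- by case: (diagonals_not_unipotent occ).
- by case: (jordan21_not_unipotent occ).
- exact: jordan3_unipotent.
- exact/quadratic_unipotent/column_unipotents_quadratic.
- exact/quadratic_unipotent/row_unipotents_quadratic.
- by case: (clock_shift_not_unipotent occ).
by case: (cube_root_frobenius_not_split occ); exact: unipotent_split.
Qed.

(** Commuting, split and unipotent lifts together isolate [ClockShift] and [CubeRootFrobenius] and
    leave three families. A common eigenvector separates [QuadraticTorus] from [CubicTorus], a
    transvection [Jordan21] from [SplitTorus]; quadratic lifts set [Jordan3] apart from the other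
    two unipotent classes, which a common row distinguishes. *)
Theorem rep_conj_inj c c' : occurs K c -> occurs K c' ->
  conj_in_PGL3 (rep c) (rep c') -> c = c'.
Proof.
move=> occ occ' cc'.
have same (Pr : {set coset_of (Z3 K)} -> Prop) (cls : pgl3_class -> bool) :
    conj_invariant Pr -> (forall d, occurs K d -> Pr (rep d) <-> cls d) -> cls c = cls c'.
  move=> inv PrP; have [PP' P'P] := conj_invariantP inv cc'.
  apply/idP/idP=> [/(proj2 (PrP c occ))/PP'|/(proj2 (PrP c' occ'))/P'P].
    exact: (proj1 (PrP c' occ')).
  exact: (proj1 (PrP c occ)).
have := same _ _ (@commuting_lifts_conj K) commuting_classP.
have := same _ _ (@split_lifts_conj K) split_classP.
have := same _ _ (@unipotent_lifts_conj K) unipotent_classP.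
have eq1 := conj_invariantP (@eigen_lifts_conj K) cc'.
have eq2 := conj_invariantP (@has_quadratic_lift_conj K) cc'.
have eq3 := conj_invariantP (@quadratic_lifts_conj K) cc'.
have eq4 := conj_invariantP (@common_row_lifts_conj K) cc'.
case: c occ {same cc'} eq1 eq2 eq3 eq4 => occ; case: c' occ' => occ' // eq1 eq2 eq3 eq4 _ _ _.
- by case: cubic_no_eigen; apply/eq1/quadratic_eigen.
- by case: cubic_no_eigen; apply/eq1/quadratic_eigen.
- by case: (@diagonals_no_quadratic K); apply/eq2/jordan21_has_quadratic.
- by case: (@diagonals_no_quadratic K); apply/eq2/jordan21_has_quadratic.
- by case: (@jordan3_not_quadratic K); apply/eq3/column_unipotents_quadratic.
- by case: (@jordan3_not_quadratic K); apply/eq3/row_unipotents_quadratic.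
- by case: (@jordan3_not_quadratic K); apply/eq3/column_unipotents_quadratic.
- by case: (@row_unipotents_no_row K); apply/eq4/column_unipotents_row.
- by case: (@jordan3_not_quadratic K); apply/eq3/row_unipotents_quadratic.
by case: (@row_unipotents_no_row K); apply/eq4/column_unipotents_row.
Qed.

Lemma clock_shift_isog : #|K| = 1 %[mod 3] -> rep ClockShift \isog [set: 'Z_3 * 'Z_3].
Proof.
move=> card1; have occ : occurs K ClockShift by apply/eqP.
have prim := prim_omega card1; have [Rg Rh] := lift_clock_shift prim.
have [gR abR] := rep_abelian occ.
by apply: (heis_isog prim gR abR (clock_shift_pair prim)); [exact: Rg | exact: Rh].
Qed.

Lemma cube_root_frobenius_isog :
  #|K| = 1 %[mod 3] -> rep CubeRootFrobenius \isog [set: 'Z_3 * 'Z_3].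
Proof.
move=> card1; have occ : occurs K CubeRootFrobenius by apply/eqP.
have prim := prim_omega card1; have [b ncb] := noncube_ex prim.
have [gR abR] := rep_abelian occ.
have [g [h [v [Rg Rh hp]]]] := noncube_pair prim bij3 dimL3 ncb.
by apply: (heis_isog prim gR abR hp); [exact: Rg | exact: Rh].
Qed.

End Classification.

Theorem proposition3p1 (K : finFieldType) (L2 L3 : fieldExtType K)
    (dimL2 : \dim {:L2} = 2%N) (dimL3 : \dim {:L3} = 3%N)
    (phi2 : {linear 'cV[K]_3 -> (L2 * K^o)%type}) (bij2 : bijective phi2)
    (phi3 : {linear 'cV[K]_3 -> L3}) (bij3 : bijective phi3)
    (omega : K)
    (prim_omega : #|K| = 1 %[mod 3] -> 3.-primitive_root omega) :
  let rep := representative omega phi2 phi3 in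
  [/\ (* the maximal abelian subgroups, up to conjugacy *)
      forall A : {set coset_of (Z3 K)},
        max_abelian A <->
        exists2 c : pgl3_class, occurs K c & conj_in_PGL3 A (rep c),
      (* the list has no repetition *)
      forall c c' : pgl3_class, occurs K c -> occurs K c' ->
        conj_in_PGL3 (rep c) (rep c') -> c = c'
    & (* isomorphism types *)
      [/\ cyclic (rep CubicTorus),
          rep SplitTorus \isog [set: {unit K} * {unit K}],
          rep Jordan21 \isog [set: {unit K} * K],
          (odd #|K| -> rep Jordan3 \isog [set: K * K]) /\
          (forall d : nat, #|K| = (2 ^ d)%N ->
             rep Jordan3 \isog [set: 'rV['Z_4]_d])
        & [/\ rep ColumnUnipotent \isog [set: K * K],
              rep RowUnipotent \isog [set: K * K]
            & #|K| = 1 %[mod 3] ->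
              rep ClockShift \isog [set: 'Z_3 * 'Z_3] /\
              rep CubeRootFrobenius \isog [set: 'Z_3 * 'Z_3]]]].
Proof.
move=> rep; split.
- move=> A; split; first exact: max_abelian_conj.
  by case=> c occ [x _ ->]; apply: max_abelianJ; exact: rep_max.
- by move=> c c'; exact: rep_conj_inj.
split.
- exact: cubic_cyclic.
- exact: diagonals_isog.
- exact: jordan21_isog.
- by split; [exact: jordan3_isog_odd | exact: jordan3_isog_even].
split.
- exact: column_unipotents_isog.
- exact: row_unipotents_isog.
by move=> card1; split; [exact: clock_shift_isog | exact: cube_root_frobenius_isog].
Qed.
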